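(* Let $\mathbf{C}_0$ be a full subcategory of $\mathbf{NG}_0$ such that (i) $\mathbf{C}_0$ contains all finite CW-complexes; (ii) $\mathbf{C}_0$ is closed under finite wedge sums; (iii) if $A\subset X$ is an inclusion of objects in $\mathbf{C}_0$ then its cofiber $X\cup CA$ belongs to $\mathbf{C}_0$ (in particular $\mathbf{C}_0$ is closed under suspension). For every bilinear functor $F\colon\mathbf{C}_0^{\mathrm{op}}\times\mathbf{C}_0\to\mathbf{NG}_0$, there exist a generalized homology theory $X\mapsto\{h_n(X;F)\}_{n\in\mathbf{Z}}$ and a generalized cohomology theory $X\mapsto\{h^n(X;F)\}_{n\in\mathbf{Z}}$ on $\mathbf{C}_0$ such that $$h_n(X;F)\cong\pi_0F(S^{n+k},\Sigma^kX),\qquad h^n(X;F)\cong\pi_0F(\Sigma^kX,S^{n+k})$$ hold whenever $k,\,n+k\ge0$. Moreover, $h_n(X;F)$ is naturally isomorphic to the $n$-th homology group $h_n(X;T)$ given by the covariant part $T$ of $F$, where $TX=F(S^0,X)$.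
   Context: A topological space is numerically generated if it has the final topology with respect to its singular simplexes (continuous maps from $\Delta^n$, $n\ge0$); $\mathbf{NG}_0$ is the category of pointed numerically generated spaces and pointed continuous maps. For a space $X$, $\nu X$ is its underlying set with the final topology with respect to its singular simplexes. $\mathbf{NG}_0$ is closed symmetric monoidal under the smash product $\wedge$ (the quotient of the product in $\mathbf{NG}_0$, i.e. $\nu$ of the topological product, by the wedge), with internal hom $F_0(X,Y)=Y^X=\nu\,\mathbf{smap}_0(X,Y)$. Here, for pointed spaces, $\mathbf{smap}_0(X,Y)$ is the set of pointed maps $f$ such that $f\sigma$ is continuous for every singular simplex $\sigma\colon \Delta^n\to X$, with the initial topology with respect to the maps $f\mapsto f\sigma\in\mathbf{map}(\Delta^n,Y)$ (compact-open topology), and basepoint the constant map. A bifunctor $F\colon\mathbf{C}_0^{\mathrm{op}}\times\mathbf{C}_0\to\mathbf{NG}_0$ (contravariant in the first, covariant in the second argument) is enriched if for all objects $X,X',Y,Y'$ the map $F_0(X',X)\times F_0(Y,Y')\to F_0(F(X,Y),F(X',Y'))$, $(f,g)\mapsto F(f,g)$, is continuous, and $F(f,g)$ is constant whenever $f$ or $g$ is constant. By adjunction, each partial functor carries a pointed homotopy $I_+\wedge Y\to Y'$ to a pointed homotopy between the induced maps. For $f\colon X\to Y$ let $E(f)=\{(x,l)\in X\times\mathbf{map}(I,Y)\mid f(x)=l(0)\}$, $p\colon E(f)\to Y$, $p(x,l)=l(1)$, and let $F(f)$ be the fiber of $p$ over the basepoint. A sequence of pointed maps $Z\xrightarrow{i}X\xrightarrow{f}Y$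 is a homotopy fibration sequence (with respect to a given pointed homotopy from $f\circ i$ to the constant map) if the induced map $Z\to F(f)$ is a weak homotopy equivalence. An enriched bifunctor $F$ is bilinear if for all pairs of objects $A\subset X$ and $B\subset Y$ of $\mathbf{C}_0$ the sequences $$F(X\cup CA,Y)\to F(X,Y)\to F(A,Y),\qquad F(X,B)\to F(X,Y)\to F(X,Y\cup CB)$$ are homotopy fibration sequences, with respect to the null homotopies coming from the contraction of $A$ in the reduced cone $CA$ and of $B$ in $CB$. In particular $T=F(S^0,-)$ is a linear enriched functor: $f\mapsto Tf$ gives continuous pointed maps $F_0(X,Y)\to F_0(TX,TY)$ and each sequence $TA\to TX\to T(X\cup CA)$ is a homotopy fibration sequence with respect to the null homotopy coming from the contraction of $A$ in $CA$. A generalized homology theory on $\mathbf{C}_0$ is a sequence of functors $h_n$ ($n\in\mathbf{Z}$) from $\mathbf{C}_0$ to abelian groups with natural isomorphisms $h_n(X)\cong h_{n+1}(\Sigma X)$, satisfying the homotopy axiom and the exactness axiom ($h_n(A)\to h_n(X)\to h_n(X\cup CA)$ is exact for every pair $A\subset X$ of objects). A generalized cohomology theory is defined dually: contravariant functors $h^n$ with natural isomorphisms $h^{n+1}(\Sigma X)\cong h^n(X)$, homotopy invariant, with $h^n(X\cup CA)\to h^n(X)\to h^n(A)$ exact. For a linear enriched functor $T$, the homology theory $h_n(X;T)$ is given by $h_n(X;T)=\pi_nTX$ for $n\ge0$ and $h_n(X;T)=\pi_0T(\Sigma^{-n}X)$ for $n<0$, with homomorphisms induced by $Tf$ and $T(\Sigma^{-n}f)$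 respectively. The group operation on $\pi_nTX$ (including $n=0$) is the composite $\pi_nTX\times\pi_nTX\cong\pi_nT(X\vee X)\to\pi_nTX$, where the first isomorphism is the inverse of the map induced by the two projections $X\vee X\to X$ and the second is induced by the folding map $X\vee X\to X$. The group operation on $\pi_0F(X,Y)$ is the one obtained in this way from the linear functor $F(X,-)$. *)

(* Defs.v *)
From HB Require Import structures.
From mathcomp Require Import all_boot all_order all_algebra generic_quotient.
From mathcomp Require Import all_classical all_reals all_analysis.
From mathcomp Require Import wedge_sigT.
From Stdlib Require Import Relation_Operators.

Set Implicit Arguments.
Unset Strict Implicit.
Unset Printing Implicit Defensive.

Import Order.TTheory GRing.Theory Num.Theory.
Import numFieldNormedType.Exports.

Local Open Scope classical_set_scope.
Local Open Scope ring_scope.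
Local Open Scope quotient_scope.

Section gen_quotient.
Context {T : choiceType} (r : T -> T -> Prop).

Definition gen_eqb (x y : T) : bool := `[< clos_refl_sym_trans T r x y >].

Lemma gen_eqb_refl : reflexive gen_eqb.
Proof. by move=> x; apply/asboolP; exact: rst_refl. Qed.

Lemma gen_eqb_sym : symmetric gen_eqb.
Proof.
by move=> x y; apply/idP/idP => /asboolP h; apply/asboolP; exact: rst_sym.
Qed.

Lemma gen_eqb_trans : transitive gen_eqb.
Proof.
move=> y x z /asboolP xy /asboolP yz; apply/asboolP; exact: rst_trans xy yz.
Qed.

Definition gen_eqv := EquivRel gen_eqb gen_eqb_refl gen_eqb_sym gen_eqb_trans.

Definition gen_quot := {eq_quot gen_eqv}.

HB.instance Definition _ := Quotient.on gen_quot.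
HB.instance Definition _ := Choice.on gen_quot.

Definition gen_pi (x : T) : gen_quot := \pi_gen_quot x.

Lemma gen_piP (x y : T) :
  gen_pi x = gen_pi y <-> clos_refl_sym_trans T r x y.
Proof.
split=> [/eqmodP /asboolP //|xy]; by apply/eqmodP/asboolP.
Qed.

Lemma gen_pi_rel (x y : T) : r x y -> gen_pi x = gen_pi y.
Proof. by move=> rxy; apply/gen_piP; exact: rst_step. Qed.

Lemma gen_reprK (z : gen_quot) : gen_pi (repr z) = z.
Proof. exact: reprK. Qed.

Lemma gen_lift_pi (Z : Type) (f : T -> Z) :
  (forall x y, r x y -> f x = f y) -> forall x, f (repr (gen_pi x)) = f x.
Proof.
move=> fr x; have fE a b : clos_refl_sym_trans T r a b -> f a = f b.
  by elim=> [{}a {}b /fr //|//|{}a {}b _ ->//|{}a {}b c _ -> _ ->].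
by apply: fE; apply/gen_piP; exact: gen_reprK.
Qed.

End gen_quotient.

Definition top_quot {T : topologicalType} (r : T -> T -> Prop) : Type :=
  quotient_topology (gen_quot r).
HB.instance Definition _ (T : topologicalType) (r : T -> T -> Prop) :=
  Topological.on (top_quot r).
HB.instance Definition _ (T : ptopologicalType) (r : T -> T -> Prop) :=
  PointedTopological.on (top_quot r).

Definition tq_pi {T : topologicalType} {r : T -> T -> Prop} (x : T) :
  top_quot r := gen_pi r x.

Lemma tq_pi_continuous (T : topologicalType) (r : T -> T -> Prop) :
  continuous (@tq_pi T r).
Proof. exact: (@pi_continuous T (gen_quot r)). Qed.

Lemma tq_continuous (T Z : topologicalType) (r : T -> T -> Prop)
  (f : top_quot r -> Z) : continuous (f \o tq_pi) -> continuous f.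
Proof. by move=> cf; apply/(@quotient_continuous T (gen_quot r) Z f). Qed.
Arguments tq_continuous {T Z r f}.

HB.instance Definition _ (X Y : ptopologicalType) := Pointed.on (X * Y)%type.

Lemma comp_continuous (X Y Z : topologicalType) (f : X -> Y) (g : Y -> Z) :
  continuous f -> continuous g -> continuous (g \o f).
Proof. by move=> cf cg x; apply: continuous_comp; [exact: cf|exact: cg]. Qed.

Lemma pair_continuous (X Y Z : topologicalType) (f : X -> Y) (g : X -> Z) :
  continuous f -> continuous g -> continuous (fun x => (f x, g x)).
Proof. by move=> cf cg x; apply: cvg_pair; [exact: cf|exact: cg]. Qed.

Section simplices.
Context (R : realType).

Definition simplex (n : nat) : Type :=
  set_type [set t : 'rV[R]_n.+1 |
    (forall i, 0 <= t ord0 i) /\ \sum_i t ord0 i = 1].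
HB.instance Definition _ n := Topological.on (simplex n).

Definition simplex_open (X : topologicalType) (U : set X) : Prop :=
  forall n (s : simplex n -> X), continuous s -> open (s @^-1` U).

Definition numerically_generated (X : topologicalType) : Prop :=
  forall U : set X, simplex_open U -> open U.

Lemma open_simplex_open (X : topologicalType) (U : set X) :
  open U -> simplex_open U.
Proof. by move=> oU n s /continuousP; exact. Qed.

End simplices.

(* the set X with the final topology for its singular simplexes *)
Definition nu (R : realType) (X : topologicalType) : Type := X.

Section nu.
Context (R : realType).

HB.instance Definition _ (X : topologicalType) := Choice.on (nu R X).
HB.instance Definition _ (X : ptopologicalType) := Pointed.on (nu R X).

Section open.
Context (X : topologicalType).

Definition nu_open : set_system (nu R X) := @simplex_open R X.

Lemma nu_openT : nu_open setT.
Proof. by move=> n s _; rewrite preimage_setT; exact: openT. Qed.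

Lemma nu_openI : setI_closed nu_open.
Proof. by move=> A B oA oB n s cs; exact: openI (oA n s cs) (oB n s cs). Qed.

Lemma nu_open_bigU (I : Type) (f : I -> set (nu R X)) :
  (forall i, nu_open (f i)) -> nu_open (\bigcup_i f i).
Proof.
move=> of_ n s cs; rewrite preimage_bigcup; apply: bigcup_open => i _.
exact: of_.
Qed.

HB.instance Definition _ :=
  isOpenTopological.Build (nu R X) nu_openT nu_openI nu_open_bigU.

Lemma nu_id_continuous : continuous (id : nu R X -> X).
Proof. by apply/continuousP => U; exact: open_simplex_open. Qed.

Lemma nu_continuous (Y : topologicalType) (f : X -> Y) :
  continuous f -> continuous (f : nu R X -> Y).
Proof.
move=> /continuousP cf; apply/continuousP => U /cf; exact: open_simplex_open.
Qed.

Lemma nu_simplexP n (s : simplex R n -> X) :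
  continuous s <-> continuous (s : simplex R n -> nu R X).
Proof.
split=> cs; first by apply/continuousP => U; exact.
apply/continuousP => U oU.
by have /continuousP := cs; apply; exact: open_simplex_open.
Qed.

Lemma nu_ng : numerically_generated R (nu R X).
Proof.
move=> U oU; rewrite (_ : open U = nu_open U)// => n s cs.
by apply: oU; apply/nu_simplexP.
Qed.

End open.

HB.instance Definition _ (X : ptopologicalType) := Topological.on (nu R X).

Lemma nu_fst_continuous (X Y : topologicalType) :
  continuous (fst : nu R (X * Y)%type -> X).
Proof. by apply: nu_continuous => z; exact: cvg_fst. Qed.

Lemma nu_snd_continuous (X Y : topologicalType) :
  continuous (snd : nu R (X * Y)%type -> Y).
Proof. by apply: nu_continuous => z; exact: cvg_snd. Qed.

Lemma ng_nu_continuous (X Y : topologicalType) (f : X -> Y) :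
  numerically_generated R X -> continuous f -> continuous (f : X -> nu R Y).
Proof.
move=> ngX cf; apply/continuousP => U; rewrite (_ : open U = nu_open U)// => oU.
apply: ngX => n s cs; apply: oU (f \o s) _ => x.
exact: continuous_comp (cs x) (cf (s x)).
Qed.

Lemma ng_continuous (X Y : topologicalType) (f : X -> Y) :
  numerically_generated R X ->
  (forall n (s : simplex R n -> X), continuous s -> continuous (f \o s)) ->
  continuous f.
Proof.
move=> ngX cf; apply/continuousP => U oU; apply: ngX => n s cs.
by have /continuousP := cf n s cs; exact.
Qed.

Lemma ng_top_quot (X : topologicalType) (r : X -> X -> Prop) :
  numerically_generated R X -> numerically_generated R (top_quot r).
Proof.
move=> ngX U oU; apply: ngX => n s cs; apply: oU (tq_pi \o s) _ => x.
apply: continuous_comp; [exact: cs|exact: tq_pi_continuous].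
Qed.

Lemma ng_wedge (I : choiceType) (X : I -> topologicalType)
    (p0 : forall i, X i) :
  (forall i, numerically_generated R (X i)) ->
  numerically_generated R (wedge p0).
Proof.
move=> ngX U oU; apply/wedge_openP => i; apply: ngX => n s cs.
apply: oU (@wedge_lift I X p0 i \o s) _ => x.
apply: continuous_comp; [exact: cs|exact: wedge_lift_continuous].
Qed.

Lemma ng_discrete (X : discreteTopologicalType) : numerically_generated R X.
Proof. by move=> U _; exact: discrete_open. Qed.

End nu.

Record NG0 (R : realType) := MkNG0 {
  ng_space :> ptopologicalType;
  ngP : numerically_generated R ng_space }.

Record smap0 (R : realType) (X Y : ptopologicalType) := MkSmap0 {
  smap0_fun :> X -> Y;
  smap0_pt : smap0_fun point = point;
  smap0_simplex : forall n (s : simplex R n -> X),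
    continuous s -> continuous (smap0_fun \o s) }.

Section smap0.
Context (R : realType).

Lemma smap0_eq (X Y : ptopologicalType) (f g : smap0 R X Y) :
  f =1 g -> f = g.
Proof.
case: f g => [f fp fs] [g gp gs] /= /funext fg; move: fp fs gp gs.
by rewrite fg => *; congr MkSmap0; exact: Prop_irrelevance.
Qed.

Lemma smap0_cst_simplex (X Y : ptopologicalType) n (s : simplex R n -> X) :
  continuous s -> continuous ((fun _ : X => point : Y) \o s).
Proof. by move=> _; exact: cst_continuous. Qed.

Definition smap0_cst (X Y : ptopologicalType) : smap0 R X Y :=
  MkSmap0 (erefl : (fun=> point : Y) (point : X) = point)
    (@smap0_cst_simplex X Y).

HB.instance Definition _ (X Y : ptopologicalType) := gen_eqMixin (smap0 R X Y).
HB.instance Definition _ (X Y : ptopologicalType) :=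
  gen_choiceMixin (smap0 R X Y).
HB.instance Definition _ (X Y : ptopologicalType) :=
  isPointed.Build (smap0 R X Y) (smap0_cst X Y).

Definition precomp_simplex (X Y : ptopologicalType)
    (s : {n : nat & continuousType (simplex R n) X}) (f : smap0 R X Y) :
  {compact-open, simplex R (projT1 s) -> Y} := f \o projT2 s.

(* map(Delta^n, Y) is topologized as a subspace of all functions, so it may be
   replaced by the latter in the definition of the initial topology *)
HB.instance Definition _ (X Y : ptopologicalType) :=
  Topological.copy (smap0 R X Y)
    (sup_topology (fun s : {n : nat & continuousType (simplex R n) X} =>
       Topological.class (initial_topology (@precomp_simplex X Y s)))).

Definition F0 (X Y : NG0 R) : NG0 R :=
  @MkNG0 R (nu R (smap0 R X Y)) (@nu_ng R (smap0 R X Y)).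

(* For objects of NG_0, smap_0(X, Y) is the set of pointed continuous maps;
   it therefore serves as the set of morphisms of NG_0. *)
Lemma smap0_continuous (X : NG0 R) (Y : ptopologicalType) (f : smap0 R X Y) :
  continuous f.
Proof. apply: ng_continuous (@ngP R X) _; exact: smap0_simplex. Qed.

Lemma continuous_smap0 (X Y : ptopologicalType) (f : X -> Y) :
  continuous f -> forall n (s : simplex R n -> X),
  continuous s -> continuous (f \o s).
Proof.
by move=> cf n s cs x; apply: continuous_comp; [exact: cs|exact: cf].
Qed.

Definition mk_smap0 (X Y : ptopologicalType) (f : X -> Y) (cf : continuous f)
    (fp : f point = point) : smap0 R X Y := MkSmap0 fp (continuous_smap0 cf).

Lemma id_continuous' (X : ptopologicalType) : continuous (id : X -> X).
Proof. by move=> x. Qed.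

Definition idm (X : NG0 R) : smap0 R X X :=
  mk_smap0 (@id_continuous' X) erefl.

Lemma compm_pt (X Y Z : NG0 R) (g : smap0 R Y Z) (f : smap0 R X Y) :
  (g \o f) point = point.
Proof. by rewrite /= !smap0_pt. Qed.

Lemma compm_continuous (X Y Z : NG0 R) (g : smap0 R Y Z) (f : smap0 R X Y) :
  continuous (g \o f).
Proof. by move=> x; apply: continuous_comp; exact: smap0_continuous. Qed.

Definition compm (X Y Z : NG0 R) (g : smap0 R Y Z) (f : smap0 R X Y) :
  smap0 R X Z := mk_smap0 (compm_continuous (g := g) (f := f)) (compm_pt g f).

End smap0.

Arguments mk_smap0 {R X Y f} cf fp.

Definition to_set (T : Type) (A : set T) (x : T) (Ax : x \in A) : set_type A :=
  exist (fun x => x \in A) x Ax.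

Definition unitI (R : realType) : Type := set_type (`[0, 1]%classic : set R).

Section unitI.
Context (R : realType).
HB.instance Definition _ := Topological.on (unitI R).

Lemma mem_I0 : (0 : R) \in (`[0, 1]%classic : set R).
Proof. by rewrite inE /= in_itv /= lexx ler01. Qed.
Lemma mem_I1 : (1 : R) \in (`[0, 1]%classic : set R).
Proof. by rewrite inE /= in_itv /= lexx ler01. Qed.

Definition I0 : unitI R := to_set mem_I0.
Definition I1 : unitI R := to_set mem_I1.

HB.instance Definition _ := isPointed.Build (unitI R) I1.

Let seg (u : R) : 'rV[R]_2 := delta_mx 0 0 + u *: (delta_mx 0 1 - delta_mx 0 0).

Let segE0 u : seg u 0 0 = 1 - u.
Proof. by rewrite !mxE /= mulr0n mulr1n sub0r mulrN1. Qed.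
Let segE1 u : seg u 0 1 = u.
Proof. by rewrite !mxE /= mulr0n mulr1n subr0 mulr1 add0r. Qed.

Let seg_simplex (u : unitI R) : seg (val u) \in
  [set t : 'rV[R]_2 | (forall i, 0 <= t ord0 i) /\ \sum_i t ord0 i = 1].
Proof.
have := set_mem (valP u); rewrite /= in_itv /= => /andP[u0 u1].
apply/mem_set; split.
  move=> i; have : (i == 0) || (i == 1) by case: i => -[|[|]].
  by case/orP => /eqP ->; rewrite ?segE0 ?segE1 ?subr_ge0.
by rewrite big_ord_recl big_ord1 segE0 (_ : lift _ _ = 1) ?segE1 ?subrK//;
  exact/val_inj.
Qed.

Let to_simplex (u : unitI R) : simplex R 1 := to_set (seg_simplex u).

Let to_simplex_continuous : continuous to_simplex.
Proof.
apply: continuous_comp_initial => u.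
apply: (@continuous_comp _ _ _ set_val seg); first exact: initial_continuous.
by apply: cvgD; [exact: cvg_cst|apply: cvgZr_tmp; exact: cvg_id].
Qed.

Let simplex_coord_itv (t : simplex R 1) :
  (val t : 'rV[R]_2) 0 1 \in (`[0, 1]%classic : set R).
Proof.
have := set_mem (valP t); move: (val t) => {}t -[t0]; rewrite big_ord_recl big_ord1.
rewrite (_ : lift _ _ = 1); last exact/val_inj.
by move=> t1; apply/mem_set; rewrite /= in_itv /= t0 /= -t1 lerDr t0.
Qed.

Let of_simplex (t : simplex R 1) : unitI R := to_set (simplex_coord_itv t).

Let of_simplex_continuous : continuous of_simplex.
Proof.
apply: continuous_comp_initial => t.
apply: (@continuous_comp _ _ _ set_val (fun M : 'rV[R]_2 => M 0 1)).
  exact: initial_continuous.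
exact: coord_continuous.
Qed.

Lemma ng_unitI : numerically_generated R (unitI R).
Proof.
move=> U oU; rewrite (_ : U = to_simplex @^-1` (of_simplex @^-1` U)).
  by move/continuousP: to_simplex_continuous; apply; exact: oU.
by apply/seteqP; split => u /=; congr U; apply/val_inj; rewrite /= segE1.
Qed.

End unitI.

Definition cube (R : realType) (n : nat) : Type := {ptws 'I_n -> unitI R}.
HB.instance Definition _ R n := Topological.on (cube R n).

Section homotopy_groups.
Context (R : realType).

Definition cube_boundary n (t : cube R n) : Prop :=
  exists i : 'I_n, t i = I0 R \/ t i = I1 R.

Record cube_map n (X : topologicalType) (x : X) := MkCubeMap {
  cube_fun :> cube R n -> X;
  cube_continuous : continuous cube_fun;
  cube_base : forall t, cube_boundary t -> cube_fun t = x }.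

HB.instance Definition _ n (X : topologicalType) (x : X) :=
  gen_eqMixin (cube_map n x).
HB.instance Definition _ n (X : topologicalType) (x : X) :=
  gen_choiceMixin (cube_map n x).

Definition cube_homotopic n (X : topologicalType) (x : X)
    (f g : cube_map n x) : Prop :=
  exists H : (unitI R * cube R n)%type -> X,
    [/\ continuous H, (forall t, H (I0 R, t) = f t),
        (forall t, H (I1 R, t) = g t) &
        forall s t, cube_boundary t -> H (s, t) = x].

(* The n-th homotopy set of X at x; since I^0 is a point with empty boundary,
   [hpi 0 x] is the set of path components of X. Homotopy is already an
   equivalence relation, so that generating one does not identify more maps. *)
Definition hpi n (X : topologicalType) (x : X) : Type :=
  gen_quot (@cube_homotopic n X x).
HB.instance Definition _ n (X : topologicalType) (x : X) :=
  Choice.on (hpi n x).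

Definition pi_class n (X : topologicalType) (x : X) (f : cube_map n x) :
  hpi n x := gen_pi _ f.

Definition cube_cst n (X : topologicalType) (x : X) : cube_map n x :=
  MkCubeMap (@cst_continuous (cube R n) X x) (fun _ _ => erefl x).

Lemma cube_comp_continuous n (X Y : topologicalType) (f : X -> Y)
    (cf : continuous f) (x : X) (g : cube_map n x) : continuous (f \o g).
Proof.
move=> t; apply: continuous_comp; [exact: cube_continuous|exact: cf].
Qed.

Lemma cube_comp_base n (X Y : topologicalType) (f : X -> Y) (x : X) (y : Y)
    (fx : f x = y) (g : cube_map n x) t :
  cube_boundary t -> (f \o g) t = y.
Proof. by move=> /(cube_base g) /= ->. Qed.

Definition cube_comp n (X Y : topologicalType) (f : X -> Y)
    (cf : continuous f) (x : X) (y : Y) (fx : f x = y) (g : cube_map n x) :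
  cube_map n y :=
  MkCubeMap (@cube_comp_continuous n X Y f cf x g) (@cube_comp_base n X Y f x y fx g).

Definition pi_map n (X Y : topologicalType) (f : X -> Y)
    (cf : continuous f) (x : X) (y : Y) (fx : f x = y) (c : hpi n x) : hpi n y :=
  pi_class (cube_comp cf fx (repr c)).

Lemma pi_mapE n (X Y : topologicalType) (f : X -> Y)
    (cf : continuous f) (x : X) (y : Y) (fx : f x = y) (g : cube_map n x) :
  pi_map cf fx (pi_class g) = pi_class (cube_comp cf fx g).
Proof.
apply: (gen_lift_pi (f := fun g => pi_class (cube_comp cf fx g))).
move=> {}g h [H [cH H0 H1 Hb]]; apply: gen_pi_rel; exists (f \o H); split.
- by move=> z; apply: continuous_comp; [exact: cH|exact: cf].
- by move=> t /=; rewrite H0.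
- by move=> t /=; rewrite H1.
- by move=> s t /(Hb s) /= ->.
Qed.

(* Isomorphism on homotopy sets at all basepoints; Z is pointed, hence
   nonempty, so n = 0 gives the bijection between path components. *)
Definition weak_equivalence (Z : ptopologicalType) (W : topologicalType)
    (f : Z -> W) : Prop :=
  exists cf : continuous f,
    forall n (z : Z), bijective (@pi_map n Z W f cf z (f z) erefl).

Definition pi_mor n (X Y : NG0 R) (f : smap0 R X Y) :
    hpi n (point : X) -> hpi n (point : Y) :=
  pi_map (@smap0_continuous R X Y f) (smap0_pt f).

Definition hofiber (X Y : NG0 R) (f : smap0 R X Y) : Type :=
  set_type [set z : (X * {compact-open, unitI R -> Y})%type |
    [/\ continuous (z.2 : unitI R -> Y), f z.1 = z.2 (I0 R) &
        z.2 (I1 R) = point]].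
HB.instance Definition _ (X Y : NG0 R) (f : smap0 R X Y) :=
  Topological.on (hofiber f).

(* [phi] is determined by i and H, and its values lie in F(f) exactly when H is
   a homotopy from f o i to the constant map. *)
Definition homotopy_fibration_sequence (Z X Y : NG0 R)
    (i : smap0 R Z X) (f : smap0 R X Y) (H : unitI R -> Z -> Y) : Prop :=
  exists phi : Z -> hofiber f,
    (forall z, (set_val (phi z)).1 = i z /\
               forall t, (set_val (phi z)).2 t = H t z) /\
    weak_equivalence phi.

(* [H] is the same as a pointed map I_+ /\ X -> Y. *)
Definition pointed_homotopic (X Y : NG0 R) (f g : smap0 R X Y) : Prop :=
  exists H : nu R (unitI R * X)%type -> Y,
    [/\ continuous H, (forall x, H (I0 R, x) = f x),
        (forall x, H (I1 R, x) = g x) & forall t, H (t, point) = point].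

End homotopy_groups.

Section constructions.
Context (R : realType).

Section smash.
Context (X Y : NG0 R).

Definition in_wedge (z : nu R (X * Y)%type) : Prop :=
  z.1 = point \/ z.2 = point.

Definition smash_rel (z w : nu R (X * Y)%type) : Prop :=
  in_wedge z /\ in_wedge w.

Definition smash : NG0 R :=
  MkNG0 (ng_top_quot (r := smash_rel) (@nu_ng R (X * Y)%type)).

Definition smash_pi (x : X) (y : Y) : smash :=
  tq_pi ((x, y) : nu R (X * Y)%type).

Lemma smash_pi_continuous :
  continuous (fun z : nu R (X * Y)%type => smash_pi z.1 z.2).
Proof.
rewrite (_ : (fun z => _) = tq_pi); first exact: tq_pi_continuous.
by apply/funext => -[].
Qed.

Lemma smash_pi_pt (x : X) (y : Y) :
  x = point \/ y = point -> smash_pi x y = point.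
Proof. by move=> xy; apply: gen_pi_rel; split=> //; left. Qed.

End smash.

Section smash_map.
Context (A X Y : NG0 R) (f : smap0 R X Y).

Definition smash_map_fun (z : smash A X) : smash A Y :=
  let ax := repr z in smash_pi ax.1 (f ax.2).

Lemma smash_map_pi a x : smash_map_fun (smash_pi a x) = smash_pi a (f x).
Proof.
pose F (z : nu R (A * X)%type) : smash A Y := smash_pi z.1 (f z.2).
have FE z w : smash_rel z w -> F z = F w.
  move=> [zp wp]; rewrite /F !smash_pi_pt//.
    by case: wp => ->; [left|right; exact: smap0_pt].
  by case: zp => ->; [left|right; exact: smap0_pt].
exact: (gen_lift_pi FE (a, x)).
Qed.

Lemma smash_map_continuous : continuous smash_map_fun.
Proof.
apply: tq_continuous.
pose g (z : nu R (A * X)%type) : nu R (A * Y)%type := (z.1, f z.2).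
have cg : continuous g.
  apply: ng_nu_continuous; first exact: nu_ng.
  apply: (@pair_continuous (nu R (A * X)%type) A Y fst (f \o snd)).
    exact: nu_fst_continuous.
  move=> z; apply: (@continuous_comp (nu R (A * X)%type) X Y snd f).
    exact: nu_snd_continuous.
  exact: smap0_continuous.
rewrite (_ : _ \o _ = tq_pi \o g).
  move=> z; apply: continuous_comp; [exact: cg|exact: tq_pi_continuous].
by apply/funext => -[a x]; exact: smash_map_pi.
Qed.

Lemma smash_map_pt : smash_map_fun point = point.
Proof.
rewrite (_ : point = smash_pi (point : A) (point : X))// smash_map_pi.
by apply: smash_pi_pt; left.
Qed.

Definition smash_map : smap0 R (smash A X) (smash A Y) :=
  mk_smap0 smash_map_continuous smash_map_pt.

End smash_map.

Definition NG_I : NG0 R := MkNG0 (@ng_unitI R).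

Definition circle_rel (s t : unitI R) : Prop := s = I0 R /\ t = I1 R.
Definition circle : NG0 R := MkNG0 (ng_top_quot (r := circle_rel) (@ng_unitI R)).

Definition S0 : NG0 R := MkNG0 (@ng_discrete R bool).

Definition susp (X : NG0 R) : NG0 R := smash circle X.
Definition susp_map (X Y : NG0 R) (f : smap0 R X Y) :
  smap0 R (susp X) (susp Y) := smash_map circle f.

(* reduced cone: the basepoint of the interval is 1, so the base of the cone
   on A is {[0, a] | a in A} and its vertex is [1, a] *)
Definition cone (A : NG0 R) : NG0 R := smash NG_I A.

Definition wedge_fam (X Y : NG0 R) (b : bool) : ptopologicalType :=
  if b then ng_space X else ng_space Y.

Lemma ng_wedge_fam (X Y : NG0 R) b : numerically_generated R (wedge_fam X Y b).
Proof. by case: b; exact: ngP. Qed.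

Definition wedge2 (X Y : NG0 R) : NG0 R :=
  @MkNG0 R (pwedge (wedge_fam X Y)) (ng_wedge (@ng_wedge_fam X Y)).

Definition winl (X Y : NG0 R) (x : X) : wedge2 X Y :=
  @wedge_lift _ _ (fun b => @point (wedge_fam X Y b)) true x.
Definition winr (X Y : NG0 R) (y : Y) : wedge2 X Y :=
  @wedge_lift _ _ (fun b => @point (wedge_fam X Y b)) false y.

Section copair.
Context (X Y Z : NG0 R) (f : smap0 R X Z) (g : smap0 R Y Z).

Definition copair_fam (b : bool) : wedge_fam X Y b -> Z :=
  if b as b' return wedge_fam X Y b' -> Z then f else g.

Lemma copair_fam_pt b : copair_fam (b := b) point = point.
Proof. by case: b => /=; exact: smap0_pt. Qed.

Lemma copair_continuous :
  continuous (wedge_fun copair_fam : wedge2 X Y -> Z).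
Proof.
apply: wedge_fun_continuous; first by case; exact: smap0_continuous.
by move=> b c; rewrite !copair_fam_pt.
Qed.

Lemma copair_pt : (wedge_fun copair_fam : wedge2 X Y -> Z) point = point.
Proof.
rewrite [LHS](@wedge_lift_funE _ _ _ _ copair_fam); first exact: copair_fam_pt.
by move=> b c; rewrite !copair_fam_pt.
Qed.

Definition copair : smap0 R (wedge2 X Y) Z :=
  mk_smap0 copair_continuous copair_pt.

End copair.

Definition fold (X : NG0 R) : smap0 R (wedge2 X X) X := copair (idm X) (idm X).
Definition wproj1 (X : NG0 R) : smap0 R (wedge2 X X) X :=
  copair (idm X) (smap0_cst R X X).
Definition wproj2 (X : NG0 R) : smap0 R (wedge2 X X) X :=
  copair (smap0_cst R X X) (idm X).

(* A is, up to isomorphism, a subset of X with the induced structure of a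
   numerically generated space, [nu] of the subspace topology *)
Definition ng_inclusion (A X : NG0 R) (i : smap0 R A X) : Prop :=
  injective i /\
  forall n (s : simplex R n -> A), continuous (i \o s) -> continuous s.

Section cofiber.
Context (A X : NG0 R) (i : smap0 R A X).

Definition cofiber_rel (z w : wedge2 X (cone A)) : Prop :=
  exists a : A, z = winl (cone A) (i a) /\
                w = winr X (smash_pi (I0 R : NG_I) a).

Definition cofiber : NG0 R :=
  MkNG0 (ng_top_quot (r := cofiber_rel) (@ngP R (wedge2 X (cone A)))).

Definition cofiber_inj_fun (x : X) : cofiber := tq_pi (winl (cone A) x).

Lemma cofiber_inj_continuous : continuous cofiber_inj_fun.
Proof.
move=> x; apply: (@continuous_comp _ _ _ (winl (cone A)) tq_pi).
  exact: (@wedge_lift_continuous _ (wedge_fam X (cone A)) _ true).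
exact: tq_pi_continuous.
Qed.

Lemma cofiber_inj_pt : cofiber_inj_fun point = point.
Proof.
rewrite /cofiber_inj_fun (_ : winl _ _ = point)//.
exact: (@wedge_liftE _ (wedge_fam X (cone A)) _ _ point true point).
Qed.

Definition cofiber_inj : smap0 R X cofiber :=
  mk_smap0 cofiber_inj_continuous cofiber_inj_pt.

Definition contraction_fun (t : unitI R) (a : A) : cofiber :=
  tq_pi (winr X (smash_pi (t : NG_I) a)).

Lemma contraction0 a : contraction_fun (I0 R) a = cofiber_inj (i a).
Proof. by apply/esym; apply: gen_pi_rel; exists a. Qed.

Lemma contraction1 a : contraction_fun (I1 R) a = point.
Proof.
rewrite /contraction_fun smash_pi_pt//; by left.
Qed.

Lemma contraction_continuous t : continuous (contraction_fun t).
Proof.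
pose g (a : A) : nu R (NG_I * A)%type := (t, a).
have cg : continuous g.
  apply: ng_nu_continuous; first exact: ngP.
  apply: (@pair_continuous A NG_I A (fun=> t) id) => a.
    exact: cvg_cst.
  exact: cvg_id.
rewrite (_ : contraction_fun t =
  (tq_pi : wedge2 X (cone A) -> cofiber) \o
  (@winr X (cone A) \o ((tq_pi : _ -> cone A) \o g)))//.
apply: comp_continuous; last exact: tq_pi_continuous.
apply: comp_continuous.
  by apply: comp_continuous; [exact: cg|exact: tq_pi_continuous].
exact: (@wedge_lift_continuous _ (wedge_fam X (cone A)) _ false).
Qed.

Lemma contraction_pt t : contraction_fun t point = point.
Proof.
rewrite /contraction_fun smash_pi_pt//; by right.
Qed.

Definition contraction (t : unitI R) : smap0 R A cofiber :=
  mk_smap0 (@contraction_continuous t) (contraction_pt t).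

End cofiber.

(* A Hausdorff space with finitely many cells: the characteristic maps are
   defined on cubes (homeomorphic to closed balls), each point lies in exactly
   one open cell and is there the image of exactly one interior point of the
   cube, and boundaries are sent to the union of the cells of lower dimension.
   As there are finitely many cells and X is Hausdorff, X automatically has
   the weak topology. *)
Definition finite_CW (X : topologicalType) : Prop :=
  hausdorff_space X /\
  exists (m : nat) (d : 'I_m -> nat) (Phi : forall i, cube R (d i) -> X),
    [/\ forall i, continuous (Phi i),
        forall x, exists! c : {i : 'I_m & cube R (d i)},
          ~ cube_boundary (projT2 c) /\ Phi _ (projT2 c) = x &
        forall i t, cube_boundary t -> exists (j : 'I_m) (s : cube R (d j)),
          [/\ (d j < d i)%N, ~ cube_boundary s & Phi j s = Phi i t]].

Lemma finite_CW_S0 : finite_CW S0.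
Proof.
split; first exact: (@discrete_hausdorff bool).
have nb (t : cube R 0) : ~ cube_boundary t by case=> -[].
have ct (t u : cube R 0) : t = u by apply/funext => -[].
exists 2%N, (fun=> 0%N), (fun i _ => i == ord0); split.
- by move=> i; exact: cst_continuous.
- move=> x; pose t : cube R 0 := fun=> I0 R.
  exists (existT _ (if x then ord0 else ord_max) t); split.
    by split; [exact: nb|case: x].
  case=> j u /= [_ jx]; rewrite (ct t u); congr existT.
  by apply/val_inj; move: jx; case: j => -[|[|//]] ? /= <-.
- by move=> i t /nb.
Qed.

End constructions.

(* A full subcategory of NG_0 is given by its class of objects. The finite
   wedge sums are generated by the binary ones and the one-point space, which
   is a finite CW-complex. The last clause follows from the previous one when
   the class is closed under isomorphism: S^1 /\ X is the cofiber of X in CX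
   only up to homeomorphism. *)
Record subcat (R : realType) := MkSubcat {
  subcat_mem :> NG0 R -> Prop;
  subcat_CW : forall X : NG0 R, finite_CW R X -> subcat_mem X;
  subcat_wedge : forall X Y : NG0 R,
    subcat_mem X -> subcat_mem Y -> subcat_mem (wedge2 X Y);
  subcat_cofiber : forall (A X : NG0 R) (i : smap0 R A X), ng_inclusion i ->
    subcat_mem A -> subcat_mem X -> subcat_mem (cofiber i);
  subcat_susp : forall X : NG0 R, subcat_mem X -> subcat_mem (susp X) }.

Record obj (R : realType) (C : subcat R) := MkObj {
  obj_space :> NG0 R;
  objP : C obj_space }.

Section objects.
Context (R : realType) (C : subcat R).

Definition wedge_obj (X Y : obj C) : obj C :=
  MkObj (subcat_wedge (objP X) (objP Y)).

Definition cofiber_obj (A X : obj C) (i : smap0 R A X) (hi : ng_inclusion i) :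
  obj C := MkObj (subcat_cofiber hi (objP A) (objP X)).

Definition susp_obj (X : obj C) : obj C := MkObj (subcat_susp (objP X)).

Definition S0_obj : obj C :=
  MkObj (@subcat_CW R C (S0 R) (finite_CW_S0 R)).

Definition iter_susp (k : nat) (X : obj C) : obj C := iter k susp_obj X.

Fixpoint iter_susp_map (k : nat) (X Y : obj C) (f : smap0 R X Y) :
    smap0 R (iter_susp k X) (iter_susp k Y) :=
  if k is k'.+1 then susp_map (iter_susp_map k' f) else f.

Definition sphere (n : nat) : obj C := iter_susp n S0_obj.

End objects.
Arguments sphere {R} C n.

Record functor (R : realType) (C : subcat R) := MkFunctor {
  fobj :> obj C -> NG0 R;
  fmor : forall X Y : obj C, smap0 R X Y -> smap0 R (fobj X) (fobj Y);
  fmor_id : forall X : obj C, fmor (idm X) =1 id;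
  fmor_comp : forall (X Y Z : obj C) (g : smap0 R Y Z) (f : smap0 R X Y),
    fmor (compm g f) =1 fmor g \o fmor f }.

Record bifunctor (R : realType) (C : subcat R) := MkBifunctor {
  bobj :> obj C -> obj C -> NG0 R;
  bmor : forall X X' Y Y' : obj C, smap0 R X' X -> smap0 R Y Y' ->
    smap0 R (bobj X Y) (bobj X' Y');
  bmor_id : forall X Y : obj C, bmor (idm X) (idm Y) =1 id;
  bmor_comp : forall (X X' X'' Y Y' Y'' : obj C)
    (f : smap0 R X' X) (f' : smap0 R X'' X')
    (g : smap0 R Y Y') (g' : smap0 R Y' Y''),
    bmor (compm f f') (compm g' g) =1 bmor f' g' \o bmor f g }.

Section bifunctors.
Context (R : realType) (C : subcat R) (F : bifunctor C).

Section partial.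
Context (X : obj C).

Lemma partial_id (Y : obj C) : bmor F (idm X) (idm Y) =1 id.
Proof. exact: bmor_id. Qed.

Lemma partial_comp (Y Y' Y'' : obj C)
    (g' : smap0 R Y' Y'') (g : smap0 R Y Y') :
  bmor F (idm X) (compm g' g) =1 bmor F (idm X) g' \o bmor F (idm X) g.
Proof.
move=> z; rewrite -(@bmor_comp R C F X X X Y Y' Y'' (idm X) (idm X) g g' z).
by congr (bmor F _ _ z); exact: smap0_eq.
Qed.

Definition partial_functor : functor C :=
  @MkFunctor R C (fun Y => F X Y) (fun Y Y' g => bmor F (idm X) g)
    partial_id partial_comp.

End partial.

Definition covariant_part : functor C := partial_functor (S0_obj C).

Definition enriched : Prop :=
  (forall X X' Y Y' : obj C,
    continuous (fun fg : nu R (F0 X' X * F0 Y Y')%type =>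
      bmor F fg.1 fg.2 : F0 (F X Y) (F X' Y'))) /\
  (forall (X X' Y Y' : obj C) (f : smap0 R X' X) (g : smap0 R Y Y'),
    (forall x, f x = point) \/ (forall y, g y = point) ->
    forall z, bmor F f g z = point).

Definition bilinear_functor : Prop :=
  [/\ enriched,
      (forall (A X Y : obj C) (i : smap0 R A X) (hi : ng_inclusion i),
        @homotopy_fibration_sequence R
          (F (cofiber_obj hi) Y) (F X Y) (F A Y)
          (@bmor R C F (cofiber_obj hi) X Y Y (cofiber_inj i) (idm Y))
          (bmor F i (idm Y))
          (fun t => @bmor R C F (cofiber_obj hi) A Y Y
                      (contraction i t) (idm Y))) &
      (forall (X B Y : obj C) (i : smap0 R B Y) (hi : ng_inclusion i),
        @homotopy_fibration_sequence R
          (F X B) (F X Y) (F X (cofiber_obj hi))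
          (bmor F (idm X) i)
          (@bmor R C F X X Y (cofiber_obj hi) (idm X) (cofiber_inj i))
          (fun t => @bmor R C F X X B (cofiber_obj hi)
                      (idm X) (contraction i t)))].

End bifunctors.

Section linear_homology.
Context (R : realType) (C : subcat R) (T : functor C).

Definition pi_functor (n : nat) (X : obj C) : Type :=
  hpi R n (point : T X).

Definition pi_functor_map (n : nat) (X Y : obj C) (f : smap0 R X Y) :
  pi_functor n X -> pi_functor n Y := pi_mor (fmor T f).

(* The element of pi_n T(X v X) with projections a and b; it exists and is
   unique when T is linear. *)
Definition pi_functor_pair (n : nat) (X : obj C) (a b : pi_functor n X) :
    pi_functor n (wedge_obj X X) :=
  xget (pi_class (cube_cst R n (point : T (wedge_obj X X))))
    [set c : hpi R n (point : T (wedge_obj X X)) |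
      @pi_functor_map n (wedge_obj X X) X (wproj1 X) c = a /\
      @pi_functor_map n (wedge_obj X X) X (wproj2 X) c = b].

Definition pi_functor_add (n : nat) (X : obj C) (a b : pi_functor n X) :
    pi_functor n X :=
  @pi_functor_map n (wedge_obj X X) X (fold X) (pi_functor_pair a b).

(* h_n(X; T); recall that Negz m is -(m + 1) *)
Definition linear_homology (n : int) (X : obj C) : Type :=
  match n with
  | Posz m => pi_functor m X
  | Negz m => pi_functor 0 (iter_susp m.+1 X)
  end.

Definition linear_homology_add (n : int) (X : obj C) :
    linear_homology n X -> linear_homology n X -> linear_homology n X :=
  match n with
  | Posz m => @pi_functor_add m X
  | Negz m => @pi_functor_add 0 (iter_susp m.+1 X)
  end.

Definition linear_homology_map (n : int) (X Y : obj C) (f : smap0 R X Y) :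
    linear_homology n X -> linear_homology n Y :=
  match n with
  | Posz m => pi_functor_map (n := m) f
  | Negz m => pi_functor_map (n := 0) (iter_susp_map m.+1 f)
  end.

End linear_homology.

Record homology_theory (R : realType) (C : subcat R) := MkHomology {
  hgrp :> int -> obj C -> zmodType;
  hmap : forall (n : int) (X Y : obj C), smap0 R X Y ->
    {additive hgrp n X -> hgrp n Y};
  hmap_id : forall n (X : obj C), hmap n (idm X) =1 id;
  hmap_comp : forall n (X Y Z : obj C) (g : smap0 R Y Z) (f : smap0 R X Y),
    hmap n (compm g f) =1 hmap n g \o hmap n f;
  hsusp : forall (n : int) (X : obj C),
    {additive hgrp n X -> hgrp (n + 1) (susp_obj X)};
  hsusp_bij : forall n (X : obj C), bijective (hsusp n X);
  hsusp_nat : forall n (X Y : obj C) (f : smap0 R X Y) (a : hgrp n X),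
    @hmap (n + 1) (susp_obj X) (susp_obj Y) (susp_map f) (hsusp n X a) =
    hsusp n Y (hmap n f a);
  hmap_homotopy : forall n (X Y : obj C) (f g : smap0 R X Y),
    pointed_homotopic f g -> hmap n f =1 hmap n g;
  hmap_exact : forall n (A X : obj C) (i : smap0 R A X) (hi : ng_inclusion i)
    (x : hgrp n X),
    @hmap n X (cofiber_obj hi) (cofiber_inj i) x = 0 <->
    exists a, hmap n i a = x }.

Record cohomology_theory (R : realType) (C : subcat R) := MkCohomology {
  cgrp :> int -> obj C -> zmodType;
  cmap : forall (n : int) (X Y : obj C), smap0 R X Y ->
    {additive cgrp n Y -> cgrp n X};
  cmap_id : forall n (X : obj C), cmap n (idm X) =1 id;
  cmap_comp : forall n (X Y Z : obj C) (g : smap0 R Y Z) (f : smap0 R X Y),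
    cmap n (compm g f) =1 cmap n f \o cmap n g;
  csusp : forall (n : int) (X : obj C),
    {additive cgrp (n + 1) (susp_obj X) -> cgrp n X};
  csusp_bij : forall n (X : obj C), bijective (csusp n X);
  csusp_nat : forall n (X Y : obj C) (f : smap0 R X Y)
    (a : cgrp (n + 1) (susp_obj Y)),
    csusp n X (@cmap (n + 1) (susp_obj X) (susp_obj Y) (susp_map f) a) =
    cmap n f (csusp n Y a);
  cmap_homotopy : forall n (X Y : obj C) (f g : smap0 R X Y),
    pointed_homotopic f g -> cmap n f =1 cmap n g;
  cmap_exact : forall n (A X : obj C) (i : smap0 R A X) (hi : ng_inclusion i)
    (x : cgrp n X),
    cmap n i x = 0 <->
    exists a, @cmap n X (cofiber_obj hi) (cofiber_inj i) a = x }.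

(* Main.v *)
Require Import Defs.
From HB Require Import structures.
From mathcomp Require Import all_boot all_order all_algebra generic_quotient.
From mathcomp Require Import all_classical all_reals all_analysis.
From mathcomp Require Import wedge_sigT zify lra.
Import Order.TTheory GRing.Theory Num.Theory.
Import numFieldNormedType.Exports.

Set Implicit Arguments.
Unset Strict Implicit.
Unset Printing Implicit Defensive.

Local Open Scope classical_set_scope.
Local Open Scope ring_scope.

(** All groups are built from the sets of path components of [F A Y].

    Contraction of cones.  Let [D] be the cone on [X], taken as the cofiber of
    the identity, and [B] the cofiber of [X] in [D].  The enrichment turns the
    contraction of [D] into a contraction of [F A D], so in the homotopy
    fibration sequence [F A X -> F A D -> F A B] the total space is
    contractible and the homotopy sets of the fiber are those of the base one
    degree up ([contractible_fibration_bij]).  As [B] is homotopy equivalent to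
    the suspension of [X], the explicit map that sends [z] to the loop
    [t |-> F(x |-> [t, x]) z] is a bijection from the [n]-th homotopy set of
    [F A X] to the next one of [F A (susp X)] ([susp_covar_bij]); by the other
    fibration sequence so is its analogue from [F (susp A) Y] to [F A Y]
    ([desusp_contra_bij]).  Both are natural, and together they identify
    [pi_0 F(A, Y)] with [pi_0 F(susp A, susp Y)] ([double_susp]).

    Groups.  Concatenation of loops in [F A (susp Y)] gives a natural group
    structure on [pi_0 F(A, Y)].  Exactness for a summand of a wedge shows that
    an element over [X \/ X] is determined by its two projections
    ([gproj_inj]), whence any natural operation with a neutral element is this
    one ([gmul_unique]).  That single fact gives commutativity, the agreement
    with the operation defined by the folding map ([natural_add]), and
    additivity of the double suspension.

    Theories.  For [n = p - q], where [p] or [q] vanishes, put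
    [h_n X = pi_0 F(S^p, Sigma^q X)] and [h^n X = pi_0 F(Sigma^q X, S^p)].
    Double suspension changes [(p, q)] into [(p + k, q + k)], which is the first
    two comparisons; removing the suspensions of [S^p] one by one yields the
    comparison with [pi_p F(S^0, X)].  Homotopy invariance comes from the
    enrichment.  Exactness is that of the fibration sequences, except that
    suspensions must be dealt with: in the contravariant variable they are
    traded for higher homotopy groups ([iter_susp_coexact]), in the covariant
    variable one moves along the Puppe sequence ([susp_exact]).

    Topology.  Homotopies live on spaces glued from cones and suspensions.
    Products of test spaces with the interval are again test spaces, so that
    a product of the interval with a numerically generated space needs no
    change of topology ([ng_unitI_prod]) and paths in the mapping spaces are
    ordinary homotopies ([smap0_curry], [smap0_uncurry]). *)

(** * Continuity *)

Section continuity.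
Context (R : realType).

Lemma compose2_continuous (T X Y Z : topologicalType) (g : X -> Y -> Z)
    (a : T -> X) (b : T -> Y) :
  continuous (fun w : X * Y => g w.1 w.2) -> continuous a -> continuous b ->
  continuous (fun z => g (a z) (b z)).
Proof.
move=> cg ca cb.
exact: (comp_continuous (pair_continuous ca cb) cg).
Qed.

Lemma fst_comp_continuous (T X Y : topologicalType) (a : T -> X * Y) :
  continuous a -> continuous (fun z => (a z).1).
Proof. by move=> ca; apply: (comp_continuous ca) => z; exact: cvg_fst. Qed.

Lemma snd_comp_continuous (T X Y : topologicalType) (a : T -> X * Y) :
  continuous a -> continuous (fun z => (a z).2).
Proof. by move=> ca; apply: (comp_continuous ca) => z; exact: cvg_snd. Qed.

Lemma id_fun_continuous (T : topologicalType) : continuous (fun z : T => z).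
Proof. by move=> z. Qed.

Lemma add_continuous (T : topologicalType) (f g : T -> R) :
  continuous f -> continuous g -> continuous (fun z => f z + g z).
Proof. by move=> cf cg z; apply: cvgD; [exact: cf|exact: cg]. Qed.

Lemma opp_continuous (T : topologicalType) (f : T -> R) :
  continuous f -> continuous (fun z => - f z).
Proof. by move=> cf z; apply: cvgN; exact: cf. Qed.

Lemma mul_continuous (T : topologicalType) (f g : T -> R) :
  continuous f -> continuous g -> continuous (fun z => f z * g z).
Proof. by move=> cf cg z; apply: cvgM; [exact: cf|exact: cg]. Qed.

Lemma inv_continuous (T : topologicalType) (f : T -> R) :
  (forall z, f z != 0) -> continuous f -> continuous (fun z => (f z)^-1).
Proof. by move=> f0 cf z; apply: cvgV; [exact: f0|exact: cf]. Qed.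

Lemma max_continuous (T : topologicalType) (f g : T -> R) :
  continuous f -> continuous g -> continuous (fun z => Num.max (f z) (g z)).
Proof. by move=> cf cg z; apply: continuous_max; [exact: cf|exact: cg]. Qed.

Lemma min_continuous (T : topologicalType) (f g : T -> R) :
  continuous f -> continuous g -> continuous (fun z => Num.min (f z) (g z)).
Proof. by move=> cf cg z; apply: continuous_min; [exact: cf|exact: cg]. Qed.

Lemma itv_clamp (x : R) :
  Num.max 0 (Num.min 1 x) \in (`[0, 1]%classic : set R).
Proof.
by apply/mem_set; rewrite /= in_itv /= le_max lexx ge_max ler01 ge_min lexx.
Qed.

Definition uval (t : unitI R) : R := val t.

Lemma uval0 : uval (I0 R) = 0. Proof. by []. Qed.
Lemma uval1 : uval (I1 R) = 1. Proof. by []. Qed.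

Definition clamp (x : R) : unitI R := to_set (itv_clamp x).

Lemma unitI_eq (s t : unitI R) : uval s = uval t -> s = t.
Proof. exact: val_inj. Qed.

Lemma unitI_ge0 (t : unitI R) : 0 <= uval t.
Proof. by have := set_mem (valP t); rewrite /= in_itv /= => /andP[]. Qed.

Lemma unitI_le1 (t : unitI R) : uval t <= 1.
Proof. by have := set_mem (valP t); rewrite /= in_itv /= => /andP[]. Qed.

Lemma uval_clamp (x : R) :
  uval (clamp x) = if x <= 0 then 0 else if 1 <= x then 1 else x.
Proof.
rewrite /uval /= /Num.max /Num.min.
by do ![case: ifPn => //]; lra.
Qed.

Lemma clamp_val (t : unitI R) : clamp (uval t) = t.
Proof.
apply: unitI_eq; rewrite uval_clamp.
by have := unitI_ge0 t; have := unitI_le1 t; do ![case: ifPn => //]; lra.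
Qed.

Lemma clamp_le0 (x : R) : x <= 0 -> clamp x = I0 R.
Proof. by move=> x0; apply: unitI_eq; rewrite uval_clamp x0. Qed.

Lemma clamp_ge1 (x : R) : 1 <= x -> clamp x = I1 R.
Proof.
move=> x1; apply: unitI_eq; rewrite uval_clamp x1 ifF//.
by apply/negbTE; rewrite -ltNge; lra.
Qed.

Lemma uval_continuous (T : topologicalType) (f : T -> unitI R) :
  continuous f -> continuous (fun z => uval (f z)).
Proof.
move=> cf; apply: (comp_continuous (g := @uval) cf).
exact: initial_continuous.
Qed.

Lemma clamp_continuous (T : topologicalType) (f : T -> R) :
  continuous f -> continuous (fun z => clamp (f z)).
Proof.
move=> cf; apply: continuous_comp_initial.
apply: max_continuous; first exact: cst_continuous.
by apply: min_continuous => //; exact: cst_continuous.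
Qed.

(** Both branches are continuous everywhere, so the two closed sets on which
    they are used need no relative topologies. *)
Lemma paste_continuous (T W : topologicalType) (r : T -> R) (f g : T -> W) :
  continuous r -> continuous f -> continuous g ->
  (forall z, r z = 0 -> f z = g z) ->
  continuous (fun z => if r z <= 0 then f z else g z).
Proof.
move=> cr cf cg fg; apply/continuous_closedP => A cA.
have /continuous_closedP cf' := cf; have /continuous_closedP cg' := cg.
have /continuous_closedP cr' := cr.
rewrite (_ : _ @^-1` A = ((r @^-1` [set x | x <= 0]) `&` (f @^-1` A)) `|`
    ((r @^-1` [set x | 0 <= x]) `&` (g @^-1` A))).
  apply: closedU; apply: closedI; [|exact: cf'| |exact: cg'].
    by apply: cr'; exact: closed_le.
  by apply: cr'; exact: closed_ge.
apply/seteqP; split => z /=.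
  by case: ifPn => [r0 Az|]; [left|rewrite -ltNge => /ltW; right].
case=> -[r0 Az]; first by rewrite r0.
by case: ifPn => // r1; rewrite fg//; apply/eqP; rewrite eq_le r0 r1.
Qed.

End continuity.

(** Proves continuity along the syntax of the formula. The partially applied
    operations are the shapes that unification leaves after eta-reduction. *)
Ltac ctn := repeat first
  [ assumption
  | match goal with |- continuous ?f =>
      lazymatch f with
      | (fun z => z) => exact: id_fun_continuous
      | id => exact: id_fun_continuous
      | (fun _ => ?c) => exact: cst_continuous
      | (fun z => (_ + _)%R) => apply: add_continuous
      | (fun z => (- _)%R) => apply: opp_continuous
      | (fun z => (_ * _)%R) => apply: mul_continuous
      | (fun z => clamp _) => apply: clamp_continuous
      | (fun z => uval _) => apply: uval_continuous
      | (fun z => (_, _)) => apply: pair_continuous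
      | (fun z => fst _) => apply: fst_comp_continuous
      | (fun z => snd _) => apply: snd_comp_continuous
      | ( *%R ?c) => refine (@mul_continuous _ _ (fun=> c) id _ _)
      | ( +%R ?c) => refine (@add_continuous _ _ (fun=> c) id _ _)
      | ( -%R ) => refine (@opp_continuous _ _ id _)
      | @uval _ => refine (@uval_continuous _ _ id _)
      | @clamp _ => refine (@clamp_continuous _ _ id _)
      | pair ?c => refine (@pair_continuous _ _ _ (fun=> c) id _ _)
      | fst => refine (@fst_comp_continuous _ _ _ id _)
      | snd => refine (@snd_comp_continuous _ _ _ id _)
      end
    end ].

(** Restricted to boolean goals, because [lra] raises an error that cannot be
    caught on an equation between points of a space without an order. *)
Ltac side := lazymatch goal with |- is_true _ => lra | _ => idtac end.

(** * Compactness and test spaces *)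

Section spaces.
Context (R : realType).

Lemma hausdorff_inj (X Y : topologicalType) (f : X -> Y) :
  injective f -> continuous f -> hausdorff_space Y -> hausdorff_space X.
Proof.
move=> inj cf hY x y xy; apply: inj; apply: hY => A B nA nB.
have [z [Az Bz]] := xy _ _ (cf x A nA) (cf y B nB).
by exists (f z).
Qed.

Lemma compact_surj (X Y : topologicalType) (f : X -> Y) (A : set X) :
  continuous f -> (forall y, exists2 x, A x & f x = y) -> compact A ->
  compact [set: Y].
Proof.
move=> cf sf cX; rewrite (_ : setT = f @` A).
  by apply: continuous_compact => //; exact: continuous_subspaceT.
by apply/seteqP; split => // y _; have [x ? ?] := sf y; exists x.
Qed.

Lemma unitI_hausdorff : hausdorff_space (unitI R).
Proof.
apply: (@hausdorff_inj (unitI R) R set_val).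
- by move=> s t; exact: unitI_eq.
- exact: initial_continuous.
- exact: Rhausdorff.
Qed.

Lemma unitI_compact : compact [set: unitI R].
Proof.
apply: (@compact_surj R (unitI R) (@clamp R) `[0, 1]).
- by apply: clamp_continuous; exact: id_fun_continuous.
- move=> t; exists (uval t); last exact: clamp_val.
  by have /set_mem := valP t.
- exact: segment_compact.
Qed.

Lemma compact_locally (X : topologicalType) :
  compact [set: X] -> locally_compact [set: X].
Proof.
move=> cX x _; rewrite withinET; exists setT; first exact: filterT.
by split => //; exact: closedT.
Qed.

Lemma cube_coord_continuous n i : continuous (fun u : cube R n => u i).
Proof. exact: (@proj_continuous _ (fun _ : 'I_n => unitI R) i). Qed.

Lemma proj_comp_continuous (T : topologicalType) n (f : T -> cube R n) i :
  continuous f -> continuous (fun z => f z i).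
Proof.
move=> cf; exact: (comp_continuous (g := fun t : cube R n => t i) cf
  (@cube_coord_continuous n i)).
Qed.

Lemma cube_of_continuous (T : topologicalType) n (f : T -> cube R n) :
  (forall i, continuous (fun z => f z i)) -> continuous f.
Proof.
move=> cf x; apply/cvg_sup => i.
move: x; apply/(@continuousP _ (initial_topology (fun g : cube R n => g i))).
move=> A [B oB <-]; have /continuousP := cf i; exact.
Qed.

Lemma cube_compact n : compact [set: cube R n].
Proof.
rewrite (_ : setT = [set f : forall i : 'I_n, unitI R | forall i, setT (f i)]).
  apply: (@tychonoff _ (fun _ : 'I_n => unitI R) (fun=> setT)) => i.
  exact: unitI_compact.
by apply/seteqP; split.
Qed.

Lemma row_continuous (T : topologicalType) n (f : T -> 'rV[R]_n) :
  (forall i, continuous (fun z => f z 0 i)) -> continuous f.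
Proof.
move=> cf x A [P nP PA]; rewrite nbhs_simpl /=.
have : \forall z \near x, forall i : 'I_n, P 0 i (f z 0 i).
  by apply: filter_forall => i; exact: (cf i x _ (nP 0 i)).
apply: filterS => z h; apply: PA => i j; rewrite (ord1 i); exact: h.
Qed.

Lemma coord_comp_continuous (T : topologicalType) n (f : T -> 'rV[R]_n) i :
  continuous f -> continuous (fun z => f z 0 i).
Proof.
move=> cf; apply: (comp_continuous (g := fun M : 'rV[R]_n => M 0 i) cf).
exact: coord_continuous.
Qed.

Lemma sum_continuous (T : topologicalType) (n : nat) (f : T -> 'I_n -> R) :
  (forall i, continuous (f ^~ i)) -> continuous (fun z => \sum_i f z i).
Proof.
elim: n f => [|n IH] f cf.
  rewrite (_ : (fun z => _) = fun=> 0); first exact: cst_continuous.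
  by apply/funext => z; rewrite big_ord0.
rewrite (_ : (fun z => _) =
    (fun z => f z ord0 + \sum_(i < n) f z (lift ord0 i))); last first.
  by apply/funext => z; rewrite big_ord_recl.
by apply: add_continuous; [exact: cf|apply: IH => i; exact: cf].
Qed.

Definition bary n (x : 'I_n -> R) : 'rV[R]_n.+1 :=
  \row_j (if unlift ord0 j is Some i then x i else 1 - \sum_i x i).

Lemma bary0 n (x : 'I_n -> R) : bary x 0 0 = 1 - \sum_i x i.
Proof. by rewrite mxE unlift_none. Qed.

Lemma baryS n (x : 'I_n -> R) i : bary x 0 (lift 0 i) = x i.
Proof. by rewrite mxE liftK. Qed.

Lemma bary_simplex n (x : 'I_n -> R) : (forall i, 0 <= x i) ->
  \sum_i x i <= 1 -> bary x \in
  [set t : 'rV[R]_n.+1 | (forall i, 0 <= t ord0 i) /\ \sum_i t ord0 i = 1].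
Proof.
move=> x0 x1; apply/mem_set; split => [i|].
  by rewrite mxE; case: unliftP => [j _|_]; rewrite ?subr_ge0.
by rewrite big_ord_recl bary0; under [X in _ + X]eq_bigr do rewrite baryS; rewrite subrK.
Qed.

Lemma bary_continuous (T : topologicalType) n (f : T -> 'I_n -> R) :
  (forall i, continuous (f ^~ i)) -> continuous (fun z => bary (f z)).
Proof.
move=> cf; apply: row_continuous => i.
case: (unliftP 0 i) => [j ->|->].
  by rewrite (_ : (fun z => _) = f ^~ j)//; apply/funext => z; rewrite baryS.
rewrite (_ : (fun z => _) = (fun z => 1 - \sum_i f z i)); last first.
  by apply/funext => z; rewrite bary0.
by ctn; exact: sum_continuous.
Qed.

Definition scoord n (s : simplex R n) (i : 'I_n.+1) : R :=
  (val s : 'rV[R]_n.+1) 0 i.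

Lemma scoord_continuous (T : topologicalType) n (f : T -> simplex R n) i :
  continuous f -> continuous (fun z => scoord (f z) i).
Proof.
move=> cf; apply: coord_comp_continuous.
apply: (comp_continuous (g := fun t : simplex R n => (val t : 'rV[R]_n.+1)) cf).
exact: initial_continuous.
Qed.

Lemma scoord_id_continuous n i : continuous (fun s : simplex R n => scoord s i).
Proof. exact: (@scoord_continuous (simplex R n) n id i (@id_fun_continuous _)). Qed.

Lemma scoord_ge0 n (s : simplex R n) i : 0 <= scoord s i.
Proof. by have [s0 _] := set_mem (valP s); exact: s0. Qed.

Lemma scoord0 n (s : simplex R n) :
  scoord s 0 = 1 - \sum_i scoord s (lift 0 i).
Proof.
have [_] := set_mem (valP s).
by rewrite big_ord_recl => s1; apply/esym/eqP; rewrite subr_eq; apply/eqP.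
Qed.

Lemma simplex_eq n (s t : simplex R n) :
  (forall i, scoord s (lift 0 i) = scoord t (lift 0 i)) -> s = t.
Proof.
move=> susp_pi; apply: val_inj; apply/rowP => i.
case: (unliftP 0 i) => [j ->|->]; first exact: susp_pi.
change (scoord s 0 = scoord t 0).
by rewrite !scoord0; congr (_ - _); apply: eq_bigr => j _; exact: susp_pi.
Qed.

Lemma scoord_sum_le1 n (s : simplex R n) : \sum_i scoord s (lift 0 i) <= 1.
Proof. by have := scoord_ge0 s 0; rewrite scoord0 subr_ge0. Qed.

(** The cube maps onto the simplex (written in its last [n] barycentric
    coordinates) by radial contraction into the region [\sum_i x i <= 1]. *)
Definition contract n (u : cube R n) (i : 'I_n) : R :=
  uval (u i) / Num.max 1 (\sum_i uval (u i)).

Lemma contract_ge0 n (u : cube R n) i : 0 <= contract u i.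
Proof.
by rewrite divr_ge0 ?unitI_ge0// le_max ler01.
Qed.

Lemma contract_le1 n (u : cube R n) : \sum_i contract u i <= 1.
Proof.
rewrite -mulr_suml ler_pdivrMr ?mul1r ?le_max ?lexx ?orbT//.
by rewrite lt_max ltr01.
Qed.

Definition simplex_of_cube n (u : cube R n) : simplex R n :=
  to_set (bary_simplex (contract_ge0 u) (contract_le1 u)).

Lemma simplex_of_cube_continuous n : continuous (@simplex_of_cube n).
Proof.
apply: continuous_comp_initial; apply: bary_continuous => i.
apply: mul_continuous.
  by apply: uval_continuous; exact: cube_coord_continuous.
apply: inv_continuous => [u|]; first by rewrite gt_eqF// lt_max ltr01.
apply: max_continuous; first exact: cst_continuous.
apply: (@sum_continuous (cube R n) n (fun u i => uval (u i))) => j.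
by apply: uval_continuous; exact: cube_coord_continuous.
Qed.

Definition cube_of_simplex n (s : simplex R n) : cube R n :=
  fun i => clamp (scoord s (lift 0 i)).

Lemma cube_of_simplexK n : cancel (@cube_of_simplex n) (@simplex_of_cube n).
Proof.
move=> s; apply: simplex_eq => i; rewrite [LHS]baryS /contract.
have vE j : uval (cube_of_simplex s j) = scoord s (lift 0 j).
  rewrite uval_clamp; set x := scoord _ _.
  have x0 : 0 <= x by exact: scoord_ge0.
  have x1 : x <= 1.
    apply: le_trans (scoord_sum_le1 s); rewrite (bigD1 j)//= lerDl.
    by apply: sumr_ge0 => k _; exact: scoord_ge0.
  by do ![case: ifPn => //]; lra.
rewrite vE; under eq_bigr do rewrite vE.
by rewrite max_l ?divr1//; exact: scoord_sum_le1.
Qed.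

Lemma cube_of_simplex_continuous n : continuous (@cube_of_simplex n).
Proof.
apply: cube_of_continuous => i; rewrite /cube_of_simplex; ctn.
exact: scoord_id_continuous.
Qed.

Lemma simplex_compact n : compact [set: simplex R n].
Proof.
apply: (@compact_surj (cube R n) _ (@simplex_of_cube n) setT).
- exact: simplex_of_cube_continuous.
- by move=> s; exists (cube_of_simplex s) => //; exact: cube_of_simplexK.
- exact: cube_compact.
Qed.

Lemma simplex_hausdorff n : hausdorff_space (simplex R n).
Proof.
apply: (@hausdorff_inj _ _ (@cube_of_simplex n)).
- exact: can_inj (@cube_of_simplexK n).
- exact: cube_of_simplex_continuous.
- by apply: hausdorff_product => _; exact: unitI_hausdorff.
Qed.

Lemma ng_retract (X Y : topologicalType) (s : X -> Y) (r : Y -> X) :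
  continuous s -> continuous r -> cancel s r ->
  numerically_generated R Y -> numerically_generated R X.
Proof.
move=> cs cr sK ngY U oU; rewrite (_ : U = s @^-1` (r @^-1` U)).
  have /continuousP := cs; apply; apply: ngY => n t ct.
  exact: (oU n (r \o t) (comp_continuous ct cr)).
by apply/seteqP; split => x /=; rewrite sK.
Qed.

Lemma ng_simplex n : numerically_generated R (simplex R n).
Proof. by move=> U oU; exact: (oU n id (@id_fun_continuous _)). Qed.

(** The other way round, the cube is a retract of the simplex: shrink it by
    the factor [n] and cut off. *)
Lemma ng_cube n : numerically_generated R (cube R n).
Proof.
pose x (u : cube R n) (i : 'I_n) : R := uval (u i) / n%:R.
have x0 u i : 0 <= x u i by rewrite divr_ge0 ?unitI_ge0.
have x1 u : \sum_i x u i <= 1.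
  apply: (@le_trans _ _ (\sum_(i < n) n%:R^-1)).
    apply: ler_sum => i _; rewrite -[leRHS]mul1r ler_wpM2r ?invr_ge0//.
    exact: unitI_le1.
  rewrite sumr_const card_ord -[leLHS]mulr_natr.
  by case: (n) => [|m]; rewrite ?mulr0// mulVf.
apply: (@ng_retract _ _ (fun u => to_set (bary_simplex (x0 u) (x1 u)) : simplex R n)
  (fun s i => clamp (n%:R * scoord s (lift 0 i)))); last first.
- exact: ng_simplex.
- move=> u; apply/funext => i /=; rewrite -[RHS]clamp_val; congr clamp.
  rewrite [scoord _ _]baryS /x mulrCA divff ?mulr1// pnatr_eq0.
  by case: n i {x x0 x1 u} => [[]|].
- apply: cube_of_continuous => i; ctn.
  exact: scoord_id_continuous.
- apply: continuous_comp_initial; apply: bary_continuous => i; rewrite /x; ctn.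
  exact: cube_coord_continuous.
Qed.

Definition ccons n (s : unitI R) (u : cube R n) : cube R n.+1 :=
  fun i => if unlift ord0 i is Some j then u j else s.

Definition ctail n (u : cube R n.+1) : cube R n := fun i => u (lift ord0 i).

Lemma ccons_continuous (T : topologicalType) n (f : T -> unitI R)
    (g : T -> cube R n) :
  continuous f -> continuous g -> continuous (fun z => ccons (f z) (g z)).
Proof.
move=> cf cg; apply: cube_of_continuous => i; rewrite /ccons.
by case: (unlift ord0 i) => [j|//]; exact: proj_comp_continuous.
Qed.

Lemma ctail_continuous (T : topologicalType) n (g : T -> cube R n.+1) :
  continuous g -> continuous (fun z => ctail (g z)).
Proof.
by move=> cg; apply: cube_of_continuous => i; exact: proj_comp_continuous.
Qed.

Lemma ccons0 n s (u : cube R n) : ccons s u ord0 = s.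
Proof. by rewrite /ccons unlift_none. Qed.

Lemma cconsK n s (u : cube R n) : ctail (ccons s u) = u.
Proof. by apply/funext => i; rewrite /ctail /ccons liftK. Qed.

Lemma ccons_eta n (u : cube R n.+1) : ccons (u ord0) (ctail u) = u.
Proof.
apply/funext => i; rewrite /ccons /ctail.
by case: unliftP => [j|] ->.
Qed.

Lemma ng_unitI_cube n : numerically_generated R (unitI R * cube R n)%type.
Proof.
apply: (@ng_retract _ _ (fun z => ccons z.1 z.2)
  (fun u => (u ord0, ctail u)) _ _ _ (@ng_cube n.+1)).
- by apply: ccons_continuous; ctn.
- apply: pair_continuous; first exact: cube_coord_continuous.
  exact: (ctail_continuous (@id_fun_continuous _)).
- by move=> [s u] /=; rewrite ccons0 cconsK.
Qed.

Lemma ng_unitI_simplex n :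
  numerically_generated R (unitI R * simplex R n)%type.
Proof.
apply: (@ng_retract _ _ (fun z => (z.1, cube_of_simplex z.2))
  (fun z => (z.1, simplex_of_cube z.2)) _ _ _ (@ng_unitI_cube n)).
- ctn; apply: (comp_continuous (g := @cube_of_simplex n)); ctn.
  exact: cube_of_simplex_continuous.
- ctn; apply: (comp_continuous (g := @simplex_of_cube n)); ctn.
  exact: simplex_of_cube_continuous.
- by move=> [s u] /=; rewrite cube_of_simplexK.
Qed.

(** * Exponential laws *)

Definition paths (W : topologicalType) : topologicalType :=
  {compact-open, unitI R -> W}.

(** Since the interval is compact and Hausdorff, both directions hold for every
    space [X]; homotopies on a colimit become maps from it to a path space. *)
Lemma unitI_curry (X W : topologicalType) (f : unitI R -> X -> W) :
  continuous (fun z : unitI R * X => f z.1 z.2) ->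
  continuous (fun x => f ^~ x : paths W).
Proof.
move=> cf; pose g (z : X * unitI R) := f z.2 z.1.
apply: (@continuous_curry_fun X (unitI R) W g).
apply: (compose2_continuous cf); ctn.
Qed.

Lemma uncurryE (X V W : topologicalType) (f : X -> V -> W) :
  compact [set: V] -> hausdorff_space V ->
  continuous (f : X -> {compact-open, V -> W}) ->
  (forall x, continuous (f x)) ->
  continuous (fun z : X * V => f z.1 z.2).
Proof.
move=> cV hV cf cfx.
have -> : (fun z : X * V => f z.1 z.2) = uncurry f.
  by apply/funext => -[].
by apply: continuous_uncurry => //; exact: compact_locally.
Qed.

Lemma unitI_uncurry (X W : topologicalType) (f : unitI R -> X -> W) :
  (forall x, continuous (f ^~ x)) ->
  continuous (fun x => f ^~ x : paths W) ->
  continuous (fun z : unitI R * X => f z.1 z.2).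
Proof.
move=> cfx cf.
have := @uncurryE X (unitI R) W (fun x => f ^~ x) unitI_compact unitI_hausdorff
  cf cfx.
move=> /(compose2_continuous (g := fun x t => f t x)) h.
by apply: (h (unitI R * X)%type snd fst); ctn.
Qed.

(** Maps on [X] are tested on simplexes, and so are homotopies of them:
    a product with the compact interval is again numerically generated. *)
Lemma ng_homotopy (X W : topologicalType) (f : unitI R -> X -> W) :
  numerically_generated R X ->
  (forall n (s : simplex R n -> X), continuous s ->
     continuous (fun z : unitI R * simplex R n => f z.1 (s z.2))) ->
  (forall x, continuous (f ^~ x)) ->
  continuous (fun z : unitI R * X => f z.1 z.2).
Proof.
move=> ngX cf cfx; apply: unitI_uncurry => //.
apply: ng_continuous ngX _ => n s cs.
exact: (unitI_curry (cf n s cs)).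
Qed.

(** Hence a homotopy defined on [X] may be checked for the product topology. *)
Lemma ng_unitI_prod (X : topologicalType) : numerically_generated R X ->
  numerically_generated R (unitI R * X)%type.
Proof.
move=> ngX; have cid' : continuous (fun z : unitI R * X =>
    (fun t x => (t, x) : nu R (unitI R * X)%type) z.1 z.2).
  pose s0 := simplex_of_cube (fun _ : 'I_0 => I0 R).
  have ct n (s : simplex R n -> X) : continuous s ->
      continuous (fun z : unitI R * simplex R n =>
        (z.1, s z.2) : nu R (unitI R * X)%type).
    move=> cs; apply: (@ng_nu_continuous R _ (unitI R * X)%type
      (fun z : unitI R * simplex R n => (z.1, s z.2)) (@ng_unitI_simplex n)).
    by apply: pair_continuous; ctn; apply: (comp_continuous (g := s)); ctn.
  apply: ng_homotopy => // x.
  apply: (compose2_continuous (g := fun t _ => (t, x) : nu R (unitI R * X)%type)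
    (ct 0 (fun=> x) (@cst_continuous _ _ x)) (a := id) (b := fun=> s0)); ctn.
move=> U oU; have /continuousP := cid'; move=> /(_ U oU).
by rewrite (_ : _ @^-1` U = U)//; apply/seteqP; split => -[].
Qed.

(** * Paths of maps *)

Lemma sup_continuous (T : topologicalType) (S : choiceType) (I : Type)
    (K : I -> topologicalType) (p : forall i, S -> K i) (f : T -> S) :
  (forall i, continuous (p i \o f)) ->
  continuous (f : T -> sup_topology (fun i =>
    Topological.class (initial_topology (p i)))).
Proof.
move=> cf x; apply/cvg_sup => i.
move: x; apply/(@continuousP _ (initial_topology (p i))) => A [B oB <-].
by have /continuousP := cf i; exact.
Qed.

(** The mapping space only sees the restrictions to simplexes, and those are
    compact. *)
Lemma smap0_curry (X Y : NG0 R) (h : unitI R -> smap0 R X Y) :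
  continuous (fun z : unitI R * X => h z.1 z.2) ->
  continuous (h : unitI R -> F0 X Y).
Proof.
move=> ch; apply: ng_nu_continuous; first exact: ng_unitI.
apply: sup_continuous => -[n s].
apply: (@continuous_curry_fun (unitI R) (simplex R n) Y
  (fun z => h z.1 (s z.2))).
apply: (compose2_continuous (g := fun t x => h t x) ch); ctn.
apply: (comp_continuous (g := s)); ctn; exact: cts_fun.
Qed.

Lemma sup_proj_continuous (S : choiceType) (I : Type)
    (K : I -> topologicalType) (p : forall i, S -> K i) i :
  continuous (p i : sup_topology (fun i =>
    Topological.class (initial_topology (p i))) -> K i).
Proof.
move=> x; have /cvg_sup/(_ i) h : nbhs x --> x by exact: cvg_id.
exact: (cvg_trans (cvg_app (p i) h) (@initial_continuous S (K i) (p i) x)).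
Qed.

(** Evaluation is continuous on each simplex, which is enough because the
    source is numerically generated. *)
Lemma smap0_uncurry (X Y : NG0 R) (h : unitI R -> smap0 R X Y) :
  continuous (h : unitI R -> F0 X Y) ->
  continuous (fun z : unitI R * X => h z.1 z.2).
Proof.
move=> ch.
have {}ch : continuous (h : unitI R -> smap0 R X Y).
  exact: (comp_continuous ch (@nu_id_continuous R (smap0 R X Y))).
have test n (s : simplex R n -> X) : continuous s ->
    continuous (fun z : unitI R * simplex R n => h z.1 (s z.2)).
  move=> cs; pose s' : continuousType _ _ :=
    HB.pack s (@isContinuous.Build _ _ s cs).
  apply: (@uncurryE (unitI R) (simplex R n) Y (fun t => h t \o s)).
  - exact: simplex_compact.
  - exact: simplex_hausdorff.
  - exact: (comp_continuous ch (@sup_proj_continuous _ _ _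
      (@precomp_simplex R X Y) (existT _ n s'))).
  - by move=> t; exact: (comp_continuous (g := h t) cs (@smap0_continuous R X Y (h t))).
apply: (@ng_homotopy X Y (fun t => h t)) => // [|x]; first exact: ngP.
pose s0 := simplex_of_cube (fun _ : 'I_0 => I0 R).
apply: (compose2_continuous (g := fun t _ => h t x)
  (test 0 (fun=> x) (@cst_continuous _ _ x)) (a := id) (b := fun=> s0)); ctn.
Qed.

End spaces.

(** * Homotopy sets *)

Section homotopy_sets.
Context (R : realType).

Section classes.
Context (n : nat) (X : topologicalType) (x : X).
Implicit Types f g h : cube_map R n x.

Lemma cube_homotopic_refl f : cube_homotopic f f.
Proof.
exists (fun z => f z.2); split => // [|s t]; last exact: cube_base.
by apply: (comp_continuous (g := f)); ctn; exact: cube_continuous.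
Qed.

Lemma cube_homotopic_sym f g : cube_homotopic f g -> cube_homotopic g f.
Proof.
move=> [H [cH H0 H1 Hb]]; exists (fun z => H (clamp (1 - uval z.1), z.2)).
split => [|t|t|s t]; last exact: Hb.
- by apply: (comp_continuous (g := H)) => //; ctn.
- by rewrite uval0 subr0 clamp_ge1 ?H1.
- by rewrite uval1 subrr clamp_le0 ?H0.
Qed.

Lemma cube_homotopic_trans f g h :
  cube_homotopic f g -> cube_homotopic g h -> cube_homotopic f h.
Proof.
move=> [H [cH H0 H1 Hb]] [K [cK K0 K1 Kb]].
exists (fun z => if 2 * uval z.1 - 1 <= 0 then H (clamp (2 * uval z.1), z.2)
  else K (clamp (2 * uval z.1 - 1), z.2)); split.
- apply: paste_continuous => [| | |[s t] /= s0]; first by ctn.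
  + by apply: (comp_continuous (g := H)) => //; ctn.
  + by apply: (comp_continuous (g := K)) => //; ctn.
  + by rewrite clamp_ge1 ?clamp_le0 ?H1 ?K0//; lra.
- by move=> t; rewrite uval0 ifT ?clamp_le0 ?H0//; lra.
- by move=> t; rewrite uval1 ifN ?clamp_ge1 ?K1//; lra.
- by move=> s t bt; rewrite Hb// Kb// if_same.
Qed.

Lemma hpiP f g : pi_class f = pi_class g <-> cube_homotopic f g.
Proof.
split=> [/gen_piP|fg]; last exact: gen_pi_rel.
elim=> {f g} [//|f|f g _|f g h _ + _].
- exact: cube_homotopic_refl.
- exact: cube_homotopic_sym.
- exact: cube_homotopic_trans.
Qed.

Lemma hpi_ex (c : hpi R n x) : exists f, c = pi_class f.
Proof. by exists (repr c); exact/esym/gen_reprK. Qed.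

Lemma pi_class_ext f g : f =1 g -> pi_class f = pi_class g.
Proof.
move=> fg; apply/hpiP; have [H [cH H0 H1 Hb]] := cube_homotopic_refl f.
by exists H; split => // t; rewrite H1.
Qed.

Definition hpi_one : hpi R n x := pi_class (cube_cst R n x).

End classes.

Lemma pi_map_one n (X Y : topologicalType) (f : X -> Y)
    (cf : continuous f) (x : X) (y : Y) (fx : f x = y) :
  pi_map cf fx (hpi_one n x) = hpi_one n y.
Proof. by rewrite pi_mapE; apply: pi_class_ext => t. Qed.

Lemma pi_map_comp n (X Y Z : topologicalType) (f : X -> Y) (g : Y -> Z)
    (h : X -> Z) (cf : continuous f) (cg : continuous g) (ch : continuous h)
    (x : X) (y : Y) (z : Z) (fx : f x = y) (gy : g y = z) (hx : h x = z)
    (c : hpi R n x) :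
  h =1 g \o f -> pi_map ch hx c = pi_map cg gy (pi_map cf fx c).
Proof.
move=> hE; have [k ->] := hpi_ex c; rewrite !pi_mapE.
by apply: pi_class_ext => t; exact: hE.
Qed.

Lemma pi_map_id n (X : topologicalType) (f : X -> X) (cf : continuous f) (x : X)
    (fx : f x = x) (c : hpi R n x) : f =1 id -> pi_map cf fx c = c.
Proof.
move=> fE; have [k ->] := hpi_ex c; rewrite !pi_mapE.
by apply: pi_class_ext => t; exact: fE.
Qed.

Lemma pi_map_homotopy n (X Y : topologicalType) (H : unitI R -> X -> Y)
    (f g : X -> Y) (cf : continuous f) (cg : continuous g) (x : X) (y : Y)
    (fx : f x = y) (gx : g x = y) (c : hpi R n x) :
  continuous (fun z : unitI R * X => H z.1 z.2) -> H (I0 R) =1 f ->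
  H (I1 R) =1 g -> (forall t, H t x = y) ->
  pi_map cf fx c = pi_map cg gx c.
Proof.
move=> cH H0 H1 Hx; have [h ->] := hpi_ex c; rewrite !pi_mapE; apply/hpiP.
exists (fun z => H z.1 (h z.2)); split => [|t|t|s t bt] /=.
- apply: (compose2_continuous cH); ctn.
  by apply: (comp_continuous (g := h)); ctn; exact: cube_continuous.
- exact: H0.
- exact: H1.
- by rewrite cube_base.
Qed.

(** * Cubes as loops *)

Lemma cube_boundaryS n (u : cube R n.+1) :
  cube_boundary u <-> [\/ u ord0 = I0 R, u ord0 = I1 R | cube_boundary (ctail u)].
Proof.
split=> [[i]|[h|h|[i ui]]].
- case: (unliftP ord0 i) => [j ->|->] [h|h].
  + by apply: Or33; exists j; left.
  + by apply: Or33; exists j; right.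
  + exact: Or31.
  + exact: Or32.
- by exists ord0; left.
- by exists ord0; right.
- by exists (lift ord0 i).
Qed.

Section loops.
Context (n : nat) (X : topologicalType) (x : X).

(** A cube map, seen as a loop in its first coordinate and prolonged to the
    whole line. *)
Definition as_loop (c : cube_map R n.+1 x) (t : R) (u : cube R n) : X :=
  c (ccons (clamp t) u).

Lemma as_loop_continuous (T : topologicalType) c (f : T -> R) (g : T -> cube R n) :
  continuous f -> continuous g -> continuous (fun z => as_loop c (f z) (g z)).
Proof.
move=> cf cg; apply: (comp_continuous (g := c)); last exact: cube_continuous.
by apply: ccons_continuous; ctn.
Qed.

Lemma as_loop_le0 c t u : t <= 0 -> as_loop c t u = x.
Proof.
move=> t0; apply: cube_base; apply/cube_boundaryS; apply: Or31.
by rewrite ccons0 clamp_le0.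
Qed.

Lemma as_loop_ge1 c t u : 1 <= t -> as_loop c t u = x.
Proof.
move=> t1; apply: cube_base; apply/cube_boundaryS; apply: Or32.
by rewrite ccons0 clamp_ge1.
Qed.

Lemma as_loop_base c t u : cube_boundary u -> as_loop c t u = x.
Proof.
by move=> bu; apply: cube_base; apply/cube_boundaryS; apply: Or33; rewrite cconsK.
Qed.

Lemma as_loopE c (u : cube R n.+1) : as_loop c (uval (u ord0)) (ctail u) = c u.
Proof. by rewrite /as_loop clamp_val ccons_eta. Qed.

Definition loop_fun (l : R -> cube R n -> X) (u : cube R n.+1) : X :=
  l (uval (u ord0)) (ctail u).

Section loop.
Context (l : R -> cube R n -> X) (cl : continuous (fun z : R * cube R n => l z.1 z.2))
  (l0 : forall u, l 0 u = x) (l1 : forall u, l 1 u = x)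
  (lb : forall t u, cube_boundary u -> l t u = x).

Lemma loop_fun_continuous : continuous (loop_fun l).
Proof.
apply: (compose2_continuous cl).
  by ctn; exact: cube_coord_continuous.
exact: (ctail_continuous (@id_fun_continuous _)).
Qed.

Lemma loop_fun_base u : cube_boundary u -> loop_fun l u = x.
Proof.
by rewrite /loop_fun => /cube_boundaryS[->|->|/lb//].
Qed.

Definition mkloop : cube_map R n.+1 x :=
  MkCubeMap loop_fun_continuous loop_fun_base.

End loop.

(** Homotopies may be parametrized by the line as well, as long as the
    conditions hold over the unit interval. *)
Lemma loop_homotopy (f g : cube_map R n.+1 x) (L : R -> R -> cube R n -> X) :
  continuous (fun z : (R * R) * cube R n => L z.1.1 z.1.2 z.2) ->
  (forall s u, 0 <= s <= 1 -> L s 0 u = x) ->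
  (forall s u, 0 <= s <= 1 -> L s 1 u = x) ->
  (forall s t u, cube_boundary u -> L s t u = x) ->
  (forall t u, 0 <= t <= 1 -> L 0 t u = as_loop f t u) ->
  (forall t u, 0 <= t <= 1 -> L 1 t u = as_loop g t u) ->
  pi_class f = pi_class g.
Proof.
move=> cL L0 L1 Lb Lf Lg; apply/hpiP.
have I (t : unitI R) : 0 <= uval t <= 1 by rewrite unitI_ge0 unitI_le1.
exists (fun z => L (uval z.1) (uval (z.2 ord0)) (ctail z.2)); split.
- refine (@compose2_continuous (unitI R * cube R n.+1)%type (R * R)%type _ _
    (fun w u => L w.1 w.2 u) (fun z => (uval z.1, uval (z.2 ord0)))
    (fun z => ctail z.2) cL _ _).
    by ctn; apply: proj_comp_continuous; ctn.
  by apply: ctail_continuous; ctn.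
- by move=> t /=; rewrite uval0 (Lf _ _ (I _)) as_loopE.
- by move=> t /=; rewrite uval1 (Lg _ _ (I _)) as_loopE.
- by move=> s t /cube_boundaryS[|| /Lb//] /= ->; rewrite ?uval0 ?uval1 ?(L0 _ _ (I _)) ?(L1 _ _ (I _)).
Qed.

(** Two reparametrizations of one path are joined by the straight line between
    the two parameters. *)
Lemma loop_reparam (f g : cube_map R n.+1 x) (w : R -> cube R n -> X)
    (a b : R -> R) :
  continuous (fun z : R * cube R n => w z.1 z.2) ->
  continuous a -> continuous b ->
  (forall t u, cube_boundary u -> w t u = x) ->
  (forall s u, 0 <= s <= 1 -> w ((1 - s) * a 0 + s * b 0) u = x) ->
  (forall s u, 0 <= s <= 1 -> w ((1 - s) * a 1 + s * b 1) u = x) ->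
  (forall t u, 0 <= t <= 1 -> w (a t) u = as_loop f t u) ->
  (forall t u, 0 <= t <= 1 -> w (b t) u = as_loop g t u) ->
  pi_class f = pi_class g.
Proof.
move=> cw ca cb wb w0 w1 wf wg.
apply: (@loop_homotopy _ _ (fun s t u => w ((1 - s) * a t + s * b t) u)) => //.
- refine (@compose2_continuous ((R * R) * cube R n)%type R _ _ w
    (fun z => (1 - z.1.1) * a z.1.2 + z.1.1 * b z.1.2) snd cw _ _); ctn.
    by apply: (comp_continuous (g := a)) => //; ctn.
  by apply: (comp_continuous (g := b)) => //; ctn.
- by move=> s t u bu; rewrite wb.
- by move=> t u t01; rewrite subr0 mul1r mul0r addr0 wf.
- by move=> t u t01; rewrite subrr mul0r mul1r add0r wg.
Qed.

Definition cat_fun (c d : R -> cube R n -> X) t u :=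
  if 2 * t - 1 <= 0 then c (2 * t) u else d (2 * t - 1) u.

Lemma catl c d t u : t <= 1 / 2 -> cat_fun c d t u = c (2 * t) u.
Proof. by move=> t2; rewrite /cat_fun ifT//; lra. Qed.

Lemma catr c d t u : 1 / 2 < t -> cat_fun c d t u = d (2 * t - 1) u.
Proof. by move=> t2; rewrite /cat_fun ifN//; lra. Qed.

Section cat.
Context (c d : cube_map R n.+1 x).

Lemma cat_continuous :
  continuous (fun z : R * cube R n => cat_fun (as_loop c) (as_loop d) z.1 z.2).
Proof.
apply: paste_continuous => [| | |z z0]; first by ctn.
- by apply: as_loop_continuous; ctn.
- by apply: as_loop_continuous; ctn.
- by rewrite as_loop_ge1 ?as_loop_le0//; lra.
Qed.

Lemma cat0 u : cat_fun (as_loop c) (as_loop d) 0 u = x.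
Proof. by rewrite /cat_fun ifT ?as_loop_le0//; lra. Qed.

Lemma cat1 u : cat_fun (as_loop c) (as_loop d) 1 u = x.
Proof. by rewrite /cat_fun ifN ?as_loop_ge1//; lra. Qed.

Lemma catb t u : cube_boundary u -> cat_fun (as_loop c) (as_loop d) t u = x.
Proof. by move=> bu; rewrite /cat_fun !as_loop_base// if_same. Qed.

Definition ccat : cube_map R n.+1 x := mkloop cat_continuous cat0 cat1 catb.

Lemma rev_continuous :
  continuous (fun z : R * cube R n => as_loop c (1 - z.1) z.2).
Proof. by apply: as_loop_continuous; ctn. Qed.

Lemma rev0 u : as_loop c (1 - 0) u = x.
Proof. by rewrite as_loop_ge1// subr0. Qed.

Lemma rev1 u : as_loop c (1 - 1) u = x.
Proof. by rewrite as_loop_le0// subrr. Qed.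

Lemma revb t u : cube_boundary u -> as_loop c (1 - t) u = x.
Proof. exact: as_loop_base. Qed.

Definition crev : cube_map R n.+1 x :=
  @mkloop (fun t u => as_loop c (1 - t) u) rev_continuous rev0 rev1 revb.

End cat.

Lemma as_loop_mkloop l cl l0 l1 lb t u : 0 <= t <= 1 ->
  as_loop (@mkloop l cl l0 l1 lb) t u = l t u.
Proof.
move=> /andP[t0 t1]; rewrite /as_loop /= /loop_fun ccons0 cconsK uval_clamp.
case: ifPn => [t0'|_]; first by congr (l _ u); lra.
by case: ifPn => // t1'; congr (l _ u); lra.
Qed.

Lemma as_loop_cat c d t u : 0 <= t <= 1 ->
  as_loop (ccat c d) t u = cat_fun (as_loop c) (as_loop d) t u.
Proof. exact: as_loop_mkloop. Qed.

Definition pi_mul (a b : hpi R n.+1 x) : hpi R n.+1 x :=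
  pi_class (ccat (repr a) (repr b)).
Definition pi_inv (a : hpi R n.+1 x) : hpi R n.+1 x := pi_class (crev (repr a)).

Lemma pi_mulE c d : pi_mul (pi_class c) (pi_class d) = pi_class (ccat c d).
Proof.
have /hpiP[H [cH H0 H1 Hb]] : pi_class (repr (pi_class c)) = pi_class c.
  exact: gen_reprK.
have /hpiP[K [cK K0 K1 Kb]] : pi_class (repr (pi_class d)) = pi_class d.
  exact: gen_reprK.
have [b0 b1] : (forall u : cube R n, cube_boundary (ccons (I0 R) u)) /\
    (forall u : cube R n, cube_boundary (ccons (I1 R) u)).
  by split => u; exists ord0; rewrite ccons0; [left|right].
have bb t (u : cube R n) : cube_boundary u -> cube_boundary (ccons t u).
  by move=> bu; apply/cube_boundaryS/Or33; rewrite cconsK.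
apply: (@loop_homotopy _ _ (fun s => cat_fun
  (fun t u => H (clamp s, ccons (clamp t) u))
  (fun t u => K (clamp s, ccons (clamp t) u)))).
- apply: paste_continuous => [| | |z z0]; first by ctn.
  + apply: (comp_continuous (g := H)) => //; ctn.
    by apply: ccons_continuous; ctn.
  + apply: (comp_continuous (g := K)) => //; ctn.
    by apply: ccons_continuous; ctn.
  + by rewrite (@clamp_ge1 _ (2 * _)) ?(@clamp_le0 _ (_ - 1)) ?Hb ?Kb//; lra.
- by move=> s u _; rewrite /cat_fun ifT ?(@clamp_le0 _ (2 * 0)) ?Hb//; lra.
- by move=> s u _; rewrite /cat_fun ifN ?(@clamp_ge1 _ (2 * 1 - 1)) ?Kb//; lra.
- by move=> s t u bu; rewrite /cat_fun !(Hb, Kb) ?if_same//; exact: bb.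
- by move=> t u t01; rewrite as_loop_cat// /cat_fun (@clamp_le0 _ 0)// !(H0, K0).
- by move=> t u t01; rewrite as_loop_cat// /cat_fun (@clamp_ge1 _ 1)// !(H1, K1).
Qed.

Lemma pi_mul1r (a : hpi R n.+1 x) : pi_mul a (hpi_one n.+1 x) = a.
Proof.
have [c ->] := hpi_ex a; rewrite pi_mulE.
apply: (@loop_reparam _ _ (as_loop c) (fun t => 2 * t) (fun t => t)); try by ctn.
- by apply: as_loop_continuous; ctn.
- exact: as_loop_base.
- by move=> s u s01; rewrite as_loop_le0//; lra.
- by move=> s u s01; rewrite as_loop_ge1//; lra.
- move=> t u t01; rewrite as_loop_cat// /cat_fun; case: ifPn => // t1.
  by rewrite as_loop_ge1//; lra.
Qed.

Lemma pi_mul1l (a : hpi R n.+1 x) : pi_mul (hpi_one n.+1 x) a = a.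
Proof.
have [c ->] := hpi_ex a; rewrite pi_mulE.
apply: (@loop_reparam _ _ (as_loop c) (fun t => 2 * t - 1) (fun t => t)); try by ctn.
- by apply: as_loop_continuous; ctn.
- exact: as_loop_base.
- by move=> s u s01; rewrite as_loop_le0//; lra.
- by move=> s u s01; rewrite as_loop_ge1//; lra.
- move=> t u t01; rewrite as_loop_cat// /cat_fun; case: ifPn => // t1.
  by rewrite as_loop_le0.
Qed.

Lemma pi_mulVl (a : hpi R n.+1 x) : pi_mul (pi_inv a) a = hpi_one n.+1 x.
Proof.
transitivity (pi_mul (pi_class (crev (repr a))) (pi_class (repr a))).
  by congr (pi_mul _); exact/esym/gen_reprK.
move: (repr a) => c {a}; rewrite pi_mulE.
apply: (@loop_reparam _ _ (as_loop c)
  (fun t => Num.max (1 - 2 * t) (2 * t - 1)) (fun t => 1)); try by ctn.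
- by apply: as_loop_continuous; ctn.
- by apply: max_continuous; ctn.
- exact: as_loop_base.
- by move=> s u s01; rewrite as_loop_ge1// /Num.max; case: ifPn; lra.
- by move=> s u s01; rewrite as_loop_ge1// /Num.max; case: ifPn; lra.
- move=> t u t01; rewrite as_loop_cat// /cat_fun.
  case: (leP (2 * t - 1) 0) => t2; last by rewrite max_r//; lra.
  by rewrite max_l ?as_loop_mkloop//; lra.
- by move=> t u t01; rewrite as_loop_ge1.
Qed.

Lemma pi_mulA : associative pi_mul.
Proof.
move=> a b c; have [f ->] := hpi_ex a; have [g ->] := hpi_ex b.
have [h ->] := hpi_ex c; rewrite !pi_mulE; apply/esym.
(* the three loops in a row, the first over [0, 1], the last over [2, 3] *)
pose w p u := if p - 1 <= 0 then as_loop f p u else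
  if p - 2 <= 0 then as_loop g (p - 1) u else as_loop h (p - 2) u.
have w1 p u : p <= 1 -> w p u = as_loop f p u by move=> ?; rewrite /w ifT//; lra.
have w2 p u : 1 < p <= 2 -> w p u = as_loop g (p - 1) u.
  by move=> ?; rewrite /w ifN ?ifT//; lra.
have w3 p u : 2 < p -> w p u = as_loop h (p - 2) u.
  by move=> ?; rewrite /w !ifN//; lra.
apply: (@loop_reparam _ _ w (fun t => Num.min (4 * t) (2 * t + 1))
  (fun t => Num.max (2 * t) (4 * t - 1))).
- apply: paste_continuous => [| | |z z0]; first by ctn.
  + by apply: as_loop_continuous; ctn.
  + apply: paste_continuous => [| | |z z0]; first by ctn.
    * by apply: as_loop_continuous; ctn.
    * by apply: as_loop_continuous; ctn.
    * by rewrite as_loop_ge1 ?as_loop_le0//; lra.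
  + by rewrite as_loop_ge1 ?ifT ?as_loop_le0//; lra.
- by apply: min_continuous; ctn.
- by apply: max_continuous; ctn.
- by move=> t u bu; rewrite /w !as_loop_base// !if_same.
- move=> s u s01; rewrite /w ifT ?as_loop_le0// /Num.min /Num.max;
    by do ![case: ifPn => //]; lra.
- move=> s u s01; rewrite /w !ifN ?as_loop_ge1// /Num.min /Num.max;
    by do ![case: ifPn => //]; lra.
- move=> t u t01; rewrite as_loop_cat//; case: (leP t (1 / 2)) => t2.
    rewrite catl ?as_loop_cat ?min_l; side.
    case: (leP t (1 / 4)) => t4; first by rewrite catl ?w1; [congr as_loop|..]; lra.
    by rewrite catr ?w2; [congr as_loop|..]; lra.
  by rewrite catr ?min_r ?w3; [congr as_loop|..]; lra.
- move=> t u t01; rewrite as_loop_cat//; case: (leP t (1 / 2)) => t2.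
    by rewrite catl ?max_l ?w1//; lra.
  rewrite catr ?as_loop_cat ?max_r; side.
  case: (leP t (3 / 4)) => t4; first by rewrite catl ?w2; [congr as_loop|..]; lra.
  by rewrite catr ?w3; [congr as_loop|..]; lra.
Qed.

End loops.

Lemma pi_map_mul n (X Y : topologicalType) (f : X -> Y)
    (cf : continuous f) (x : X) (y : Y) (fx : f x = y) (a b : hpi R n.+1 x) :
  pi_map cf fx (pi_mul a b) = pi_mul (pi_map cf fx a) (pi_map cf fx b).
Proof.
have [c ->] := hpi_ex a; have [d ->] := hpi_ex b.
rewrite !(pi_mulE, pi_mapE); apply: pi_class_ext => u /=.
by rewrite /loop_fun /cat_fun; case: ifP.
Qed.

End homotopy_sets.

(** * Loops of maps *)

Section map_loops.
Context (R : realType).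

(** A pointed map from [Z] to the loop space of [B], as a loop of maps. *)
Record map_loop (Z B : topologicalType) (z : Z) (b : B) := MkMapLoop {
  mloop :> unitI R -> Z -> B;
  mloop_continuous : continuous (fun w : unitI R * Z => mloop w.1 w.2);
  mloop0 : forall x, mloop (I0 R) x = b;
  mloop1 : forall x, mloop (I1 R) x = b;
  mloop_base : forall t, mloop t z = b }.

Section pi_loop.
Context (n : nat) (Z B : topologicalType) (z : Z) (b : B) (L : map_loop z b).

Definition cube_loop_fun (c : cube_map R n z) (u : cube R n.+1) : B :=
  L (u ord0) (c (ctail u)).

Lemma cube_loop_continuous c : continuous (cube_loop_fun c).
Proof.
apply: (compose2_continuous (@mloop_continuous _ _ _ _ L)).
  exact: cube_coord_continuous.
apply: (comp_continuous (g := c)); last exact: cube_continuous.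
exact: (ctail_continuous (@id_fun_continuous _)).
Qed.

Lemma cube_loop_base c u : cube_boundary u -> cube_loop_fun c u = b.
Proof.
rewrite /cube_loop_fun => /cube_boundaryS[->|->|bu].
- exact: mloop0.
- exact: mloop1.
- by rewrite cube_base// mloop_base.
Qed.

Definition cube_loop c : cube_map R n.+1 b :=
  MkCubeMap (@cube_loop_continuous c) (@cube_loop_base c).

(** The map induced by [L] once the [n]-cubes in the loop space are read as
    [n.+1]-cubes in [B]. *)
Definition pi_loop (c : hpi R n z) : hpi R n.+1 b := pi_class (cube_loop (repr c)).

Lemma pi_loopE c : pi_loop (pi_class c) = pi_class (cube_loop c).
Proof.
apply: (gen_lift_pi (f := fun c => pi_class (cube_loop c))).
move=> {}c d [H [cH H0 H1 Hb]]; apply/hpiP.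
exists (fun w => L (w.2 ord0) (H (w.1, ctail w.2))); split => [|u|u|s u] /=.
- apply: (compose2_continuous (@mloop_continuous _ _ _ _ L)).
    by apply: proj_comp_continuous; ctn.
  apply: (comp_continuous (g := H)) => //; ctn.
  by apply: ctail_continuous; ctn.
- by rewrite H0.
- by rewrite H1.
- move=> /cube_boundaryS[->|->|bu]; rewrite ?mloop0 ?mloop1//.
  by rewrite Hb// mloop_base.
Qed.

Lemma as_loop_cube_loop c t u : as_loop (cube_loop c) t u = L (clamp t) (c u).
Proof. by rewrite /as_loop /= /cube_loop_fun ccons0 cconsK. Qed.

Lemma pi_loop_one : pi_loop (hpi_one R n z) = hpi_one R n.+1 b.
Proof.
by rewrite pi_loopE; apply: pi_class_ext => u; exact: mloop_base.
Qed.

End pi_loop.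

Lemma pi_loop_post n (Z B B' : topologicalType) (z : Z) (b : B) (b' : B')
    (L : map_loop z b) (L' : map_loop z b') (f : B -> B') (cf : continuous f)
    (fb : f b = b') (c : hpi R n z) :
  (forall t x, L' t x = f (L t x)) ->
  pi_map cf fb (pi_loop L c) = pi_loop L' c.
Proof.
move=> LL; have [d ->] := hpi_ex c; rewrite !(pi_loopE, pi_mapE).
by apply: pi_class_ext => u; exact/esym/LL.
Qed.

Lemma pi_loop_pre n (Z Z' B : topologicalType) (z : Z) (z' : Z') (b : B)
    (L : map_loop z b) (L' : map_loop z' b) (g : Z' -> Z) (cg : continuous g)
    (gz : g z' = z) (c : hpi R n z') :
  (forall t x, L' t x = L t (g x)) ->
  pi_loop L (pi_map cg gz c) = pi_loop L' c.
Proof.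
move=> LL; have [d ->] := hpi_ex c; rewrite !(pi_loopE, pi_mapE).
by apply: pi_class_ext => u; exact/esym/LL.
Qed.

End map_loops.

(** * Homotopy fibration sequences *)

Section hofiber.
Context (R : realType) (X Y : NG0 R) (f : smap0 R X Y).

Definition hopoint (w : hofiber f) : X := (set_val w).1.
Definition hopath (w : hofiber f) (t : unitI R) : Y := (set_val w).2 t.

Lemma hofiber_eq (w w' : hofiber f) :
  hopoint w = hopoint w' -> (forall t, hopath w t = hopath w' t) -> w = w'.
Proof.
move=> e1 e2; apply: val_inj; apply: injective_projections; first exact: e1.
by apply/funext => t; exact: e2.
Qed.

Lemma hopath0 w : hopath w (I0 R) = f (hopoint w).
Proof. by have [_ h _] := set_mem (valP w); exact/esym/h. Qed.

Lemma hopath1 w : hopath w (I1 R) = point.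
Proof. by have [_ _ h] := set_mem (valP w); exact: h. Qed.

Lemma hofiber_in (T : topologicalType) (a : T -> X) (l : unitI R -> T -> Y) :
  continuous a -> continuous (fun z : unitI R * T => l z.1 z.2) ->
  (forall z, l (I0 R) z = f (a z)) -> (forall z, l (I1 R) z = point) ->
  exists h : T -> hofiber f, [/\ continuous h, forall z, hopoint (h z) = a z &
    forall t z, hopath (h z) t = l t z].
Proof.
move=> ca cl l0 l1.
have hP z : (a z, l ^~ z) \in
    [set z : (X * {compact-open, unitI R -> Y})%type |
      [/\ continuous (z.2 : unitI R -> Y), f z.1 = z.2 (I0 R) &
          z.2 (I1 R) = point]].
  apply/mem_set; split => //=.
  by refine (@compose2_continuous _ _ _ _ l id (fun=> z) cl _ _); ctn.
exists (fun z => to_set (hP z)); split => //.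
apply: continuous_comp_initial.
by apply: pair_continuous => //; exact: unitI_curry.
Qed.

Lemma set_val_hofiber_continuous (T : topologicalType) (h : T -> hofiber f) :
  continuous h -> continuous (fun z =>
    (set_val (h z) : (X * {compact-open, unitI R -> Y})%type)).
Proof. by move=> ch; apply: (comp_continuous ch); exact: initial_continuous. Qed.

Lemma hopoint_continuous (T : topologicalType) (h : T -> hofiber f) :
  continuous h -> continuous (fun z => hopoint (h z)).
Proof.
by move=> /set_val_hofiber_continuous ch; exact: fst_comp_continuous.
Qed.

Lemma hopath_continuous (T : topologicalType) (h : T -> hofiber f) :
  continuous h -> continuous (fun z : unitI R * T => hopath (h z.2) z.1).
Proof.
move=> /set_val_hofiber_continuous ch.
apply: (@unitI_uncurry _ _ _ (fun t z => hopath (h z) t)) => [z|].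
  by have [h1 _ _] := set_mem (valP (h z)); exact: h1.
exact: (snd_comp_continuous ch).
Qed.

End hofiber.

Section fibration.
Context (R : realType) (Z E B : NG0 R) (i : smap0 R Z E) (p : smap0 R E B).
Context (H : unitI R -> Z -> B) (Hbase : forall t, H t point = point).
Hypothesis hf : homotopy_fibration_sequence i p H.

Lemma fibration_homotopy : [/\ continuous (fun z : unitI R * Z => H z.1 z.2),
  forall z, H (I0 R) z = p (i z) & forall z, H (I1 R) z = point].
Proof.
have [phi [phiE [cphi _]]] := hf.
have HE z t : hopath (phi z) t = H t z by have [_] := phiE z; exact.
split => [|z|z].
- have := hopath_continuous cphi.
  by under eq_fun do rewrite HE.
- by rewrite -HE hopath0; congr (p _); have [] := phiE z.
- by rewrite -HE hopath1.
Qed.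

(** A map to [E] together with a null homotopy of its image in [B] is a map to
    the homotopy fiber, hence comes from [Z] up to homotopy. *)
Lemma fibration_exact n (c : hpi R n (point : E)) :
  pi_mor p c = hpi_one R n (point : B) <-> exists d, pi_mor i d = c.
Proof.
have [cH H0 H1] := fibration_homotopy.
split=> [|[d <-]]; last first.
  have [g ->] := hpi_ex d; rewrite /pi_mor !pi_mapE; apply/hpiP.
  exists (fun z => H z.1 (g z.2)); split => [|t|t|s t bt] /=.
  - apply: (compose2_continuous cH); ctn.
    by apply: (comp_continuous (g := g)); ctn; exact: cube_continuous.
  - exact: H0.
  - exact: H1.
  - by rewrite cube_base.
have [phi [phiE [cphi bij]]] := hf; have [g ->] := hpi_ex c.
have HE z t : hopath (phi z) t = H t z by have [_] := phiE z; exact.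
rewrite /pi_mor pi_mapE => /hpiP[K [cK K0 K1 Kb]].
have [h [ch h1 h2]] := @hofiber_in R E B p _ g (fun t u => K (t, u))
  (@cube_continuous _ _ _ _ g)
  (comp_continuous (pair_continuous (@fst_comp_continuous _ _ _ id (@id_fun_continuous _))
    (@snd_comp_continuous _ _ _ id (@id_fun_continuous _))) cK) K0 K1.
have hb u : cube_boundary u -> h u = phi point.
  move=> bu; apply: hofiber_eq => [|t].
    by rewrite h1 cube_base// /hopoint (phiE point).1 smap0_pt.
  by rewrite h2 Kb// HE Hbase.
have [inv _ invK] := bij n point.
pose d := inv (pi_class (MkCubeMap ch hb)).
exists d; have : pi_map cphi erefl d = pi_class (MkCubeMap ch hb) by exact: invK.
have [k ->] := hpi_ex d; rewrite !pi_mapE => /hpiP[W [cW W0 W1 Wb]].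
apply/hpiP; exists (fun z => hopoint (W z)); split => [|t|t|s t bt].
- exact: hopoint_continuous.
- by rewrite W0 /= /hopoint (phiE _).1.
- by rewrite W1 /= h1.
- by rewrite Wb// /hopoint (phiE _).1 smap0_pt.
Qed.

Section contractible.
Context (K : unitI R -> E -> E).
Hypothesis (cK : continuous (fun z : unitI R * E => K z.1 z.2)).
Hypothesis (K0 : forall e, K (I0 R) e = e) (K1 : forall e, K (I1 R) e = point).
Hypothesis (Kbase : forall t, K t point = point).

(** The path in [B] from the basepoint to itself through [p (i z)], which
    corresponds to the parameter 0. *)
Definition join_path (q : R) (z : Z) : B :=
  if q <= 0 then p (K (clamp (- q)) (i z)) else H (clamp q) z.

Lemma join_path_continuous (T : topologicalType) (q : T -> R) (g : T -> Z) :
  continuous q -> continuous g -> continuous (fun w => join_path (q w) (g w)).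
Proof.
have [cH H0 H1] := fibration_homotopy => cq cg.
apply: paste_continuous => [//| | |w w0].
- apply: (comp_continuous (g := p)); last exact: smap0_continuous.
  apply: (compose2_continuous cK); ctn.
  by apply: (comp_continuous (g := i)); ctn; exact: smap0_continuous.
- by apply: (compose2_continuous cH); ctn.
- by rewrite w0 oppr0 clamp_le0// K0 H0.
Qed.

Lemma join_path_base q : join_path q point = point.
Proof. by rewrite /join_path Hbase smap0_pt Kbase smap0_pt if_same. Qed.

Lemma join_path1 q z : 1 <= q -> join_path q z = point.
Proof.
have [_ _ H1] := fibration_homotopy.
by move=> q1; rewrite /join_path ifN ?clamp_ge1//; lra.
Qed.

Context (L : map_loop R (point : Z) (point : B)).
Hypothesis LE : forall t z, L t z = join_path (2 * uval t - 1) z.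

(** A cube in the base is a family of loops, that is, of points of the homotopy
    fiber over the basepoint of [E]; so it comes from [Z] up to a homotopy in
    the fiber, whose first component is filled in by the contraction. *)
Lemma contractible_fibration_surj n (c : hpi R n.+1 (point : B)) :
  exists d, pi_loop L d = c.
Proof.
have [cH H0 H1] := fibration_homotopy.
have [phi [phiE [cphi bij]]] := hf; have [l ->] := hpi_ex c.
have HE z t : hopath (phi z) t = H t z by have [_] := phiE z; exact.
have [h [ch h1 h2]] : exists h : cube R n -> hofiber p, [/\ continuous h,
    forall u, hopoint (h u) = point &
    forall t u, hopath (h u) t = as_loop l (uval t) u].
  apply: (@hofiber_in R E B p _ (fun=> point) (fun t u => as_loop l (uval t) u)).
  - exact: cst_continuous.
  - by apply: as_loop_continuous; ctn.
  - by move=> u; rewrite uval0 as_loop_le0// smap0_pt.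
  - by move=> u; rewrite uval1 as_loop_ge1.
have hb u : cube_boundary u -> h u = phi point.
  move=> bu; apply: hofiber_eq => [|t].
    by rewrite h1 /hopoint (phiE point).1 smap0_pt.
  by rewrite h2 as_loop_base// HE Hbase.
have [inv _ invK] := bij n point.
pose d := inv (pi_class (MkCubeMap ch hb)).
exists d; have : pi_map cphi erefl d = pi_class (MkCubeMap ch hb) by exact: invK.
have [k ->] := hpi_ex d; rewrite !pi_mapE pi_loopE => /hpiP[W [cW W0 W1 Wb]].
(* the contracted first component ends as a constant first half of the loop *)
rewrite -[RHS]pi_mul1l pi_mulE.
apply: (@loop_homotopy _ _ _ _ _ _ (fun s t u =>
  if 2 * t - 1 <= 0 then p (K (clamp (1 - 2 * t)) (hopoint (W (clamp s, u))))
  else hopath (W (clamp s, u)) (clamp (2 * t - 1)))).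
- apply: paste_continuous => [| | |z z0]; first by ctn.
  + apply: (comp_continuous (g := p)); last exact: smap0_continuous.
    apply: (compose2_continuous cK); ctn.
    by apply: hopoint_continuous; apply: (comp_continuous (g := W)) => //; ctn.
  + refine (@compose2_continuous _ _ _ _ (fun t w => hopath (W w) t)
      _ _ (hopath_continuous cW) _ _); ctn.
  + by rewrite (@clamp_le0 _ (1 - _)) ?(@clamp_le0 _ (_ - 1)) ?K0 ?hopath0//; lra.
- by move=> s u _; rewrite ifT ?(@clamp_ge1 _ (1 - _)) ?K1 ?smap0_pt//; lra.
- by move=> s u _; rewrite ifN ?(@clamp_ge1 _ (2 * 1 - 1)) ?hopath1//; lra.
- move=> s t u bu; rewrite Wb// HE Hbase /hopoint (phiE _).1.
  by rewrite smap0_pt Kbase smap0_pt if_same.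
- move=> t u /andP[t0 t1]; rewrite as_loop_cube_loop LE uval_clamp (clamp_le0 (x := 0))//.
  rewrite W0 /join_path /= HE /hopoint (phiE _).1.
  have -> : (if t <= 0 then 0 else if 1 <= t then 1 else t) = t.
    by do ![case: ifPn => //]; lra.
  by rewrite opprB.
- move=> t u t01; rewrite as_loop_cat// (clamp_ge1 (x := 1))// W1 /= h1 h2.
  rewrite Kbase smap0_pt /cat_fun; case: ifPn => // t2; rewrite /as_loop.
  by rewrite clamp_val.
Qed.

(** Contracting the point of [E] in an element of the homotopy fiber, while its
    path in [B] grows backwards, leads to the loop given by [L]. *)
Lemma join_path_fiber n (g : cube_map R n (point : Z)) (phi : Z -> hofiber p)
    (cphi : continuous phi)
    (phiE : forall z, hopoint (phi z) = i z /\ forall t, hopath (phi z) t = H t z) :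
  exists2 G : cube_map R n (phi point),
    (forall u, hopoint (G u) = point /\ forall t, hopath (G u) t = L t (g u)) &
    pi_map cphi erefl (pi_class g) = pi_class G.
Proof.
have [cH H0 H1] := fibration_homotopy.
(* at time [v] the path starts at the parameter [- v] *)
have [h [ch h1 h2]] : exists h : unitI R * cube R n -> hofiber p,
    [/\ continuous h, forall w, hopoint (h w) = K w.1 (i (g w.2)) &
      forall t w, hopath (h w) t =
        join_path (uval t * (1 + uval w.1) - uval w.1) (g w.2)].
  apply: (@hofiber_in R E B p _ (fun w => K w.1 (i (g w.2)))
    (fun t w => join_path (uval t * (1 + uval w.1) - uval w.1) (g w.2))).
  - apply: (compose2_continuous cK); ctn.
    apply: (comp_continuous (g := i)); last exact: smap0_continuous.
    by apply: (comp_continuous (g := g)); ctn; exact: cube_continuous.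
  - apply: join_path_continuous; ctn.
    by apply: (comp_continuous (g := g)); ctn; exact: cube_continuous.
  - move=> w; rewrite uval0 /join_path mul0r sub0r opprK clamp_val ifT//.
    by have := unitI_ge0 w.1; lra.
  - by move=> w; rewrite uval1 join_path1//; lra.
have hb s u : cube_boundary u -> h (s, u) = phi point.
  move=> bu; apply: hofiber_eq => [|t].
    by rewrite h1 /= cube_base// (phiE point).1 smap0_pt Kbase.
  by rewrite h2 /= cube_base// join_path_base (phiE point).2 Hbase.
have ch1 : continuous (fun u => h (I1 R, u)).
  by apply: (comp_continuous (g := h)) => //; ctn.
exists (MkCubeMap ch1 (hb (I1 R))).
  move=> u /=; split => [|t]; first by rewrite h1 /= K1.
  by rewrite h2 LE /= uval1; congr join_path; lra.
rewrite pi_mapE; apply/hpiP; exists h; split => // u.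
apply: hofiber_eq => [|t]; first by rewrite h1 /= K0 (phiE _).1.
rewrite h2 /= uval0 (phiE _).2 /join_path addr0 mulr1 subr0 clamp_val.
case: ifPn => // t0; have -> : t = I0 R.
  by rewrite -(clamp_val t) clamp_le0.
by rewrite uval0 oppr0 clamp_le0// K0 H0.
Qed.

Lemma contractible_fibration_inj n (c d : hpi R n (point : Z)) :
  pi_loop L c = pi_loop L d -> c = d.
Proof.
have [phi [phiE' [cphi bij]]] := hf.
have phiE z : hopoint (phi z) = i z /\ forall t, hopath (phi z) t = H t z.
  exact: phiE'.
have [f ->] := hpi_ex c; have [g ->] := hpi_ex d.
rewrite !pi_loopE => /hpiP[W [cW W0 W1 Wb]].
apply: (bij_inj (bij n point)).
have [F FE ->] := join_path_fiber f cphi phiE.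
have [G GE ->] := join_path_fiber g cphi phiE.
have bb t (u : cube R n) : (cube_boundary u \/ t = I0 R \/ t = I1 R) ->
    cube_boundary (ccons t u).
  move=> [bu|[->|->]]; last 2 first.
  - by exists ord0; rewrite ccons0; left.
  - by exists ord0; rewrite ccons0; right.
  by apply/cube_boundaryS/Or33; rewrite cconsK.
have [h [ch h1 h2]] : exists h : unitI R * cube R n -> hofiber p,
    [/\ continuous h, forall w, hopoint (h w) = point &
      forall t w, hopath (h w) t = W (w.1, ccons t w.2)].
  apply: (@hofiber_in R E B p _ (fun=> point) (fun t w => W (w.1, ccons t w.2))).
  - exact: cst_continuous.
  - apply: (comp_continuous (g := W)) => //; ctn.
    by apply: ccons_continuous; ctn.
  - by move=> w; rewrite Wb ?smap0_pt//; apply: bb; right; left.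
  - by move=> w; rewrite Wb//; apply: bb; right; right.
apply/hpiP; exists h; split => // [u|u|s u bu]; apply: hofiber_eq => [|t].
- by rewrite h1 (FE u).1.
- by rewrite h2 /= W0 (FE u).2 /= /cube_loop_fun ccons0 cconsK.
- by rewrite h1 (GE u).1.
- by rewrite h2 /= W1 (GE u).2 /= /cube_loop_fun ccons0 cconsK.
- by rewrite h1 (phiE _).1 smap0_pt.
- by rewrite h2 Wb ?(phiE _).2 ?Hbase//; apply: bb; left.
Qed.

(** This is the part of the long exact sequence that is used. It is stated for
    an explicit loop of maps, because naturality is read off from the latter. *)
Lemma contractible_fibration_bij n : bijective (@pi_loop R n _ _ _ _ L).
Proof.
have surj c := contractible_fibration_surj c.
pose inv c := projT1 (cid (@surj n c)).
have invK : cancel inv (@pi_loop R n _ _ _ _ L).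
  by move=> c; exact: (projT2 (cid (surj n c))).
by exists inv => // c; apply: contractible_fibration_inj; rewrite invK.
Qed.

End contractible.
End fibration.

(** * Smash products, wedges and cofibers *)

Section universal.
Context (R : realType).
Implicit Types A X Y : NG0 R.

Lemma tq_open (T : topologicalType) (r : T -> T -> Prop) (U : set (top_quot r)) :
  open ((@tq_pi T r) @^-1` U) -> open U.
Proof. by []. Qed.

Lemma wedge2_ind X Y (P : wedge2 X Y -> Prop) :
  (forall x, P (winl Y x)) -> (forall y, P (winr X y)) -> forall z, P z.
Proof.
move=> Pl Pr z.
have : (\bigcup_b (@wedge_lift _ (wedge_fam X Y) (fun b => point) b) @` setT) z.
  by rewrite wedgeTE.
by move=> [[] _ [x _ <-]]; [exact: Pl|exact: Pr].
Qed.

Lemma smash_ind X Y (P : smash X Y -> Prop) :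
  (forall x y, P (smash_pi x y)) -> forall z, P z.
Proof.
move=> Pxy z; rewrite -[z]gen_reprK; case: (repr z) => x y; exact: Pxy.
Qed.

Definition wedge2_rec X Y (W : Type) (f : X -> W) (g : Y -> W) : wedge2 X Y -> W :=
  wedge_fun (fun b => if b as b' return wedge_fam X Y b' -> W then f else g).

Lemma wedge2_recl X Y W (f : X -> W) (g : Y -> W) x :
  f point = g point -> wedge2_rec f g (winl Y x) = f x.
Proof.
move=> fg.
rewrite /wedge2_rec /winl (wedge_lift_funE (i0 := true))//.
by move=> [] [].
Qed.

Lemma wedge2_recr X Y W (f : X -> W) (g : Y -> W) y :
  f point = g point -> wedge2_rec f g (winr X y) = g y.
Proof.
move=> fg.
rewrite /wedge2_rec /winr (wedge_lift_funE (i0 := false))//.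
by move=> [] [].
Qed.

Lemma wedge2_open X Y (U : set (wedge2 X Y)) :
  open (@winl R X Y @^-1` U) -> open (@winr R X Y @^-1` U) -> open U.
Proof. by move=> Ul Ur; apply/wedge_openP => -[]. Qed.

Lemma wedge2_continuous X Y (W : topologicalType) (h : wedge2 X Y -> W) :
  continuous (h \o @winl R X Y) -> continuous (h \o @winr R X Y) -> continuous h.
Proof.
move=> /continuousP hl /continuousP hr; apply/continuousP => U oU.
by apply: wedge2_open; [exact: hl|exact: hr].
Qed.

Lemma winl_continuous X Y : continuous (@winl R X Y).
Proof. exact: (@wedge_lift_continuous _ (wedge_fam X Y) _ true). Qed.

Lemma winr_continuous X Y : continuous (@winr R X Y).
Proof. exact: (@wedge_lift_continuous _ (wedge_fam X Y) _ false). Qed.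

Lemma winl_pt X Y : winl Y (point : X) = point.
Proof. exact: (@wedge_liftE _ (wedge_fam X Y) _ _ point true point). Qed.

Lemma winr_pt X Y : winr X (point : Y) = point.
Proof. exact: (@wedge_liftE _ (wedge_fam X Y) _ _ point false point). Qed.

Definition winl_map X Y : smap0 R X (wedge2 X Y) :=
  mk_smap0 (@winl_continuous X Y) (winl_pt X Y).
Definition winr_map X Y : smap0 R Y (wedge2 X Y) :=
  mk_smap0 (@winr_continuous X Y) (winr_pt X Y).

Lemma wedge2_homotopy X Y (W : topologicalType) (h : unitI R -> wedge2 X Y -> W) :
  continuous (fun z : unitI R * X => h z.1 (winl Y z.2)) ->
  continuous (fun z : unitI R * Y => h z.1 (winr X z.2)) ->
  continuous (fun z : unitI R * wedge2 X Y => h z.1 z.2).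
Proof.
move=> hl hr; apply: unitI_uncurry => [|].
  apply: wedge2_ind => [x|y].
    by refine (@compose2_continuous _ _ _ _ (fun t x => h t (winl Y x))
      id (fun=> x) hl _ _); ctn.
  by refine (@compose2_continuous _ _ _ _ (fun t y => h t (winr X y))
    id (fun=> y) hr _ _); ctn.
apply: wedge2_continuous.
  exact: (unitI_curry (f := fun t x => h t (winl Y x)) hl).
exact: (unitI_curry (f := fun t y => h t (winr X y)) hr).
Qed.

Definition smash_rec X Y (W : Type) (g : X -> Y -> W) (z : smash X Y) : W :=
  g (repr z).1 (repr z).2.

Lemma smash_recE X Y W (g : X -> Y -> W) (w0 : W) x y :
  (forall x, g x point = w0) -> (forall y, g point y = w0) ->
  smash_rec g (smash_pi x y) = g x y.
Proof.
move=> gx gy; pose h (z : nu R (X * Y)%type) := g z.1 z.2.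
apply: (gen_lift_pi (f := h)) => -[a b] [c d].
by rewrite /smash_rel /in_wedge /h /= => -[[->|->] [->|->]]; rewrite ?gx ?gy.
Qed.

Section cofiber.
Context A X (i : smap0 R A X).

Lemma cofiber_ind (P : cofiber i -> Prop) :
  (forall x, P (cofiber_inj i x)) -> (forall t a, P (contraction_fun i t a)) ->
  forall z, P z.
Proof.
move=> Px Pa z; rewrite -[z]gen_reprK; move: (repr z).
apply: (@wedge2_ind X (cone A)) => [x|]; first exact: Px.
by apply: smash_ind => t a; exact: Pa.
Qed.

(** With values in a mere type, so that it also yields the open sets needed for
    [ng_inclusion_cofiber_inj]; continuity is a separate matter. *)
Definition cofiber_rec (W : Type) (f : X -> W) (g : unitI R -> A -> W)
    (z : cofiber i) : W :=
  @wedge2_rec X (cone A) W f (@smash_rec (NG_I R) A W g) (repr z).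

Section cofiber_recE.
Context (W : Type) (w0 : W) (f : X -> W) (g : unitI R -> A -> W).
Hypothesis (g0 : forall a, g (I0 R) a = f (i a)).
Hypothesis (g1 : forall a, g (I1 R) a = w0).
Hypothesis (gb : forall t, g t point = w0).

Let fg : f point = @smash_rec (NG_I R) A W g point.
Proof.
rewrite -(smap0_pt i) -g0 gb.
rewrite (_ : point = smash_pi (point : NG_I R) (point : A))//.
by rewrite (@smash_recE (NG_I R) A _ _ w0).
Qed.

Let rel_rec z w : @cofiber_rel R A X i z w ->
  @wedge2_rec X (cone A) W f (@smash_rec (NG_I R) A W g) z =
  @wedge2_rec X (cone A) W f (@smash_rec (NG_I R) A W g) w.
Proof.
move=> [a [-> ->]]; rewrite wedge2_recl// wedge2_recr//.
by rewrite (@smash_recE (NG_I R) A _ _ w0).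
Qed.

Lemma cofiber_rec_inj x : cofiber_rec f g (cofiber_inj i x) = f x.
Proof.
rewrite /cofiber_rec.
by rewrite (gen_lift_pi rel_rec (winl (cone A) x)) wedge2_recl.
Qed.

Lemma cofiber_rec_cone t a : cofiber_rec f g (contraction_fun i t a) = g t a.
Proof.
rewrite /cofiber_rec (gen_lift_pi rel_rec (winr X (smash_pi (t : NG_I R) a))).
by rewrite wedge2_recr// (@smash_recE (NG_I R) A _ _ w0).
Qed.

End cofiber_recE.

Lemma cofiber_open (U : set (cofiber i)) :
  open (cofiber_inj i @^-1` U) ->
  open [set z : unitI R * A | U (contraction_fun i z.1 z.2)] -> open U.
Proof.
move=> oX oA; apply: tq_open; apply: wedge2_open; first exact: oX.
apply: tq_open.
move=> n s cs.
have /continuousP/(_ _ oA) := cs.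
rewrite (_ : mkset _ =
  tq_pi @^-1` (@winr R X (cone A) @^-1` (tq_pi @^-1` U)))//.
by apply/funext => -[].
Qed.

Lemma cofiber_continuous (W : topologicalType) (h : cofiber i -> W) :
  continuous (h \o cofiber_inj i) ->
  continuous (fun z : unitI R * A => h (contraction_fun i z.1 z.2)) ->
  continuous h.
Proof.
move=> /continuousP hX /continuousP hA; apply/continuousP => U oU.
by apply: cofiber_open; [exact: hX|exact: hA].
Qed.

Lemma cofiber_homotopy (W : topologicalType) (h : unitI R -> cofiber i -> W) :
  continuous (fun z : unitI R * X => h z.1 (cofiber_inj i z.2)) ->
  continuous (fun z : unitI R * (unitI R * A) =>
    h z.1 (contraction_fun i z.2.1 z.2.2)) ->
  continuous (fun z : unitI R * cofiber i => h z.1 z.2).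
Proof.
move=> hX hA; apply: unitI_uncurry => [|].
  apply: cofiber_ind => [x|t a].
    by refine (@compose2_continuous _ _ _ _ (fun t x => h t (cofiber_inj i x))
      id (fun=> x) hX _ _); ctn.
  by refine (@compose2_continuous _ _ _ _
    (fun s z => h s (contraction_fun i z.1 z.2)) id (fun=> (t, a)) hA _ _); ctn.
apply: cofiber_continuous.
  exact: (unitI_curry (f := fun t x => h t (cofiber_inj i x)) hX).
exact: (unitI_curry (f := fun t z => h t (contraction_fun i z.1 z.2)) hA).
Qed.

Lemma contraction_fun_continuous (T : topologicalType) (f : T -> unitI R)
    (g : T -> A) : continuous f -> continuous g ->
  continuous (fun z => contraction_fun i (f z) (g z)).
Proof.
move=> cf cg.
have c1 : continuous (fun z : unitI R * A =>
    (z : nu R (NG_I R * A)%type)).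
  apply: (@ng_nu_continuous R (unitI R * A)%type (NG_I R * A)%type id).
    by apply: ng_unitI_prod; exact: ngP.
  exact: id_fun_continuous.
have c2 : continuous (fun z : nu R (NG_I R * A)%type => (tq_pi z : cone A)).
  exact: tq_pi_continuous.
have c3 : continuous (fun z : unitI R * A =>
    (tq_pi (winr X (tq_pi (z : nu R (NG_I R * A)%type) : cone A)) : cofiber i)).
  apply: (comp_continuous (g := tq_pi)); last exact: tq_pi_continuous.
  apply: (comp_continuous (g := @winr R X (cone A))); last exact: winr_continuous.
  exact: (comp_continuous c1 c2).
exact: (comp_continuous (pair_continuous cf cg) c3).
Qed.

Lemma contraction_fun0 t a : t = I0 R -> contraction_fun i t a = cofiber_inj i (i a).
Proof. by move=> ->; exact: contraction0. Qed.

Lemma contraction_fun1 t a : t = I1 R -> contraction_fun i t a = point.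
Proof. by move=> ->; exact: contraction1. Qed.

Lemma cofiber_inj_comp_continuous (T : topologicalType) (f : T -> X) :
  continuous f -> continuous (fun z => cofiber_inj i (f z)).
Proof.
move=> cf; apply: (comp_continuous (g := cofiber_inj i)) => //.
exact: smap0_continuous.
Qed.

(** An open set of [X] is the trace of an open set of the cofiber, obtained by
    thickening it along the cone, completely if it contains the basepoint. *)
Lemma ng_inclusion_cofiber_inj : ng_inclusion (cofiber_inj i).
Proof.
have I01 : I1 R = I0 R -> False by move/(congr1 (@uval R)); rewrite uval0 uval1; lra.
split=> [x y xy|n s cs].
  (* a retraction of sets, with no continuity claimed *)
  pose r := cofiber_rec id (fun t a => if t == I0 R then i a else point).
  have rE z : r (cofiber_inj i z) = z.
    rewrite /r (@cofiber_rec_inj _ point) => //= [a|a|t]; rewrite ?eqxx//.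
      by case: eqP => // /I01.
    by case: eqP; rewrite ?smap0_pt.
  by rewrite -(rE x) xy rE.
apply/continuousP => U oU.
suff [V oV VU] : exists2 V : set (cofiber i), open V & cofiber_inj i @^-1` V = U.
  rewrite -VU -comp_preimage.
  by have /continuousP := cs; exact.
have oi : open [set z : unitI R * A | U (i z.2)].
  have c2 : continuous (fun z : unitI R * A => i z.2).
    by apply: (comp_continuous (g := i)); ctn; exact: smap0_continuous.
  by have /continuousP := c2; exact.
have cu : continuous (fun z : unitI R * A => uval z.1) by ctn.
have [Up|NUp] := pselect (U point).
- pose g (t : unitI R) (a : A) := U (i a) \/ 0 < uval t.
  have g0 a : g (I0 R) a = U (i a).
    by apply/propext; rewrite /g uval0 ltxx; split => [[]//|]; left.
  have g1 a : g (I1 R) a = True.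
    by apply/propext; split => // _; right; rewrite uval1.
  have gb t : g t point = True.
    by apply/propext; split => // _; left; rewrite smap0_pt.
  exists (cofiber_rec U g); last first.
    by apply/funext => x; exact: (cofiber_rec_inj g0 g1 gb).
  apply: cofiber_open.
    by rewrite (_ : _ @^-1` _ = U)//; apply/funext => x; exact: (cofiber_rec_inj g0 g1 gb).
  rewrite (_ : mkset _ = [set z : unitI R * A | U (i z.2)] `|`
      ((fun z : unitI R * A => uval z.1) @^-1` [set x | 0 < x])); last first.
    by apply/funext => z; exact: (cofiber_rec_cone g0 g1 gb).
  apply: openU => //; have /continuousP := cu; apply; exact: open_gt.
- pose g (t : unitI R) (a : A) := U (i a) /\ uval t < 1 / 2.
  have g0 a : g (I0 R) a = U (i a).
    by apply/propext; rewrite /g uval0; split => [[]//|]; split => //; lra.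
  have g1 a : g (I1 R) a = False.
    by apply/propext; split => // -[_]; rewrite uval1; lra.
  have gb t : g t point = False.
    by apply/propext; split => // -[]; rewrite smap0_pt.
  exists (cofiber_rec U g); last first.
    by apply/funext => x; exact: (cofiber_rec_inj g0 g1 gb).
  apply: cofiber_open.
    by rewrite (_ : _ @^-1` _ = U)//; apply/funext => x; exact: (cofiber_rec_inj g0 g1 gb).
  rewrite (_ : mkset _ = [set z : unitI R * A | U (i z.2)] `&`
      ((fun z : unitI R * A => uval z.1) @^-1` [set x | x < 1 / 2])); last first.
    by apply/funext => z; exact: (cofiber_rec_cone g0 g1 gb).
  apply: openI => //; have /continuousP := cu; apply; exact: open_lt.
Qed.

End cofiber.

(** * Suspensions *)

Section susp.
Context X.

Definition susp_pi (t : unitI R) (x : X) : susp X :=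
  smash_pi (tq_pi t : circle R) x.

Lemma susp_pi0 t x : t = I0 R -> susp_pi t x = point.
Proof.
move=> ->; rewrite /susp_pi smash_pi_pt//; left.
by apply: gen_pi_rel.
Qed.

Lemma susp_pi1 t x : t = I1 R -> susp_pi t x = point.
Proof. by move=> ->; rewrite /susp_pi smash_pi_pt//; left. Qed.

Lemma susp_pi_pt t : susp_pi t point = point.
Proof. by rewrite /susp_pi smash_pi_pt//; right. Qed.

Lemma susp_ind (P : susp X -> Prop) : (forall t x, P (susp_pi t x)) -> forall z, P z.
Proof.
move=> Pst; apply: smash_ind => c x; rewrite -[c]gen_reprK; exact: Pst.
Qed.

Definition susp_rec (W : Type) (g : unitI R -> X -> W) : susp X -> W :=
  @smash_rec (circle R) X W (fun c => g (repr c)).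

Lemma susp_recE W (w0 : W) (g : unitI R -> X -> W) t x :
  (forall x, g (I0 R) x = w0) -> (forall x, g (I1 R) x = w0) ->
  (forall t, g t point = w0) -> susp_rec g (susp_pi t x) = g t x.
Proof.
move=> g0 g1 gb.
have gE s : g (repr (tq_pi s : circle R)) = g s.
  apply: (gen_lift_pi (f := g)) => a b [-> ->].
  by apply/funext => y; rewrite g0 g1.
rewrite /susp_rec /susp_pi (@smash_recE (circle R) X _ _ w0) ?gE//.
Qed.

(** The circle is a quotient of the interval, but [X] need not be locally
    compact. Its simplexes are, and on them the exponential law applies. *)
Lemma susp_continuous (W : topologicalType) (h : susp X -> W) :
  continuous (fun z : unitI R * X => h (susp_pi z.1 z.2)) -> continuous h.
Proof.
move=> ch; apply: tq_continuous; apply: (ng_continuous (@nu_ng R _)) => n s cs.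
have ca : continuous (fun d => (s d).1).
  exact: (comp_continuous cs (@nu_fst_continuous R (circle R) X)).
have cb : continuous (fun d => (s d).2).
  exact: (comp_continuous cs (@nu_snd_continuous R (circle R) X)).
pose G (c : circle R) (d : simplex R n) := h (smash_pi c (s d).2).
have cG : continuous (fun z : unitI R * simplex R n => h (susp_pi z.1 (s z.2).2)).
  refine (@compose2_continuous _ _ _ _ (fun t x => h (susp_pi t x)) fst
    (fun z => (s z.2).2) ch _ _); first by ctn.
  by apply: (comp_continuous (f := snd) (g := fun d => (s d).2)); ctn.
have cGc : continuous (fun z : circle R * simplex R n => G z.1 z.2).
  apply: uncurryE; [exact: simplex_compact|exact: simplex_hausdorff| |].
    apply: tq_continuous.
    exact: (@continuous_curry_fun (unitI R) (simplex R n) W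
      (fun z => h (susp_pi z.1 (s z.2).2))).
  move=> c; rewrite -[c]gen_reprK.
  by refine (@compose2_continuous _ _ _ _ (fun t d => h (susp_pi t (s d).2))
    (fun=> repr c) id cG _ _); ctn.
rewrite (_ : _ \o _ = fun d => G (s d).1 d); last first.
  by apply/funext => d; rewrite /G /=; case: (s d).
by refine (@compose2_continuous _ _ _ _ G (fun d => (s d).1) id cGc _ _); ctn.
Qed.

Lemma susp_homotopy (W : topologicalType) (h : unitI R -> susp X -> W) :
  continuous (fun z : unitI R * (unitI R * X) => h z.1 (susp_pi z.2.1 z.2.2)) ->
  continuous (fun z : unitI R * susp X => h z.1 z.2).
Proof.
move=> hA; apply: unitI_uncurry => [|].
  apply: susp_ind => t a.
  by refine (@compose2_continuous _ _ _ _
    (fun s z => h s (susp_pi z.1 z.2)) id (fun=> (t, a)) hA _ _); ctn.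
apply: susp_continuous.
exact: (unitI_curry (f := fun t z => h t (susp_pi z.1 z.2)) hA).
Qed.

Lemma susp_pi_continuous (T : topologicalType) (f : T -> unitI R)
    (g : T -> X) : continuous f -> continuous g ->
  continuous (fun z => susp_pi (f z) (g z)).
Proof.
move=> cf cg.
have c0 : continuous (fun z : unitI R * X => (tq_pi z.1 : circle R, z.2)).
  apply: pair_continuous; ctn.
  by apply: (comp_continuous (g := tq_pi)); ctn; exact: tq_pi_continuous.
have c1 : continuous (fun z : unitI R * X =>
    ((tq_pi z.1 : circle R, z.2) : nu R (circle R * X)%type)).
  apply: ng_nu_continuous c0; by apply: ng_unitI_prod; exact: ngP.
have c2 : continuous (fun z : unitI R * X => susp_pi z.1 z.2).
  have c3 := @smash_pi_continuous R (circle R) X.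
  exact: (comp_continuous c1 c3).
by refine (@compose2_continuous _ _ _ _ susp_pi f g c2 _ _).
Qed.

End susp.

Lemma susp_mapE X Y (f : smap0 R X Y) t x : susp_map f (susp_pi t x) = susp_pi t (f x).
Proof. exact: smash_map_pi. Qed.

End universal.

(** * Homotopies between pointed maps *)

Section homotopic.
Context (R : realType).

Lemma compmE (X Y Z : NG0 R) (g : smap0 R Y Z) (f : smap0 R X Y) x :
  compm g f x = g (f x).
Proof. by []. Qed.

Definition homotopic (X Y : NG0 R) (f g : smap0 R X Y) : Prop :=
  exists h : unitI R -> smap0 R X Y,
    [/\ continuous (fun z : unitI R * X => h z.1 z.2), h (I0 R) = f &
        h (I1 R) = g].

Lemma homotopicI (X Y : NG0 R) (f g : smap0 R X Y) (h : unitI R -> X -> Y) :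
  continuous (fun z : unitI R * X => h z.1 z.2) ->
  (forall t, h t point = point) -> h (I0 R) =1 f -> h (I1 R) =1 g ->
  homotopic f g.
Proof.
move=> ch hp h0 h1.
have c t : continuous (h t).
  by refine (@compose2_continuous _ _ _ _ h (fun=> t) id ch _ _); ctn.
exists (fun t => mk_smap0 (c t) (hp t)); split => //; exact: smap0_eq.
Qed.

Lemma pointed_homotopicW (X Y : NG0 R) (f g : smap0 R X Y) :
  pointed_homotopic f g -> homotopic f g.
Proof.
move=> [H [cH H0 H1 Hp]]; apply: (homotopicI (h := fun t x => H (t, x))) => //.
have c1 : continuous (fun z : unitI R * X => (z : nu R (unitI R * X)%type)).
  apply: (@ng_nu_continuous R (unitI R * X)%type (unitI R * X)%type id).
    by apply: ng_unitI_prod; exact: ngP.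
  exact: id_fun_continuous.
rewrite (_ : (fun z => _) = fun z : unitI R * X => H (z : nu R _)).
  exact: (comp_continuous c1 cH).
by apply/funext => -[].
Qed.

Lemma homotopic_susp (X Y : NG0 R) (f g : smap0 R X Y) :
  homotopic f g -> homotopic (susp_map f) (susp_map g).
Proof.
move=> [h [ch h0 h1]].
apply: (homotopicI (h := fun t => susp_map (h t))) => [|t|z|z].
- apply: (@susp_homotopy R X _ (fun t => susp_map (h t))).
  rewrite (_ : (fun z => _) =
    fun z : unitI R * (unitI R * X) => susp_pi z.2.1 (h z.1 z.2.2)).
    apply: susp_pi_continuous; ctn.
    by refine (@compose2_continuous _ _ _ _ (fun t x => h t x) fst
      (fun z => z.2.2) ch _ _); ctn.
  by apply/funext => z; rewrite susp_mapE.
- exact: smap0_pt.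
- by rewrite h0.
- by rewrite h1.
Qed.

(** * The Puppe sequence *)

Section collapse.
Context (A X : NG0 R) (i : smap0 R A X).

Definition collapse_fun : cofiber i -> susp A :=
  cofiber_rec (fun=> point) (@susp_pi R A).

Lemma collapse_inj x : collapse_fun (cofiber_inj i x) = point.
Proof.
by rewrite /collapse_fun (cofiber_rec_inj (w0 := point))// => a;
  [exact: susp_pi0|exact: susp_pi1|exact: susp_pi_pt].
Qed.

Lemma collapse_cone t a : collapse_fun (contraction_fun i t a) = susp_pi t a.
Proof.
by rewrite /collapse_fun (cofiber_rec_cone (w0 := point))// => b;
  [exact: susp_pi0|exact: susp_pi1|exact: susp_pi_pt].
Qed.

Lemma collapse_continuous : continuous collapse_fun.
Proof.
apply: cofiber_continuous.
  rewrite (_ : _ \o _ = fun=> point); first exact: cst_continuous.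
  by apply/funext => x; exact: collapse_inj.
rewrite (_ : (fun z => _) = fun z : unitI R * A => susp_pi z.1 z.2).
  by apply: susp_pi_continuous; ctn.
by apply/funext => z; exact: collapse_cone.
Qed.

Lemma cofiber_pt : (point : cofiber i) = cofiber_inj i point.
Proof. by rewrite smap0_pt. Qed.

Lemma collapse_pt : collapse_fun point = point.
Proof. by rewrite cofiber_pt collapse_inj. Qed.

(** The boundary map of the Puppe sequence. *)
Definition collapse : smap0 R (cofiber i) (susp A) :=
  mk_smap0 collapse_continuous collapse_pt.

Local Notation q := (cofiber_inj i).

(** In the double cofiber, the union of [X] and the cones on [A] and on [X],
    collapsing the cone on [X] leaves the suspension of [A]; with the parameter
    reversed no sign appears in [collapse_kappa] below. *)
Definition kappa_fun : cofiber q -> susp A :=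
  cofiber_rec (cofiber_rec (fun=> point) (fun t a => susp_pi (clamp (1 - uval t)) a))
    (fun _ _ => point).

Let kappa_inner_inj x :
  cofiber_rec (i := i) (fun=> point) (fun t a => susp_pi (clamp (1 - uval t)) a) (q x)
  = (point : susp A).
Proof.
rewrite (cofiber_rec_inj (w0 := point)) => //= *.
- by rewrite susp_pi1// uval0 clamp_ge1// subr0.
- by rewrite susp_pi0// uval1 clamp_le0// subrr.
- by rewrite susp_pi_pt.
Qed.

Let kappa_inner_cone t a :
  cofiber_rec (i := i) (fun=> point) (fun t a => susp_pi (clamp (1 - uval t)) a)
    (contraction_fun i t a) = (susp_pi (clamp (1 - uval t)) a : susp A).
Proof.
rewrite (cofiber_rec_cone (w0 := point)) => //= *.
- by rewrite susp_pi1// uval0 clamp_ge1// subr0.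
- by rewrite susp_pi0// uval1 clamp_le0// subrr.
- by rewrite susp_pi_pt.
Qed.

Lemma kappa_inj_inj x : kappa_fun (cofiber_inj q (q x)) = point.
Proof.
by rewrite /kappa_fun (cofiber_rec_inj (w0 := point)) // => *; rewrite kappa_inner_inj.
Qed.

Lemma kappa_inj_cone t a :
  kappa_fun (cofiber_inj q (contraction_fun i t a)) = susp_pi (clamp (1 - uval t)) a.
Proof.
by rewrite /kappa_fun (cofiber_rec_inj (w0 := point)) // => *; rewrite (kappa_inner_inj, kappa_inner_cone).
Qed.

Lemma kappa_cone t x : kappa_fun (contraction_fun q t x) = point.
Proof.
by rewrite /kappa_fun (cofiber_rec_cone (w0 := point)) // => *; rewrite kappa_inner_inj.
Qed.

Lemma kappa_continuous : continuous kappa_fun.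
Proof.
apply: cofiber_continuous.
  apply: cofiber_continuous.
    rewrite (_ : _ \o _ = fun=> point); first exact: cst_continuous.
    by apply/funext => x; exact: kappa_inj_inj.
  rewrite (_ : (fun z => _) = fun z : unitI R * A => susp_pi (clamp (1 - uval z.1)) z.2).
    by apply: susp_pi_continuous; ctn.
  by apply/funext => z; exact: kappa_inj_cone.
rewrite (_ : (fun z => _) = fun=> point); first exact: cst_continuous.
by apply/funext => z; exact: kappa_cone.
Qed.

Lemma kappa_pt : kappa_fun point = point.
Proof.
rewrite (_ : point = cofiber_inj q (q point)) ?kappa_inj_inj//.
by rewrite !smap0_pt.
Qed.

Definition kappa : smap0 R (cofiber q) (susp A) :=
  mk_smap0 kappa_continuous kappa_pt.

(** The line through both cones over [a], from the vertex of the first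
    at [-1] to the vertex of the second at [1]. *)
Definition cone_line (p : R) (a : A) : cofiber q :=
  if p <= 0 then cofiber_inj q (contraction_fun i (clamp (- p)) a)
  else contraction_fun q (clamp p) (i a).

Lemma cone_line_continuous (T : topologicalType) (p : T -> R) (g : T -> A) :
  continuous p -> continuous g -> continuous (fun z => cone_line (p z) (g z)).
Proof.
move=> cp cg; apply: paste_continuous => [//| | |z z0].
- apply: cofiber_inj_comp_continuous; apply: contraction_fun_continuous; ctn.
- apply: contraction_fun_continuous; ctn.
  by apply: (comp_continuous (g := i)) => //; exact: smap0_continuous.
- rewrite z0 oppr0 (contraction_fun0 i) ?clamp_le0//.
  by rewrite contraction_fun0.
Qed.

Lemma cone_lineN p a : p <= 0 ->
  cone_line p a = cofiber_inj q (contraction_fun i (clamp (- p)) a).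
Proof. by move=> p0; rewrite /cone_line p0. Qed.

Lemma cone_lineP p a : 0 <= p ->
  cone_line p a = contraction_fun q (clamp p) (i a).
Proof.
move=> p0; rewrite /cone_line; case: ifPn => // p0'.
have -> : p = 0 by lra.
rewrite oppr0 (contraction_fun0 i) ?clamp_le0//.
by rewrite contraction_fun0.
Qed.

Lemma cone_line1 p a : 1 <= p -> cone_line p a = point.
Proof.
by move=> p1; rewrite cone_lineP ?contraction_fun1 ?clamp_ge1//; lra.
Qed.

Lemma cone_lineN1 p a : p <= -1 -> cone_line p a = point.
Proof.
move=> p1; rewrite cone_lineN ?(contraction_fun1 i) ?clamp_ge1//; side.
by rewrite smap0_pt.
Qed.

Lemma cone_line_pt p : cone_line p point = point.
Proof.
by rewrite /cone_line smap0_pt !contraction_pt smap0_pt if_same.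
Qed.

Lemma kappa_line p a : kappa_fun (cone_line p a) = susp_pi (clamp (1 + p)) a.
Proof.
case: (leP p 0) => p0.
  rewrite cone_lineN// kappa_inj_cone uval_clamp; congr susp_pi.
  apply: unitI_eq; rewrite !uval_clamp.
  by do ![case: ifPn => //]; lra.
rewrite cone_lineP ?ltW// kappa_cone susp_pi1// clamp_ge1//; lra.
Qed.

Definition section_fun : susp A -> cofiber q :=
  susp_rec (fun t a => cone_line (2 * uval t - 1) a).

Lemma section_susp_pi t a : section_fun (susp_pi t a) = cone_line (2 * uval t - 1) a.
Proof.
rewrite /section_fun (susp_recE (w0 := point)) => //.
- by move=> x; rewrite uval0 cone_lineN1//; lra.
- by move=> x; rewrite uval1 cone_line1//; lra.
- by move=> s; rewrite cone_line_pt.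
Qed.

Lemma section_continuous : continuous section_fun.
Proof.
apply: susp_continuous.
rewrite (_ : (fun z => _) =
  fun z : unitI R * A => cone_line (2 * uval z.1 - 1) z.2).
  by apply: cone_line_continuous; ctn.
by apply/funext => z; exact: section_susp_pi.
Qed.

Lemma section_pt : section_fun point = point.
Proof.
rewrite (_ : point = susp_pi (I0 R) point); last by rewrite susp_pi_pt.
by rewrite section_susp_pi cone_line_pt.
Qed.

(** The line through the two cones, as a suspension coordinate; a homotopy
    inverse of [kappa]. *)
Definition susp_section : smap0 R (susp A) (cofiber q) :=
  mk_smap0 section_continuous section_pt.

Lemma kappa_section : homotopic (compm kappa susp_section) (idm (susp A)).
Proof.
pose h u := susp_rec (fun t a => susp_pi (clamp ((2 - uval u) * uval t)) a : susp A).
have hE u t a : h u (susp_pi t a) = susp_pi (clamp ((2 - uval u) * uval t)) a.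
  rewrite /h (susp_recE (w0 := point)) => // [x|x|s].
  - by rewrite uval0 mulr0 clamp_le0// susp_pi0.
  - by rewrite uval1 mulr1 clamp_ge1 ?susp_pi1//; have := unitI_le1 u; lra.
  - by rewrite susp_pi_pt.
apply: (homotopicI (h := h)) => [|t|z|z].
- apply: susp_homotopy.
  rewrite (_ : (fun z => _) = fun z : unitI R * (unitI R * A) =>
      susp_pi (clamp ((2 - uval z.1) * uval z.2.1)) z.2.2).
    by apply: susp_pi_continuous; ctn.
  by apply/funext => z; rewrite hE.
- by rewrite -(susp_pi_pt A (I0 R)) hE !susp_pi_pt.
- elim/susp_ind: z => t a; rewrite hE /= section_susp_pi kappa_line.
  by rewrite uval0; congr (susp_pi (clamp _) a); lra.
- elim/susp_ind: z => t a; rewrite hE /= uval1.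
  by rewrite -[in RHS](clamp_val t); congr (susp_pi (clamp _) a); lra.
Qed.

(** Push the cone on [X] to its vertex, dragging the base of the cone on [A]
    along the line through the two cones. *)
Lemma section_kappa :
  homotopic (idm (cofiber q)) (compm susp_section kappa).
Proof.
pose h1 u : cofiber i -> cofiber q := cofiber_rec
  (fun x => contraction_fun q u x)
  (fun t a => cone_line (uval u - uval t * (1 + uval u)) a).
pose h u : cofiber q -> cofiber q := cofiber_rec (h1 u)
  (fun t x => contraction_fun q (clamp (uval t + uval u)) x).
have a0 u a : cone_line (uval u - uval (I0 R) * (1 + uval u)) a =
    contraction_fun q u (i a).
  by rewrite uval0 mul0r subr0 cone_lineP ?unitI_ge0// clamp_val.
have a1 u a : cone_line (uval u - uval (I1 R) * (1 + uval u)) a = point.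
  by rewrite uval1 mul1r cone_lineN1//; lra.
have ab u t : cone_line (uval u - uval t * (1 + uval u)) point = point.
  exact: cone_line_pt.
have h1x u x : h1 u (q x) = contraction_fun q u x.
  exact: (cofiber_rec_inj (a0 u) (a1 u) (ab u)).
have h1a u t a : h1 u (contraction_fun i t a) =
    cone_line (uval u - uval t * (1 + uval u)) a.
  exact: (cofiber_rec_cone (a0 u) (a1 u) (ab u)).
have b0 u x : contraction_fun q (clamp (uval (I0 R) + uval u)) x = h1 u (q x).
  by rewrite h1x uval0 add0r clamp_val.
have b1 u x : contraction_fun q (clamp (uval (I1 R) + uval u)) x = point.
  by rewrite contraction_fun1// clamp_ge1// uval1; have := unitI_ge0 u; lra.
have bb u t : contraction_fun q (clamp (uval t + uval u)) point = point.
  exact: contraction_pt.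
have hz u z : h u (cofiber_inj q z) = h1 u z.
  exact: (cofiber_rec_inj (b0 u) (b1 u) (bb u)).
have hx u t x : h u (contraction_fun q t x) =
    contraction_fun q (clamp (uval t + uval u)) x.
  exact: (cofiber_rec_cone (b0 u) (b1 u) (bb u)).
apply: (homotopicI (h := h)) => [|t|z|z].
- apply: cofiber_homotopy.
    apply: (@cofiber_homotopy _ _ _ _ _ (fun u z => h u (cofiber_inj q z))).
      rewrite (_ : (fun z => _) =
        fun z : unitI R * X => contraction_fun q z.1 z.2).
        by apply: contraction_fun_continuous; ctn.
      by apply/funext => z; rewrite hz h1x.
    rewrite (_ : (fun z => _) = fun z : unitI R * (unitI R * A) =>
        cone_line (uval z.1 - uval z.2.1 * (1 + uval z.1)) z.2.2).
      by apply: cone_line_continuous; ctn.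
    by apply/funext => z; rewrite hz h1a.
  rewrite (_ : (fun z => _) = fun z : unitI R * (unitI R * X) =>
      contraction_fun q (clamp (uval z.2.1 + uval z.1)) z.2.2).
    by apply: contraction_fun_continuous; ctn.
  by apply/funext => z; rewrite hx.
- have {1}-> : (point : cofiber q) = contraction_fun q t point.
    by rewrite contraction_pt.
  by rewrite hx contraction_pt.
- elim/cofiber_ind: z => [z|t x]; last by rewrite hx uval0 addr0 clamp_val.
  rewrite hz; elim/cofiber_ind: z => [x|t a]; first by rewrite h1x contraction0.
  rewrite h1a uval0 sub0r addr0 mulr1 cone_lineN ?opprK ?clamp_val//.
  by have := unitI_ge0 t; lra.
- elim/cofiber_ind: z => [z|t x].
    rewrite hz; elim/cofiber_ind: z => [x|t a] /=.
      by rewrite h1x contraction1 kappa_inj_inj section_pt.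
    rewrite h1a kappa_inj_cone section_susp_pi uval1 uval_clamp.
    congr cone_line; have := unitI_ge0 t; have := unitI_le1 t.
    by do ![case: ifPn => //]; lra.
  rewrite hx /= kappa_cone section_pt contraction_fun1// clamp_ge1// uval1.
  by have := unitI_ge0 t; lra.
Qed.

End collapse.

(** Both maps collapse one of the two cones of the double cofiber; in between,
    slide the interval that is kept. *)
Section slide.
Context (A X : NG0 R) (i : smap0 R A X).
Local Notation q := (cofiber_inj i).

Definition slide_inner (u : unitI R) : cofiber i -> susp X := cofiber_rec
  (fun x => susp_pi u x) (fun t a => susp_pi (clamp (uval u - uval t)) (i a)).

Definition slide (u : unitI R) : cofiber q -> susp X := cofiber_rec
  (slide_inner u) (fun t x => susp_pi (clamp (uval t + uval u)) x).

Let a0 u a : susp_pi (clamp (uval u - uval (I0 R))) (i a) = susp_pi u (i a).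
Proof. by rewrite uval0 subr0 clamp_val. Qed.
Let a1 (u : unitI R) a : susp_pi (clamp (uval u - uval (I1 R))) (i a) = point.
Proof. by rewrite susp_pi0// uval1 clamp_le0//; have := unitI_le1 u; lra. Qed.
Let ab (u t : unitI R) : susp_pi (clamp (uval u - uval t)) (i point) = point.
Proof. by rewrite smap0_pt susp_pi_pt. Qed.

Lemma slide_inner_inj u x : slide_inner u (q x) = susp_pi u x.
Proof. exact: (cofiber_rec_inj (a0 u) (a1 u) (ab u)). Qed.

Lemma slide_inner_cone u t a : slide_inner u (contraction_fun i t a) =
  susp_pi (clamp (uval u - uval t)) (i a).
Proof. exact: (cofiber_rec_cone (a0 u) (a1 u) (ab u)). Qed.

Let b0 u x : susp_pi (clamp (uval (I0 R) + uval u)) x = slide_inner u (q x).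
Proof. by rewrite slide_inner_inj uval0 add0r clamp_val. Qed.
Let b1 (u : unitI R) (x : X) : susp_pi (clamp (uval (I1 R) + uval u)) x = point.
Proof. by rewrite susp_pi1// clamp_ge1// uval1; have := unitI_ge0 u; lra. Qed.
Let bb (u t : unitI R) : susp_pi (clamp (uval t + uval u)) (point : X) = point.
Proof. exact: susp_pi_pt. Qed.

Lemma slide_inj u z : slide u (cofiber_inj q z) = slide_inner u z.
Proof. exact: (cofiber_rec_inj (b0 u) (b1 u) (bb u)). Qed.

Lemma slide_cone u t x :
  slide u (contraction_fun q t x) = susp_pi (clamp (uval t + uval u)) x.
Proof. exact: (cofiber_rec_cone (b0 u) (b1 u) (bb u)). Qed.

Lemma slide_continuous : continuous (fun z : unitI R * cofiber q => slide z.1 z.2).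
Proof.
apply: cofiber_homotopy.
  apply: (@cofiber_homotopy _ _ _ _ _ (fun u z => slide u (cofiber_inj q z))).
    rewrite (_ : (fun z => _) = fun z : unitI R * X => susp_pi z.1 z.2).
      by apply: susp_pi_continuous; ctn.
    by apply/funext => z; rewrite slide_inj slide_inner_inj.
  rewrite (_ : (fun z => _) = fun z : unitI R * (unitI R * A) =>
      susp_pi (clamp (uval z.1 - uval z.2.1)) (i z.2.2)).
    apply: susp_pi_continuous; ctn.
    apply: (comp_continuous (g := i)); ctn; exact: smap0_continuous.
  by apply/funext => z; rewrite slide_inj slide_inner_cone.
rewrite (_ : (fun z => _) = fun z : unitI R * (unitI R * X) =>
    susp_pi (clamp (uval z.2.1 + uval z.1)) z.2.2).
  by apply: susp_pi_continuous; ctn.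
by apply/funext => z; rewrite slide_cone.
Qed.

Lemma slide_pt u : slide u point = point.
Proof. by rewrite cofiber_pt slide_inj cofiber_pt slide_inner_inj susp_pi_pt. Qed.

Lemma slide0 : slide (I0 R) =1 collapse q.
Proof.
apply: cofiber_ind => [z|t x]; last first.
  by rewrite slide_cone uval0 addr0 clamp_val; exact/esym/collapse_cone.
rewrite slide_inj [RHS]collapse_inj; elim/cofiber_ind: z => [x|t a].
  by rewrite slide_inner_inj susp_pi0.
by rewrite slide_inner_cone susp_pi0// uval0 clamp_le0//; have := unitI_ge0 t; lra.
Qed.

Lemma slide1 (z : cofiber q) : slide (I1 R) z = susp_map i (kappa_fun z).
Proof.
elim/cofiber_ind: z => [z|t x].
  rewrite slide_inj; elim/cofiber_ind: z => [x|t a].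
    by rewrite slide_inner_inj susp_pi1// kappa_inj_inj smap0_pt.
  by rewrite slide_inner_cone kappa_inj_cone susp_mapE uval1.
rewrite slide_cone kappa_cone smap0_pt susp_pi1// clamp_ge1// uval1.
by have := unitI_ge0 t; lra.
Qed.

Lemma collapse_kappa :
  homotopic (collapse (cofiber_inj i)) (compm (susp_map i) (kappa i)).
Proof.
apply: (homotopicI slide_continuous slide_pt slide0) => z.
rewrite compmE; exact: slide1.
Qed.

End slide.

Lemma susp_map_comp (X Y Z : NG0 R) (g : smap0 R Y Z) (f : smap0 R X Y) :
  susp_map (compm g f) = compm (susp_map g) (susp_map f).
Proof.
apply: smap0_eq; apply: susp_ind => t x.
have e1 := susp_mapE (compm g f) t x.
have e2 := susp_mapE g t (f x).
have e3 := congr1 (susp_map g) (susp_mapE f t x).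
exact: etrans e1 (esym (etrans (compmE _ _ _) (etrans e3 e2))).
Qed.

Lemma susp_map_id (X : NG0 R) : susp_map (idm X) = idm (susp X).
Proof. by apply: smap0_eq; apply: susp_ind => t x; exact: susp_mapE. Qed.

Lemma susp_map_cst (X Y : NG0 R) :
  susp_map (smap0_cst R X Y) = smap0_cst R (susp X) (susp Y).
Proof.
apply: smap0_eq; apply: susp_ind => t x.
have e := susp_mapE (smap0_cst R X Y) t x.
exact: etrans e (susp_pi_pt Y t).
Qed.

Lemma cofiber_null (A X : NG0 R) (i : smap0 R A X) :
  homotopic (compm (cofiber_inj i) i) (smap0_cst R A (cofiber i)).
Proof.
exists (Defs.contraction i); split.
- by apply: contraction_fun_continuous; ctn.
- by apply: smap0_eq => a; exact: contraction0.
- by apply: smap0_eq => a; exact: contraction1.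
Qed.

(** The cone on [X] is taken as the cofiber of the identity: a full subcategory
    that is closed under cofibers contains it, while it need not be closed under
    homeomorphism. *)
Section cone_contraction.
Context (X : NG0 R).
Local Notation D := (cofiber (idm X)).

Definition cone_contract_fun (u : unitI R) : D -> D :=
  cofiber_rec (fun x => contraction_fun (idm X) u x)
    (fun t x => contraction_fun (idm X) (clamp (uval t + uval u)) x).

Let a0 u x : contraction_fun (idm X) (clamp (uval (I0 R) + uval u)) x =
  contraction_fun (idm X) u x.
Proof. by rewrite uval0 add0r clamp_val. Qed.
Let a1 u x : contraction_fun (idm X) (clamp (uval (I1 R) + uval u)) x = point.
Proof.
by rewrite contraction_fun1// clamp_ge1// uval1; have := unitI_ge0 u; lra.
Qed.
Let ab u t : contraction_fun (idm X) (clamp (uval t + uval u)) point = point.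
Proof. exact: contraction_pt. Qed.

Lemma cone_contract_inj u x : cone_contract_fun u (cofiber_inj (idm X) x) =
  contraction_fun (idm X) u x.
Proof. exact: (cofiber_rec_inj (a0 u) (a1 u) (ab u)). Qed.

Lemma cone_contract_cone u t x :
  cone_contract_fun u (contraction_fun (idm X) t x) =
  contraction_fun (idm X) (clamp (uval t + uval u)) x.
Proof. exact: (cofiber_rec_cone (a0 u) (a1 u) (ab u)). Qed.

Lemma cone_contract_continuous :
  continuous (fun z : unitI R * D => cone_contract_fun z.1 z.2).
Proof.
apply: cofiber_homotopy.
  rewrite (_ : (fun z => _) =
    fun z : unitI R * X => contraction_fun (idm X) z.1 z.2).
    by apply: contraction_fun_continuous; ctn.
  by apply/funext => z; rewrite cone_contract_inj.
rewrite (_ : (fun z => _) = fun z : unitI R * (unitI R * X) =>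
    contraction_fun (idm X) (clamp (uval z.2.1 + uval z.1)) z.2.2).
  by apply: contraction_fun_continuous; ctn.
by apply/funext => z; rewrite cone_contract_cone.
Qed.

Lemma cone_contract_slice u : continuous (cone_contract_fun u).
Proof.
by refine (@compose2_continuous _ _ _ _ cone_contract_fun (fun=> u) id
  cone_contract_continuous _ _); ctn.
Qed.

Lemma cone_contract_pt u : cone_contract_fun u point = point.
Proof. by rewrite cofiber_pt cone_contract_inj contraction_pt smap0_pt. Qed.

Definition cone_contract (u : unitI R) : smap0 R D D :=
  mk_smap0 (@cone_contract_slice u) (cone_contract_pt u).

Lemma cone_contract0 : cone_contract (I0 R) = idm D.
Proof.
apply: smap0_eq; elim/cofiber_ind => [x|t x] /=.
  by rewrite cone_contract_inj contraction0.
by rewrite cone_contract_cone uval0 addr0 clamp_val.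
Qed.

Lemma cone_contract1 : cone_contract (I1 R) = smap0_cst R D D.
Proof.
apply: smap0_eq; elim/cofiber_ind => [x|t x] /=.
  by rewrite cone_contract_inj contraction1.
rewrite cone_contract_cone contraction_fun1// clamp_ge1// uval1.
by have := unitI_ge0 t; lra.
Qed.

End cone_contraction.

End homotopic.

(** * Homotopy sets of a bilinear functor *)

Lemma pi_loop_nat (R : realType) n (Z Z' B B' : topologicalType)
    (z : Z) (z' : Z') (b : B) (b' : B') (L : map_loop R z b)
    (L' : map_loop R z' b') (f : B -> B') (cf : continuous f) (fb : f b = b')
    (g : Z -> Z') (cg : continuous g) (gz : g z = z') (c : hpi R n z) :
  (forall t x, f (L t x) = L' t (g x)) ->
  pi_map cf fb (pi_loop L c) = pi_loop L' (pi_map cg gz c).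
Proof.
move=> LL; have [d ->] := hpi_ex c; rewrite !(pi_loopE, pi_mapE).
by apply: pi_class_ext => u; exact: LL.
Qed.

Section inverse.
Context (T U : Type) (f : T -> U) (bf : bijective f).

Lemma bij_surj_ex (u : U) : exists t, f t = u.
Proof. by case: bf => g _ gK; exists (g u). Qed.

Definition binv (u : U) : T := projT1 (cid (bij_surj_ex u)).

Lemma binvK u : f (binv u) = u.
Proof. exact: (projT2 (cid (bij_surj_ex u))). Qed.

Lemma Kbinv t : binv (f t) = t.
Proof. by apply: (bij_inj bf); rewrite binvK. Qed.

Lemma binv_bij : bijective binv.
Proof. by exists f; [exact: binvK|exact: Kbinv]. Qed.

End inverse.

Section suspension_path.
Context (R : realType) (X : NG0 R).

Lemma susp_pi_slice t : continuous (@susp_pi R X t).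
Proof. by apply: susp_pi_continuous; ctn. Qed.

Definition susp_path (t : unitI R) : smap0 R X (susp X) :=
  mk_smap0 (@susp_pi_slice t) (susp_pi_pt X t).

Lemma susp_path_continuous : continuous (fun z : unitI R * X => susp_path z.1 z.2).
Proof. by apply: susp_pi_continuous; ctn. Qed.

Lemma ng_inclusion_id : ng_inclusion (idm X).
Proof. by split=> [x y|n s]. Qed.

Lemma section_susp_path t x : susp_section (idm X) (susp_path t x) =
  cone_line (idm X) (2 * uval t - 1) x.
Proof. exact: section_susp_pi. Qed.

End suspension_path.

Section action.
Context (R : realType) (C : subcat R) (F : bifunctor C).
Hypothesis hF : bilinear_functor F.
Implicit Types A B X Y : obj C.

Definition act n X X' Y Y' (f : smap0 R X' X) (g : smap0 R Y Y') :
  hpi R n (point : F X Y) -> hpi R n (point : F X' Y') := pi_mor (bmor F f g).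
Arguments act n {X X' Y Y'}.

Lemma act_comp n X X' X'' Y Y' Y'' (f : smap0 R X' X) (f' : smap0 R X'' X')
    (g : smap0 R Y Y') (g' : smap0 R Y' Y'') c :
  act n f' g' (act n f g c) = act n (compm f f') (compm g' g) c.
Proof.
by apply/esym; apply: pi_map_comp => z; exact: bmor_comp.
Qed.

Lemma act_id n X Y c : act n (idm X) (idm Y) c = c.
Proof. by apply: pi_map_id => z; exact: bmor_id. Qed.

Lemma compm_idl (X Y : NG0 R) (f : smap0 R X Y) : compm (idm Y) f = f.
Proof. exact: smap0_eq. Qed.

Lemma compm_idr (X Y : NG0 R) (f : smap0 R X Y) : compm f (idm X) = f.
Proof. exact: smap0_eq. Qed.

Lemma act_compl n X X' X'' Y (f : smap0 R X' X) (f' : smap0 R X'' X') c :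
  act n f' (idm Y) (act n f (idm Y) c) = act n (compm f f') (idm Y) c.
Proof. by rewrite act_comp compm_idl. Qed.

Lemma act_compr n X Y Y' Y'' (g : smap0 R Y Y') (g' : smap0 R Y' Y'') c :
  act n (idm X) g' (act n (idm X) g c) = act n (idm X) (compm g' g) c.
Proof. by rewrite act_comp compm_idl. Qed.

Lemma act_one n X X' Y Y' (f : smap0 R X' X) (g : smap0 R Y Y') :
  act n f g (hpi_one R n point) = hpi_one R n point.
Proof. exact: pi_map_one. Qed.

Lemma bmor_cst X X' Y Y' (f : smap0 R X' X) (g : smap0 R Y Y') :
  (forall x, f x = point) \/ (forall y, g y = point) ->
  forall z, bmor F f g z = point.
Proof. by have [[_ h] _ _] := hF; exact: h. Qed.

Lemma act_cst n X X' Y Y' (f : smap0 R X' X) (g : smap0 R Y Y') c :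
  (forall x, f x = point) \/ (forall y, g y = point) ->
  act n f g c = hpi_one R n point.
Proof.
move=> fg; have [d ->] := hpi_ex c; rewrite /act /pi_mor pi_mapE.
by apply: pi_class_ext => u; exact: bmor_cst.
Qed.

(** The enrichment, read through the exponential law. *)
Lemma bmor_homotopy X X' Y Y' (f : unitI R -> smap0 R X' X)
    (g : unitI R -> smap0 R Y Y') :
  continuous (fun z : unitI R * X' => f z.1 z.2) ->
  continuous (fun z : unitI R * Y => g z.1 z.2) ->
  continuous (fun z : unitI R * F X Y => bmor F (f z.1) (g z.1) z.2).
Proof.
move=> /smap0_curry cf /smap0_curry cg; have [[cF _] _ _] := hF.
have c1 : continuous (fun t => (f t, g t) : nu R (F0 X' X * F0 Y Y')%type).
  apply: (@ng_nu_continuous R (unitI R) (F0 X' X * F0 Y Y')%type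
    (fun t => (f t, g t)) (@ng_unitI R)).
  exact: pair_continuous.
apply: (@smap0_uncurry R (F X Y) (F X' Y') (fun t => bmor F (f t) (g t))).
exact: (comp_continuous c1 (cF X X' Y Y')).
Qed.

Lemma act_homotopic n X X' Y Y' (f f' : smap0 R X' X) (g g' : smap0 R Y Y') c :
  homotopic f f' -> homotopic g g' -> act n f g c = act n f' g' c.
Proof.
move=> [h [ch h0 h1]] [k [ck k0 k1]].
apply: (@pi_map_homotopy R n _ _ (fun t => bmor F (h t) (k t))).
- exact: bmor_homotopy.
- by rewrite h0 k0.
- by rewrite h1 k1.
- by move=> t; exact: smap0_pt.
Qed.

Lemma homotopic_refl (X Y : NG0 R) (f : smap0 R X Y) : homotopic f f.
Proof.
exists (fun=> f); split => //; apply: (comp_continuous (g := f)); ctn.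
exact: smap0_continuous.
Qed.

Lemma act_homotopicr n X Y Y' (g g' : smap0 R Y Y') c :
  homotopic g g' -> act n (idm X) g c = act n (idm X) g' c.
Proof. by apply: act_homotopic; exact: homotopic_refl. Qed.

Lemma act_homotopicl n X X' Y (f f' : smap0 R X' X) c :
  homotopic f f' -> act n f (idm Y) c = act n f' (idm Y) c.
Proof. by move=> ff; apply: act_homotopic => //; exact: homotopic_refl. Qed.

Lemma act_exactr n A B Y (i : smap0 R B Y) (hi : ng_inclusion i) c :
  @act n A A Y (cofiber_obj hi) (idm A) (cofiber_inj i) c = hpi_one R n point <->
  exists d, act n (idm A) i d = c.
Proof.
have [_ _ /(_ A B Y i hi) fib] := hF.
by apply: (fibration_exact _ fib) => t; exact: smap0_pt.
Qed.

Lemma act_exactl n A X Y (i : smap0 R A X) (hi : ng_inclusion i) c :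
  act n i (idm Y) c = hpi_one R n point <->
  exists d, @act n (cofiber_obj hi) X Y Y (cofiber_inj i) (idm Y) d = c.
Proof.
have [_ /(_ A X Y i hi) fib _] := hF.
by apply: (fibration_exact _ fib) => t; exact: smap0_pt.
Qed.

(** * Suspension isomorphisms *)

Lemma susp_path_cst X t : t = I0 R \/ t = I1 R -> forall x : X, susp_path X t x = point.
Proof. by move=> [->|->] x; [exact: susp_pi0|exact: susp_pi1]. Qed.

Lemma susp_covar_continuous A Y : continuous (fun w : unitI R * F A Y =>
  @bmor R C F A A Y (susp_obj Y) (idm A) (susp_path Y w.1) w.2).
Proof.
apply: (@bmor_homotopy A A Y (susp_obj Y) (fun=> idm A) (fun t => susp_path Y t)).
  by apply: (@snd_comp_continuous _ _ _ id); ctn.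
exact: susp_path_continuous.
Qed.

Lemma susp_covar_cst A Y t : t = I0 R \/ t = I1 R -> forall z : F A Y,
  @bmor R C F A A Y (susp_obj Y) (idm A) (susp_path Y t) z = point.
Proof.
move=> t01; apply: (@bmor_cst A A Y (susp_obj Y)).
by right; exact: (@susp_path_cst Y).
Qed.

(** The maps [x |-> [t, x]] form a loop of maps from [Y] to its suspension, which
    the covariant functor [F A] turns into a map from [F A Y] to the loop space
    of [F A (susp Y)]. *)
Definition susp_covar_loop A Y : map_loop R (point : F A Y) (point : F A (susp_obj Y)) :=
  @MkMapLoop R (F A Y) (F A (susp_obj Y)) point point
    (fun t z => @bmor R C F A A Y (susp_obj Y) (idm A) (susp_path Y t) z)
    (@susp_covar_continuous A Y)
    (@susp_covar_cst A Y _ (or_introl erefl)) (@susp_covar_cst A Y _ (or_intror erefl))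
    (fun t => smap0_pt (@bmor R C F A A Y (susp_obj Y) (idm A) (susp_path Y t))).

Definition susp_covar n A Y : hpi R n (point : F A Y) ->
  hpi R n.+1 (point : F A (susp_obj Y)) := pi_loop (susp_covar_loop A Y).

Lemma desusp_contra_continuous A Y : continuous (fun w : unitI R * F (susp_obj A) Y =>
  @bmor R C F (susp_obj A) A Y Y (susp_path A w.1) (idm Y) w.2).
Proof.
apply: (@bmor_homotopy (susp_obj A) A Y Y (fun t => susp_path A t) (fun=> idm Y)).
  exact: susp_path_continuous.
by apply: (@snd_comp_continuous _ _ _ id); ctn.
Qed.

Lemma desusp_contra_cst A Y t : t = I0 R \/ t = I1 R -> forall z : F (susp_obj A) Y,
  @bmor R C F (susp_obj A) A Y Y (susp_path A t) (idm Y) z = point.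
Proof.
move=> t01; apply: (@bmor_cst (susp_obj A) A Y Y).
by left; exact: (@susp_path_cst A).
Qed.

(** The same loop of maps, read by the contravariant functor [F - Y]. *)
Definition desusp_contra_loop A Y : map_loop R (point : F (susp_obj A) Y) (point : F A Y) :=
  @MkMapLoop R (F (susp_obj A) Y) (F A Y) point point
    (fun t z => @bmor R C F (susp_obj A) A Y Y (susp_path A t) (idm Y) z)
    (@desusp_contra_continuous A Y)
    (@desusp_contra_cst A Y _ (or_introl erefl)) (@desusp_contra_cst A Y _ (or_intror erefl))
    (fun t => smap0_pt (@bmor R C F (susp_obj A) A Y Y (susp_path A t) (idm Y))).

Definition desusp_contra n A Y : hpi R n (point : F (susp_obj A) Y) ->
  hpi R n.+1 (point : F A Y) := pi_loop (desusp_contra_loop A Y).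

Lemma susp_path_nat (X Y : NG0 R) (f : smap0 R X Y) t :
  compm (susp_map f) (susp_path X t) = compm (susp_path Y t) f.
Proof. by apply: smap0_eq => x; rewrite !compmE; exact: susp_mapE. Qed.

Lemma susp_covar_nat n A A' Y Y' (f : smap0 R A' A) (g : smap0 R Y Y') c :
  @act n.+1 A A' (susp_obj Y) (susp_obj Y') f (susp_map g) (susp_covar c) =
  susp_covar (act n f g c).
Proof.
apply: pi_loop_nat => t x.
have e1 := @bmor_comp R C F A A A' Y (susp_obj Y) (susp_obj Y')
  (idm A) f (susp_path Y t) (susp_map g) x.
have e2 := @bmor_comp R C F A A' A' Y Y' (susp_obj Y')
  f (idm A') g (susp_path Y' t) x.
rewrite /= in e1 e2; rewrite /= -e1 -e2.
by rewrite susp_path_nat compm_idl compm_idr.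
Qed.

Lemma desusp_contra_nat n A A' Y Y' (f : smap0 R A' A) (g : smap0 R Y Y') c :
  act n.+1 f g (desusp_contra c) =
  desusp_contra (@act n (susp_obj A) (susp_obj A') Y Y' (susp_map f) g c).
Proof.
apply: pi_loop_nat => t x.
have e1 := @bmor_comp R C F (susp_obj A) A A' Y Y Y'
  (susp_path A t) f (idm Y) g x.
have e2 := @bmor_comp R C F (susp_obj A) (susp_obj A') A' Y Y' Y'
  (susp_map f) (susp_path A' t) g (idm Y') x.
rewrite /= in e1 e2; rewrite /= -e1 -e2.
by rewrite susp_path_nat compm_idl compm_idr.
Qed.

Section cone.
Context (X : obj C).

Definition cone_obj : obj C := cofiber_obj (ng_inclusion_id X).
Let D := cone_obj.
Let q : smap0 R X D := cofiber_inj (idm X).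
Definition double_cone_obj : obj C :=
  @cofiber_obj R C X D q (ng_inclusion_cofiber_inj (idm X)).
Let B := double_cone_obj.
Let qq : smap0 R D B := cofiber_inj q.
Let s : smap0 R (susp_obj X) B := susp_section (idm X).

(** The next two equations cut the loop formed by the contraction of [D] and the
    null homotopy of the fibration sequence: it is the canonical loop in the
    suspension, followed by the homotopy equivalence [s]. *)
Lemma cone_lineNE t : 2 * uval t - 1 <= 0 ->
  compm qq (compm (cone_contract X (clamp (- (2 * uval t - 1)))) q) =
  compm s (susp_path X t).
Proof.
move=> t0; apply: smap0_eq => x; rewrite !compmE section_susp_path cone_lineN//.
by congr (cofiber_inj _ _); exact: cone_contract_inj.
Qed.

Lemma cone_linePE t : 0 <= 2 * uval t - 1 ->
  Defs.contraction q (clamp (2 * uval t - 1)) = compm s (susp_path X t).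
Proof.
by move=> t0; apply: smap0_eq => x; rewrite compmE section_susp_path cone_lineP.
Qed.

Lemma kappa_susp_section n A c :
  @act n A A B (susp_obj X) (idm A) (kappa (idm X))
    (@act n A A (susp_obj X) B (idm A) s c) = c.
Proof.
rewrite act_compr (@act_homotopicr n A (susp_obj X) (susp_obj X) _ _ _ (kappa_section (idm X))); exact: act_id.
Qed.

Lemma susp_section_kappa n A c :
  @act n A A (susp_obj X) B (idm A) s
    (@act n A A B (susp_obj X) (idm A) (kappa (idm X)) c) = c.
Proof.
rewrite act_compr -(@act_homotopicr n A B B _ _ _ (section_kappa (idm X))); exact: act_id.
Qed.

Lemma susp_section_bijr n A : bijective (@act n A A (susp_obj X) B (idm A) s).
Proof.
exists (@act n A A B (susp_obj X) (idm A) (kappa (idm X))) => c.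
  exact: kappa_susp_section.
exact: susp_section_kappa.
Qed.

Lemma susp_section_bijl n Y : bijective (@act n B (susp_obj X) Y Y s (idm Y)).
Proof.
exists (@act n (susp_obj X) B Y Y (kappa (idm X)) (idm Y)) => c.
  rewrite act_compl -(@act_homotopicl n B B Y _ _ _ (section_kappa (idm X))); exact: act_id.
rewrite act_compl (@act_homotopicl n (susp_obj X) (susp_obj X) Y _ _ _ (kappa_section (idm X))); exact: act_id.
Qed.

(** The sequence of [X] in its cone exhibits [F A X] as the loop space of
    [F A (susp X)], since [F A] of the cone is contractible. *)
Lemma susp_covar_bij n A : bijective (@susp_covar n A X).
Proof.
have [_ _ /(_ A X D q (ng_inclusion_cofiber_inj (idm X))) fib] := hF.
pose K t := bmor F (idm A) (cone_contract X t : smap0 R D D).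
have cL : continuous (fun w : unitI R * F A X =>
    bmor F (idm A) (compm s (susp_path X w.1) : smap0 R X B) w.2).
  apply: (@bmor_homotopy A A X B (fun=> idm A) (fun t => compm s (susp_path X t))).
    by apply: (@snd_comp_continuous _ _ _ id); ctn.
  exact: (comp_continuous (@susp_path_continuous R X) (@smap0_continuous R (susp_obj X) B s)).
have L01 t z : t = I0 R \/ t = I1 R ->
    bmor F (idm A) (compm s (susp_path X t) : smap0 R X B) z = point.
  move=> t01; apply: bmor_cst; right => y.
  by rewrite compmE susp_path_cst// smap0_pt.
pose L : map_loop R (point : F A X) (point : F A B) :=
  @MkMapLoop R (F A X) (F A B) point point
  (fun t z => bmor F (idm A) (compm s (susp_path X t) : smap0 R X B) z) cL
  (fun z => L01 _ z (or_introl erefl)) (fun z => L01 _ z (or_intror erefl))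
  (fun t => smap0_pt (bmor F (idm A) (compm s (susp_path X t) : smap0 R X B))).
have Lbij : bijective (@pi_loop R n _ _ _ _ L).
  apply: (contractible_fibration_bij _ fib (K := fun t => K t)).
  - by move=> t; exact: smap0_pt.
  - apply: (@bmor_homotopy A A D D (fun=> idm A) (fun t => cone_contract X t)).
      by apply: (@snd_comp_continuous _ _ _ id); ctn.
    exact: cone_contract_continuous.
  - by move=> e; rewrite /K cone_contract0; exact: bmor_id.
  - by move=> e; rewrite /K cone_contract1; apply: bmor_cst; right.
  - by move=> t; exact: smap0_pt.
  - move=> t z; rewrite /join_path; case: ifPn => t0.
      have e1 := @bmor_comp R C F A A A X D D (idm A) (idm A) q
        (cone_contract X (clamp (- (2 * uval t - 1)))) z.
      have e2 := @bmor_comp R C F A A A X D B (idm A) (idm A)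
        (compm (cone_contract X (clamp (- (2 * uval t - 1)))) q) qq z.
      rewrite /= in e1 e2; rewrite compm_idl in e1; rewrite /K -e1 -e2 (cone_lineNE t0).
      by rewrite compm_idl.
    by rewrite cone_linePE//; move: t0; rewrite -ltNge => /ltW.
have LE c : pi_loop L c = @act n.+1 A A (susp_obj X) B (idm A) s (susp_covar c).
  apply/esym; apply: pi_loop_post => t x.
  have := @bmor_comp R C F A A A X (susp_obj X) B (idm A) (idm A) (susp_path X t) s x.
  by rewrite /= => <-; rewrite compm_idl.
have [k kK Kk] := Lbij.
exists (fun c => k (@act n.+1 A A (susp_obj X) B (idm A) s c)) => c.
  by rewrite -LE kK.
by apply: (bij_inj (susp_section_bijr n.+1 A)); rewrite -LE Kk.
Qed.

(** Dually, [F - Y] of the cone is contractible; here the homotopy equivalence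
    enters on the side of the fiber. *)
Lemma desusp_contra_bij n Y : bijective (@desusp_contra n X Y).
Proof.
have [_ /(_ X D Y q (ng_inclusion_cofiber_inj (idm X))) fib _] := hF.
pose K t := bmor F (cone_contract X t : smap0 R D D) (idm Y).
have cL : continuous (fun w : unitI R * F B Y =>
    bmor F (compm s (susp_path X w.1) : smap0 R X B) (idm Y) w.2).
  apply: (@bmor_homotopy B X Y Y (fun t => compm s (susp_path X t)) (fun=> idm Y)).
    exact: (comp_continuous (@susp_path_continuous R X) (@smap0_continuous R (susp_obj X) B s)).
  by apply: (@snd_comp_continuous _ _ _ id); ctn.
have L01 t z : t = I0 R \/ t = I1 R ->
    bmor F (compm s (susp_path X t) : smap0 R X B) (idm Y) z = point.
  move=> t01; apply: bmor_cst; left => y.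
  by rewrite compmE susp_path_cst// smap0_pt.
pose L : map_loop R (point : F B Y) (point : F X Y) :=
  @MkMapLoop R (F B Y) (F X Y) point point
  (fun t z => bmor F (compm s (susp_path X t) : smap0 R X B) (idm Y) z) cL
  (fun z => L01 _ z (or_introl erefl)) (fun z => L01 _ z (or_intror erefl))
  (fun t => smap0_pt (bmor F (compm s (susp_path X t) : smap0 R X B) (idm Y))).
have Lbij : bijective (@pi_loop R n _ _ _ _ L).
  apply: (contractible_fibration_bij _ fib (K := fun t => K t)).
  - by move=> t; exact: smap0_pt.
  - apply: (@bmor_homotopy D D Y Y (fun t => cone_contract X t) (fun=> idm Y)).
      exact: cone_contract_continuous.
    by apply: (@snd_comp_continuous _ _ _ id); ctn.
  - by move=> e; rewrite /K cone_contract0; exact: bmor_id.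
  - by move=> e; rewrite /K cone_contract1; apply: bmor_cst; left.
  - by move=> t; exact: smap0_pt.
  - move=> t z; rewrite /join_path; case: ifPn => t0.
      have e1 := @bmor_comp R C F B D D Y Y Y qq
        (cone_contract X (clamp (- (2 * uval t - 1)))) (idm Y) (idm Y) z.
      have e2 := @bmor_comp R C F B D X Y Y Y
        (compm qq (cone_contract X (clamp (- (2 * uval t - 1))))) q
        (idm Y) (idm Y) z.
      rewrite /= in e1 e2; rewrite compm_idl in e1; rewrite /K -e1 -e2.
      have -> : L t z = bmor F (compm s (susp_path X t) : smap0 R X B) (idm Y) z by [].
      rewrite compm_idl -(cone_lineNE t0).
      by congr (bmor F _ _ z); exact: smap0_eq.
    by rewrite cone_linePE//; move: t0; rewrite -ltNge => /ltW.
have LE c : pi_loop L c = desusp_contra (@act n B (susp_obj X) Y Y s (idm Y) c).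
  apply/esym; apply: pi_loop_pre => t x.
  have := @bmor_comp R C F B (susp_obj X) X Y Y Y s (susp_path X t) (idm Y) (idm Y) x.
  by rewrite /= => <-; rewrite compm_idl.
have [k kK Kk] := Lbij; have [j jK Kj] := susp_section_bijl n Y.
exists (fun c => @act n B (susp_obj X) Y Y s (idm Y) (k c)) => c.
  by rewrite -[c]Kj -LE kK.
by rewrite -LE Kk.
Qed.

End cone.

End action.
Arguments act {R C F} n {X X' Y Y'}.

(** * Wedges *)

Section wedge.
Context (R : realType).

Lemma copair_winl (X Y Z : NG0 R) (f : smap0 R X Z) (g : smap0 R Y Z) x :
  copair f g (winl Y x) = f x.
Proof.
rewrite /copair /winl /= (wedge_lift_funE (i0 := true))//.
by move=> b c; rewrite !copair_fam_pt.
Qed.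

Lemma copair_winr (X Y Z : NG0 R) (f : smap0 R X Z) (g : smap0 R Y Z) y :
  copair f g (winr X y) = g y.
Proof.
rewrite /copair /winr /= (wedge_lift_funE (i0 := false))//.
by move=> b c; rewrite !copair_fam_pt.
Qed.

Lemma copair_inl (X Y Z : NG0 R) (f : smap0 R X Z) (g : smap0 R Y Z) :
  compm (copair f g) (winl_map X Y) = f.
Proof. by apply: smap0_eq => x; rewrite compmE; exact: copair_winl. Qed.

Lemma copair_inr (X Y Z : NG0 R) (f : smap0 R X Z) (g : smap0 R Y Z) :
  compm (copair f g) (winr_map X Y) = g.
Proof. by apply: smap0_eq => x; rewrite compmE; exact: copair_winr. Qed.

Context (X : NG0 R).
Local Notation i := (winl_map X X).

Lemma ng_inclusion_winl : ng_inclusion i.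
Proof.
split=> [x y xy|n s cs].
  exact: etrans (esym (copair_winl (idm X) (smap0_cst R X X) x))
    (etrans (congr1 (wproj1 X) xy) (copair_winl _ _ y)).
have c : continuous (wproj1 X \o (i \o s)).
  exact: (comp_continuous cs (@smap0_continuous R _ _ (wproj1 X))).
rewrite (_ : s = wproj1 X \o (i \o s))//.
by apply/funext => x; exact/esym/copair_winl.
Qed.

(** In the cofiber of a summand, that summand is contracted. *)
Lemma cofiber_winl :
  homotopic (cofiber_inj i)
    (compm (cofiber_inj i) (compm (winr_map X X) (wproj2 X))).
Proof.
pose h t : wedge2 X X -> cofiber i := wedge2_rec
  (fun x => contraction_fun i t x) (fun y => cofiber_inj i (winr X y)).
have hp t : contraction_fun i t point = cofiber_inj i (winr X point).
  by rewrite contraction_pt winr_pt smap0_pt.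
have hl t x : h t (winl X x) = contraction_fun i t x by exact: wedge2_recl (hp t).
have hr t y : h t (winr X y) = cofiber_inj i (winr X y).
  exact: wedge2_recr (hp t).
apply: (homotopicI (h := h)) => [|t|z|z].
- apply: wedge2_homotopy.
    rewrite (_ : (fun z => _) = fun z : unitI R * X => contraction_fun i z.1 z.2).
      by apply: contraction_fun_continuous; ctn.
    by apply/funext => z; rewrite hl.
  rewrite (_ : (fun z => _) = fun z : unitI R * X => cofiber_inj i (winr X z.2)).
    apply: cofiber_inj_comp_continuous.
    by apply: (comp_continuous (g := @winr R X X)); ctn; exact: winr_continuous.
  by apply/funext => z; rewrite hr.
- by rewrite -winl_pt hl contraction_pt.
- elim/wedge2_ind: z => [x|y]; last by rewrite hr.
  by rewrite hl; exact: contraction0.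
- elim/wedge2_ind: z => [x|y].
    rewrite hl contraction1 !compmE.
    by rewrite [wproj2 X _]copair_winl [winr_map _ _ _]winr_pt smap0_pt.
  by rewrite hr !compmE [wproj2 X _]copair_winr.
Qed.

End wedge.

(** * The group structure *)

Section group.
Context (R : realType) (C : subcat R) (F : bifunctor C).
Hypothesis hF : bilinear_functor F.
Implicit Types A B X Y : obj C.

Local Notation act0 := (act 0%N).

(** The proof that [F] is bilinear is a parameter of the type because the group
    structure depends on it. *)
Definition grp of bilinear_functor F := fun A Y => hpi R 0 (point : F A Y).
Local Notation G := (grp hF).
HB.instance Definition _ A Y := Choice.on (G A Y).

Definition grp_pi1 A Y : G A Y -> hpi R 1 (point : F A (susp_obj Y)) :=
  @susp_covar R C F hF 0%N A Y.

Lemma grp_pi1_bij A Y : bijective (@grp_pi1 A Y).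
Proof. exact: susp_covar_bij. Qed.

Definition gact A A' Y Y' (f : smap0 R A' A) (g : smap0 R Y Y') :
  G A Y -> G A' Y' := act 0%N f g.
Arguments gact {A A' Y Y'}.

Lemma grp_pi1_nat A A' Y Y' (f : smap0 R A' A) (g : smap0 R Y Y') c :
  grp_pi1 (gact f g c) =
  @act R C F 1 A A' (susp_obj Y) (susp_obj Y') f (susp_map g) (grp_pi1 c).
Proof. by rewrite /grp_pi1 susp_covar_nat. Qed.

(** Concatenation of loops, transported from [F A (susp Y)]. *)
Definition gmul A Y (a b : G A Y) : G A Y := binv (grp_pi1_bij A Y) (pi_mul (grp_pi1 a) (grp_pi1 b)).
Definition ginv A Y (a : G A Y) : G A Y := binv (grp_pi1_bij A Y) (pi_inv (grp_pi1 a)).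
Definition gone A Y : G A Y := hpi_one R 0 point.

Lemma grp_pi1_mul A Y (a b : G A Y) : grp_pi1 (gmul a b) = pi_mul (grp_pi1 a) (grp_pi1 b).
Proof. exact: binvK. Qed.

Lemma grp_pi1_inv A Y (a : G A Y) : grp_pi1 (ginv a) = pi_inv (grp_pi1 a).
Proof. exact: binvK. Qed.

Lemma grp_pi1_one A Y : grp_pi1 (gone A Y) = hpi_one R 1 point.
Proof. exact: pi_loop_one. Qed.

Lemma gmulA A Y : associative (@gmul A Y).
Proof.
by move=> a b c; apply: (bij_inj (grp_pi1_bij A Y)); rewrite !grp_pi1_mul pi_mulA.
Qed.

Lemma gmul1l A Y (a : G A Y) : gmul (gone A Y) a = a.
Proof. by apply: (bij_inj (grp_pi1_bij A Y)); rewrite grp_pi1_mul grp_pi1_one pi_mul1l. Qed.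

Lemma gmul1r A Y (a : G A Y) : gmul a (gone A Y) = a.
Proof. by apply: (bij_inj (grp_pi1_bij A Y)); rewrite grp_pi1_mul grp_pi1_one pi_mul1r. Qed.

Lemma gmulVl A Y (a : G A Y) : gmul (ginv a) a = gone A Y.
Proof.
by apply: (bij_inj (grp_pi1_bij A Y)); rewrite grp_pi1_mul grp_pi1_inv grp_pi1_one pi_mulVl.
Qed.

Lemma gact_mul A A' Y Y' (f : smap0 R A' A) (g : smap0 R Y Y') a b :
  gact f g (gmul a b) = gmul (gact f g a) (gact f g b).
Proof.
apply: (bij_inj (grp_pi1_bij A' Y')); rewrite grp_pi1_mul !grp_pi1_nat grp_pi1_mul.
exact: pi_map_mul.
Qed.

Lemma gact_one A A' Y Y' (f : smap0 R A' A) (g : smap0 R Y Y') :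
  gact f g (gone A Y) = gone A' Y'.
Proof. exact: act_one. Qed.

Lemma gmul_eq_one A Y (a b : G A Y) : gmul (ginv a) b = gone A Y -> a = b.
Proof.
move=> ab; have aV : gmul (ginv (ginv a)) (gone A Y) = a.
  by rewrite -(gmulVl a) gmulA gmulVl gmul1l.
by rewrite -aV -ab gmulA gmulVl gmul1l.
Qed.

Local Notation W X := (wedge_obj X X).
Definition gproj1 A X : G A (W X) -> G A X :=
  @gact A A (W X) X (idm A) (wproj1 X).
Definition gproj2 A X : G A (W X) -> G A X :=
  @gact A A (W X) X (idm A) (wproj2 X).
Definition gfold A X : G A (W X) -> G A X :=
  @gact A A (W X) X (idm A) (fold X).
Definition gin1 A X : G A X -> G A (W X) :=
  @gact A A X (W X) (idm A) (winl_map X X).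
Definition gin2 A X : G A X -> G A (W X) :=
  @gact A A X (W X) (idm A) (winr_map X X).

Lemma gactr_comp A X Y Y' (g : smap0 R X Y) (g' : smap0 R Y Y') (c : G A X) :
  gact (idm A) g' (gact (idm A) g c) = gact (idm A) (compm g' g) c.
Proof. exact: act_compr. Qed.

Lemma gact_id A X (c : G A X) : gact (idm A) (idm X) c = c.
Proof. exact: act_id. Qed.

Lemma gact_cstr A X Y (g : smap0 R X Y) (c : G A X) :
  (forall x, g x = point) -> gact (idm A) g c = gone A Y.
Proof. by move=> g0; apply: (act_cst hF); right. Qed.

Lemma gproj11 A X (a : G A X) : gproj1 (gin1 a) = a.
Proof.
rewrite /gproj1 /gin1 (@gactr_comp A X (W X) X) [compm _ _]copair_inl.
exact: gact_id.
Qed.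

Lemma gproj22 A X (a : G A X) : gproj2 (gin2 a) = a.
Proof.
rewrite /gproj2 /gin2 (@gactr_comp A X (W X) X) [compm _ _]copair_inr.
exact: gact_id.
Qed.

Lemma gproj12 A X (a : G A X) : gproj1 (gin2 a) = gone A X.
Proof.
rewrite /gproj1 /gin2 (@gactr_comp A X (W X) X) [compm _ _]copair_inr.
exact: gact_cstr.
Qed.

Lemma gproj21 A X (a : G A X) : gproj2 (gin1 a) = gone A X.
Proof.
rewrite /gproj2 /gin1 (@gactr_comp A X (W X) X) [compm _ _]copair_inl.
exact: gact_cstr.
Qed.

Lemma gfold1 A X (a : G A X) : gfold (gin1 a) = a.
Proof.
rewrite /gfold /gin1 (@gactr_comp A X (W X) X) [compm _ _]copair_inl.
exact: gact_id.
Qed.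

Lemma gfold2 A X (a : G A X) : gfold (gin2 a) = a.
Proof.
rewrite /gfold /gin2 (@gactr_comp A X (W X) X) [compm _ _]copair_inr.
exact: gact_id.
Qed.

(** If the second projection vanishes, so does the image in the cofiber of the
    first summand, where that summand is contracted; by exactness the element
    comes from the first summand, and there the first projection detects it. *)
Lemma gproj_eq_one A X (d : G A (W X)) :
  gproj1 d = gone A X -> gproj2 d = gone A X -> d = gone A (W X).
Proof.
move=> d1 d2.
have hi : ng_inclusion (winl_map X X : smap0 R X (W X)).
  exact: ng_inclusion_winl.
pose Z := cofiber_obj hi.
pose q : smap0 R (W X) Z := cofiber_inj (winl_map X X).
have : gact (idm A) q d = gone A Z.
  have h : homotopic q (compm q (compm (winr_map X X) (wproj2 X))).
    exact: cofiber_winl.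
  rewrite /gact (@act_homotopicr R C F hF 0 A (W X) Z _ _ d h).
  rewrite -(@act_compr R C F 0 A (W X) (W X) Z _ q d).
  rewrite -(@act_compr R C F 0 A (W X) X (W X) (wproj2 X) (winr_map X X) d).
  have -> : act 0%N (idm A) (wproj2 X : smap0 R (W X) X) d = gone A X by exact: d2.
  by rewrite /gone !act_one.
move/(@act_exactr R C F hF 0 A X (W X) _ hi d) => [a ad].
have {}ad : gin1 a = d by exact: ad.
by move: d1; rewrite -ad gproj11 => ->; exact: gact_one.
Qed.

Lemma gproj_inj A X (c d : G A (W X)) :
  gproj1 c = gproj1 d -> gproj2 c = gproj2 d -> c = d.
Proof.
move=> cd1 cd2; apply: gmul_eq_one; apply: gproj_eq_one.
  by rewrite /gproj1 gact_mul [X in gmul _ X](esym cd1) -gact_mul gmulVl gact_one.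
by rewrite /gproj2 gact_mul [X in gmul _ X](esym cd2) -gact_mul gmulVl gact_one.
Qed.

(** A natural operation with a neutral element is determined by the images of
    its arguments in the two summands of a wedge. *)
Lemma gmul_unique A (op : forall Y, G A Y -> G A Y -> G A Y) Y (a b : G A Y) :
  (forall X (g : smap0 R X Y) (a b : G A X),
     op Y (gact (idm A) g a) (gact (idm A) g b) = gact (idm A) g (op X a b)) ->
  op Y a (gone A Y) = a -> op Y (gone A Y) b = b -> op Y a b = gmul a b.
Proof.
move=> nat op1 op2; have E : op (W Y) (gin1 a) (gin2 b) = gmul (gin1 a) (gin2 b).
  apply: gproj_inj.
    rewrite {1}/gproj1 -(nat (W Y)) -/(gproj1 _) -/(gproj1 _) gproj11 gproj12 op1.
    by rewrite /gproj1 gact_mul -/(gproj1 _) -/(gproj1 _) gproj11 gproj12 gmul1r.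
  rewrite {1}/gproj2 -(nat (W Y)) -/(gproj2 _) -/(gproj2 _) gproj21 gproj22 op2.
  by rewrite /gproj2 gact_mul -/(gproj2 _) -/(gproj2 _) gproj21 gproj22 gmul1l.
have := congr1 (@gfold A Y) E.
rewrite {1}/gfold -(nat (W Y)) -/(gfold _) -/(gfold _) gfold1 gfold2 => ->.
by rewrite /gfold gact_mul -/(gfold _) -/(gfold _) gfold1 gfold2.
Qed.

(** The opposite operation is natural with the same neutral element. *)
Lemma gmulC A Y : commutative (@gmul A Y).
Proof.
move=> a b.
apply: (@gmul_unique A (fun Y a b => gmul b a) Y b a) => [X g c d| |].
- by rewrite gact_mul.
- exact: gmul1l.
- exact: gmul1r.
Qed.

HB.instance Definition _ A Y := GRing.isZmodule.Build (G A Y)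
  (@gmulA A Y) (@gmulC A Y) (@gmul1l A Y) (@gmulVl A Y).

Lemma gaddE A Y (a b : G A Y) : a + b = gmul a b.
Proof. by []. Qed.

(** The element of the wedge picked for two arguments can only be the image of
    the product of their inclusions, by [gproj_inj], and the folding map sends
    this to the product of the arguments. *)
Lemma natural_add A (T : functor C) n
    (phi : forall Y, G A Y -> pi_functor T n Y) :
  (forall Y, bijective (phi Y)) ->
  (forall Y Y' (g : smap0 R Y Y') c,
     phi Y' (gact (idm A) g c) = pi_functor_map g (phi Y c)) ->
  forall Y a b, phi Y (a + b) = pi_functor_add (phi Y a) (phi Y b).
Proof.
move=> bphi nphi Y a b; rewrite gaddE /pi_functor_add.
set d := pi_functor_pair _ _.
have [dE1 dE2] : @pi_functor_map R C T n (W Y) Y (wproj1 Y) d = phi Y a /\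
    @pi_functor_map R C T n (W Y) Y (wproj2 Y) d = phi Y b.
  rewrite /d /pi_functor_pair; set S := mkset _.
  suff [c Sc] : S !=set0 by exact: (xgetPex _ (ex_intro _ c Sc)).
  exists (phi (W Y) (gmul (gin1 a) (gin2 b))); split.
    rewrite -(nphi (W Y) Y) gact_mul; congr phi.
    rewrite -/(gproj1 _) -/(gproj1 _).
    by rewrite gproj11 gproj12 gmul1r.
  rewrite -(nphi (W Y) Y) gact_mul; congr phi.
  rewrite -/(gproj2 _) -/(gproj2 _).
  by rewrite gproj21 gproj22 gmul1l.
have [c dE] := bij_surj_ex (bphi (W Y)) d.
have cE : c = gmul (gin1 a) (gin2 b).
  apply: gproj_inj; apply: (bij_inj (bphi Y)).
    rewrite [LHS](nphi (W Y) Y) dE dE1; congr phi.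
    by rewrite /gproj1 gact_mul -/(gproj1 _) -/(gproj1 _) gproj11 gproj12 gmul1r.
  rewrite [LHS](nphi (W Y) Y) dE dE2; congr phi.
  by rewrite /gproj2 gact_mul -/(gproj2 _) -/(gproj2 _) gproj21 gproj22 gmul1l.
rewrite -dE -(nphi (W Y) Y) cE; congr phi.
by rewrite gact_mul -/(gfold _) -/(gfold _) gfold1 gfold2.
Qed.

(** * Double suspension *)

Lemma desusp_contra0_bij A Y : bijective (@desusp_contra R C F hF 0 A (susp_obj Y)).
Proof. exact: desusp_contra_bij. Qed.

(** Both suspension isomorphisms end in [pi_1 F(A, susp Y)]. *)
Definition double_susp A Y (c : G A Y) : G (susp_obj A) (susp_obj Y) :=
  binv (desusp_contra0_bij A Y) (grp_pi1 c).

Lemma desusp_double_susp A Y (c : G A Y) : desusp_contra hF (double_susp c) = grp_pi1 c.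
Proof. exact: binvK. Qed.

Lemma double_susp_bij A Y : bijective (@double_susp A Y).
Proof. exact: bij_comp (binv_bij _) (grp_pi1_bij A Y). Qed.

Lemma double_susp_nat A A' Y Y' (f : smap0 R A' A) (g : smap0 R Y Y') c :
  double_susp (gact f g c) =
  @gact (susp_obj A) (susp_obj A') (susp_obj Y) (susp_obj Y')
    (susp_map f) (susp_map g) (double_susp c).
Proof.
apply: (bij_inj (desusp_contra0_bij A' Y')); rewrite desusp_double_susp grp_pi1_nat -desusp_double_susp.
exact: (@desusp_contra_nat R C F hF 0 A A' (susp_obj Y) (susp_obj Y') f (susp_map g)).
Qed.

Lemma double_susp_one A Y : double_susp (gone A Y) = gone _ _.
Proof.
apply: (bij_inj (desusp_contra0_bij A Y)); rewrite desusp_double_susp grp_pi1_one.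
exact/esym/pi_loop_one.
Qed.

(** Transport of the operation along the bijection is again natural in [Y]. *)
Lemma double_susp_add A Y : {morph @double_susp A Y : a b / a + b}.
Proof.
move=> a b; rewrite !gaddE.
pose op Y (a b : G A Y) := binv (double_susp_bij A Y) (gmul (double_susp a) (double_susp b)).
rewrite -(@gmul_unique A op) /op ?binvK//.
- move=> X g c d; apply: (bij_inj (double_susp_bij A Y)); rewrite binvK !double_susp_nat binvK.
  by rewrite gact_mul.
- by rewrite double_susp_one gmul1r Kbinv.
- by rewrite double_susp_one gmul1l Kbinv.
Qed.

End group.
Arguments gact {R C F hF A A' Y Y'}.

(** * Exact functors and suspension *)

Section exact_functor.
Context (R : realType) (C : subcat R).
Implicit Types A X Y Z : obj C.

(** What the Puppe sequence needs of the functor [Y |-> pi_0 F(A, Y)]. It is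
    abstracted from [F] so as to apply to composites with the suspension. *)
Record exact_functor := MkExactFunctor {
  eobj :> obj C -> Type;
  ept : forall X, eobj X;
  emap : forall X Y, smap0 R X Y -> eobj X -> eobj Y;
  emap_id : forall X x, emap (idm X) x = x;
  emap_comp : forall X Y Z (g : smap0 R Y Z) (f : smap0 R X Y) x,
    emap (compm g f) x = emap g (emap f x);
  emap_cst : forall X Y (x : eobj X), emap (smap0_cst R X Y) x = ept Y;
  emap_homotopic : forall X Y (f g : smap0 R X Y) x, homotopic f g ->
    emap f x = emap g x;
  emap_exact : forall A X (i : smap0 R A X) (hi : ng_inclusion i) x,
    @emap X (cofiber_obj hi) (cofiber_inj i) x = ept (cofiber_obj hi) <->
    exists a, emap i a = x }.

Section puppe.
Context (G : exact_functor).

Lemma emap_pt X Y (f : smap0 R X Y) : emap f (ept G X) = ept G Y.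
Proof.
rewrite -(emap_cst X (ept G X)) -emap_comp.
rewrite (_ : compm _ _ = smap0_cst R X Y) ?emap_cst//.
by apply: smap0_eq => x; rewrite compmE; exact: smap0_pt.
Qed.

Definition reflect_fun X : susp X -> susp X :=
  susp_rec (fun t x => susp_pi (clamp (1 - uval t)) x).

Lemma reflect_susp_pi X t x : @reflect_fun X (susp_pi t x) = susp_pi (clamp (1 - uval t)) x.
Proof.
rewrite /reflect_fun (susp_recE (w0 := point)) => //.
- by move=> y; rewrite susp_pi1// uval0 subr0 clamp_ge1.
- by move=> y; rewrite susp_pi0// uval1 subrr clamp_le0.
- by move=> s; rewrite susp_pi_pt.
Qed.

Lemma reflect_continuous X : continuous (@reflect_fun X).
Proof.
apply: susp_continuous.
rewrite (_ : (fun z => _) =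
  fun z : unitI R * X => susp_pi (clamp (1 - uval z.1)) z.2).
  by apply: susp_pi_continuous; ctn.
by apply/funext => z; rewrite reflect_susp_pi.
Qed.

Lemma reflect_pt X : @reflect_fun X point = point.
Proof. by rewrite -{1}(susp_pi_pt X (I0 R)) reflect_susp_pi susp_pi_pt. Qed.

Definition reflect X : smap0 R (susp X) (susp X) :=
  mk_smap0 (@reflect_continuous X) (@reflect_pt X).

Lemma reflect_nat X Y (f : smap0 R X Y) :
  compm (reflect Y) (susp_map f) = compm (susp_map f) (reflect X).
Proof.
apply: smap0_eq; apply: susp_ind => t x; rewrite !compmE.
rewrite [susp_map f (susp_pi t x)]susp_mapE [reflect Y _]reflect_susp_pi.
by rewrite [reflect X _]reflect_susp_pi [RHS]susp_mapE.
Qed.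

(** On the first cofiber the two ways of collapsing to the suspension of [A]
    differ by the sign built into [kappa]. *)
Lemma kappa_cofiber_inj A X (i : smap0 R A X) :
  compm (kappa i) (cofiber_inj (cofiber_inj i)) = compm (reflect A) (collapse i).
Proof.
apply: smap0_eq => z; rewrite !compmE; elim/cofiber_ind: z => [x|t a].
  rewrite [LHS]kappa_inj_inj [collapse i _]collapse_inj.
  exact/esym/reflect_pt.
rewrite [LHS]kappa_inj_cone [collapse i _]collapse_cone.
exact/esym/reflect_susp_pi.
Qed.

(** The suspension of an inclusion need not be an inclusion, so exactness
    cannot be applied to it directly. But the iterated cofibers of [i] are
    inclusions, and going three steps along their sequence turns the first two
    maps into their suspensions, up to homotopy equivalence and sign. *)
Lemma susp_exact A X (i : smap0 R A X) (hi : ng_inclusion i) x :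
  @emap G (susp_obj X) (susp_obj (cofiber_obj hi)) (susp_map (cofiber_inj i)) x =
    ept G (susp_obj (cofiber_obj hi)) <->
  exists a, @emap G (susp_obj A) (susp_obj X) (susp_map i) a = x.
Proof.
pose Z := cofiber_obj hi; pose q : smap0 R X Z := cofiber_inj i.
pose hq : ng_inclusion q := ng_inclusion_cofiber_inj i.
pose W := cofiber_obj hq; pose j : smap0 R Z W := cofiber_inj q.
pose hj : ng_inclusion j := ng_inclusion_cofiber_inj q.
pose V := cofiber_obj hj; pose k : smap0 R W V := cofiber_inj j.
pose hk : ng_inclusion k := ng_inclusion_cofiber_inj j.
pose U := cofiber_obj hk; pose l : smap0 R V U := cofiber_inj k.
split=> [x0|[a <-]]; last first.
  rewrite -(@emap_comp G (susp_obj A) (susp_obj X) (susp_obj Z)) -susp_map_comp.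
  rewrite (@emap_homotopic G (susp_obj A) (susp_obj Z) _
    (susp_map (smap0_cst R A Z)) a (homotopic_susp (cofiber_null i))).
  by rewrite susp_map_cst; exact: (@emap_cst G (susp_obj A) (susp_obj Z)).
pose kq : smap0 R V (susp_obj X) := kappa q.
pose sq : smap0 R (susp_obj X) V := susp_section q.
pose y := emap sq x.
have yx : emap kq y = x.
  rewrite -emap_comp (emap_homotopic _ (kappa_section q : homotopic (compm kq sq)
    (idm (susp_obj X)))).
  exact: emap_id.
pose dj : smap0 R V (susp_obj Z) := collapse j.
have dy : emap dj y = ept G (susp_obj Z).
  rewrite (emap_homotopic y (collapse_kappa q : homotopic dj
    (compm (susp_map q : smap0 R (susp_obj X) (susp_obj Z)) kq))).
  by rewrite emap_comp yx.
pose kj : smap0 R U (susp_obj Z) := kappa j.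
pose sj : smap0 R (susp_obj Z) U := susp_section j.
have ly : emap l y = ept G U.
  rewrite -[LHS](emap_id (X := U)).
  rewrite (emap_homotopic _ (section_kappa j : homotopic (idm U) (compm sj kj))).
  rewrite emap_comp -(emap_comp kj l).
  have -> : compm kj l = compm (reflect Z : smap0 R (susp_obj Z) (susp_obj Z)) dj.
    exact: kappa_cofiber_inj.
  by rewrite emap_comp dy !emap_pt.
have [w wy] := (emap_exact hk y).1 ly.
pose ki : smap0 R W (susp_obj A) := kappa i.
pose dq : smap0 R W (susp_obj X) := collapse q.
pose rA : smap0 R (susp_obj A) (susp_obj A) := reflect A.
pose rX : smap0 R (susp_obj X) (susp_obj X) := reflect X.
pose si : smap0 R (susp_obj A) (susp_obj X) := susp_map i.
exists (emap rA (emap ki w)).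
rewrite -yx -wy -(emap_comp kq k).
have -> : compm kq k = compm rX dq by exact: kappa_cofiber_inj.
rewrite emap_comp (emap_homotopic w (collapse_kappa i : homotopic dq (compm si ki))).
rewrite emap_comp -(emap_comp si rA) -(emap_comp rX si).
by congr (emap _ _); exact/esym/reflect_nat.
Qed.

Lemma susp_emap_comp X Y Z (g : smap0 R Y Z) (f : smap0 R X Y) x :
  @emap G (susp_obj X) (susp_obj Z) (susp_map (compm g f)) x =
  @emap G (susp_obj Y) (susp_obj Z) (susp_map g)
    (@emap G (susp_obj X) (susp_obj Y) (susp_map f) x).
Proof. by rewrite susp_map_comp; exact: (@emap_comp G (susp_obj X) (susp_obj Y) (susp_obj Z)). Qed.

Lemma susp_emap_id X x :
  @emap G (susp_obj X) (susp_obj X) (susp_map (idm X)) x = x.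
Proof. by rewrite susp_map_id; exact: (@emap_id G (susp_obj X)). Qed.

Lemma susp_emap_cst X Y x :
  @emap G (susp_obj X) (susp_obj Y) (susp_map (smap0_cst R X Y)) x = ept G _.
Proof. by rewrite susp_map_cst; exact: (@emap_cst G (susp_obj X) (susp_obj Y)). Qed.

Lemma susp_emap_homotopic X Y (f g : smap0 R X Y) x : homotopic f g ->
  @emap G (susp_obj X) (susp_obj Y) (susp_map f) x =
  @emap G (susp_obj X) (susp_obj Y) (susp_map g) x.
Proof. by move=> /homotopic_susp; exact: (@emap_homotopic G (susp_obj X) (susp_obj Y)). Qed.

Definition susp_functor : exact_functor :=
  @MkExactFunctor (fun X => G (susp_obj X)) (fun X => ept G (susp_obj X))
    (fun X Y f => @emap G (susp_obj X) (susp_obj Y) (susp_map f))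
    susp_emap_id susp_emap_comp susp_emap_cst susp_emap_homotopic susp_exact.

End puppe.

Lemma iter_susp_exact (G : exact_functor) k A X (i : smap0 R A X)
    (hi : ng_inclusion i) x :
  emap (@iter_susp_map R C k X (cofiber_obj hi) (cofiber_inj i)) x =
    ept G (iter_susp k (cofiber_obj hi)) <->
  exists a, emap (@iter_susp_map R C k A X i) a = x.
Proof.
elim: k G x => [|k IH] G x; first exact: emap_exact.
exact: (IH (susp_functor G) x).
Qed.

Lemma iter_susp_map_id k X : iter_susp_map k (idm X) = idm (iter_susp k X).
Proof. by elim: k => //= k ->; exact: susp_map_id. Qed.

Lemma iter_susp_map_comp k X Y Z (g : smap0 R Y Z) (f : smap0 R X Y) :
  iter_susp_map k (compm g f) = compm (iter_susp_map k g) (iter_susp_map k f).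
Proof. by elim: k => //= k ->; exact: susp_map_comp. Qed.

Lemma homotopic_iter_susp k X Y (f g : smap0 R X Y) :
  homotopic f g -> homotopic (iter_susp_map k f) (iter_susp_map k g).
Proof. by move=> fg; elim: k => //= k; exact: homotopic_susp. Qed.

(** The suspensions that realize a negative degree are applied outside, while
    the suspension isomorphism adds one inside. *)
Fixpoint susp_swap k X :
    smap0 R (susp_obj (iter_susp k X)) (iter_susp k (susp_obj X)) :=
  if k is k'.+1 then susp_map (susp_swap k' X) else idm (susp_obj X).

Fixpoint susp_unswap k X :
    smap0 R (iter_susp k (susp_obj X)) (susp_obj (iter_susp k X)) :=
  if k is k'.+1 then susp_map (susp_unswap k' X) else idm (susp_obj X).

Lemma susp_swapK k X :
  compm (susp_unswap k X) (susp_swap k X) = idm (susp_obj (iter_susp k X)).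
Proof.
elim: k => [|k IH] /=; first exact: smap0_eq.
by rewrite -susp_map_comp IH susp_map_id.
Qed.

Lemma susp_unswapK k X :
  compm (susp_swap k X) (susp_unswap k X) = idm (iter_susp k (susp_obj X)).
Proof.
elim: k => [|k IH] /=; first exact: smap0_eq.
by rewrite -susp_map_comp IH susp_map_id.
Qed.

Lemma susp_swap_nat k X Y (f : smap0 R X Y) :
  compm (@iter_susp_map R C k (susp_obj X) (susp_obj Y) (susp_map f))
    (susp_swap k X) =
  compm (susp_swap k Y) (susp_map (iter_susp_map k f)).
Proof.
elim: k => [|k IH] /=; first exact: smap0_eq.
by rewrite -!susp_map_comp IH.
Qed.

End exact_functor.

(** * The two theories *)

Section theories.
Context (R : realType) (C : subcat R) (F : bifunctor C).
Hypothesis hF : bilinear_functor F.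
Implicit Types A X Y Z : obj C.
Local Notation G := (grp hF).

Section additive_of.
Context (U V : zmodType) (f : U -> V) (fD : {morph f : x y / x + y}).

Lemma additive_ofB : {morph f : x y / x - y}.
Proof.
move=> x y; apply: (addIr (f y)); rewrite -fD !addrNK//.
Qed.

Definition additive_of : {additive U -> V} :=
  HB.pack f (GRing.isZmodMorphism.Build U V f additive_ofB).

End additive_of.

Lemma gactD A A' Y Y' (f : smap0 R A' A) (g : smap0 R Y Y') :
  {morph (gact f g : G A Y -> G A' Y') : a b / a + b}.
Proof. exact: gact_mul. Qed.

Lemma gactl_comp A A' A'' Y (f : smap0 R A' A) (f' : smap0 R A'' A') (c : G A Y) :
  gact f' (idm Y) (gact f (idm Y) c) = gact (compm f f') (idm Y) c.
Proof. exact: act_compl. Qed.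

Definition grp_functor A : exact_functor C :=
  @MkExactFunctor R C (fun X => G A X) (fun X => gone hF A X)
    (fun X Y g => gact (idm A) g)
    (fun X x => gact_id x)
    (fun X Y Z g f x => esym (gactr_comp f g x))
    (fun X Y x => @gact_cstr R C F hF A X Y (smap0_cst R X Y) x (fun=> erefl))
    (fun X Y f g x fg => @act_homotopicr R C F hF 0 A X Y f g x fg)
    (fun B X i hi x => @act_exactr R C F hF 0 A B X i hi x).

(** The degree [N] is tied to [m + n] by an equation only, since removing the
    outermost suspension raises [n] and not [m + n] up to conversion. *)
Lemma iter_desusp m n N : N = (m + n)%N ->
  exists psi : forall A Y, hpi R n (point : F (iter_susp m A) Y) ->
      hpi R N (point : F A Y),
    [/\ forall A Y, bijective (psi A Y),
        forall A Y, psi A Y (hpi_one R n point) = hpi_one R N point &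
        forall A A' Y Y' (f : smap0 R A' A) (g : smap0 R Y Y') c,
          psi A' Y' (act n (iter_susp_map m f) g c) = act N f g (psi A Y c)].
Proof.
elim: m n => [|m IH] n NE.
  by rewrite NE; exists (fun A Y => id); split => // A Y; exists id.
have [|psi [bpsi psi1 npsi]] := IH n.+1; first by rewrite NE addSnnS.
exists (fun A Y c => psi A Y (@desusp_contra R C F hF n (iter_susp m A) Y c)); split.
- move=> A Y; exact: (bij_comp (bpsi A Y) (@desusp_contra_bij R C F hF (iter_susp m A) n Y)).
- by move=> A Y; rewrite [desusp_contra _ _]pi_loop_one psi1.
- move=> A A' Y Y' f g c; rewrite -npsi; congr psi; apply/esym.
  exact: (@desusp_contra_nat R C F hF n (iter_susp m A) (iter_susp m A') Y Y').
Qed.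

(** [pi_0 F(Sigma^k X, Y)] is [pi_k F(X, Y)], where the fibration sequence is
    exact in every degree. *)
Lemma iter_susp_coexact k A X Y (i : smap0 R A X) (hi : ng_inclusion i)
    (x : G (iter_susp k X) Y) :
  gact (iter_susp_map k i) (idm Y) x = gone hF _ Y <->
  exists a, @gact R C F hF (iter_susp k (cofiber_obj hi)) (iter_susp k X) Y Y
    (@iter_susp_map R C k X (cofiber_obj hi) (cofiber_inj i)) (idm Y) a = x.
Proof.
have [psi [bpsi psi1 npsi]] := @iter_desusp k 0 k (esym (addn0 k)).
have E : gact (iter_susp_map k i) (idm Y) x = gone hF _ Y <->
    act k i (idm Y) (psi X Y x) = hpi_one R k point.
  rewrite -npsi -(psi1 A Y); split => [h|/(bij_inj (bpsi A Y))//].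
  by congr psi; exact: h.
split => [/E/(act_exactl hF hi)[d dE]|[a ax]].
  have [a aE] := bij_surj_ex (bpsi _ _) d; exists a.
  apply: (bij_inj (bpsi X Y)); rewrite -dE -aE.
  exact: (npsi (cofiber_obj hi) X Y Y (cofiber_inj i) (idm Y) a).
apply/E/(act_exactl hF hi); exists (psi (cofiber_obj hi) Y a).
rewrite -ax; apply/esym.
exact: (npsi (cofiber_obj hi) X Y Y (cofiber_inj i) (idm Y) a).
Qed.

(** Degree [n] is realized by the sphere of dimension [sphere_index n] and
    [susp_index n] suspensions; one of the two numbers vanishes, and their
    difference is [n]. *)
Definition sphere_index (n : int) : nat := if n is Posz p then p else 0%N.
Definition susp_index (n : int) : nat := if n is Negz p then p.+1 else 0%N.

Lemma shift_index (n : int) (k m : nat) : n + k%:Z = m%:Z ->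
  exists2 j, k = (j + susp_index n)%N & m = (j + sphere_index n)%N.
Proof.
case: n => p /= kpm; first by exists k; lia.
by exists m; lia.
Qed.

(** * Homology *)

Definition homology_group (n : int) X : zmodType :=
  G (sphere C (sphere_index n)) (iter_susp (susp_index n) X).

Definition homology_map (n : int) X Y (f : smap0 R X Y) :
    {additive homology_group n X -> homology_group n Y} :=
  additive_of (@gactD (sphere C (sphere_index n)) (sphere C (sphere_index n))
    (iter_susp (susp_index n) X) (iter_susp (susp_index n) Y) (idm _)
    (iter_susp_map (susp_index n) f)).

Lemma homology_mapE n X Y (f : smap0 R X Y) a :
  homology_map n f a = gact (idm (sphere C (sphere_index n))) (iter_susp_map (susp_index n) f) a.
Proof. by []. Qed.

Lemma susp_swap_bijr A k X : bijective (@gact R C F hF A A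
  (susp_obj (iter_susp k X)) (iter_susp k (susp_obj X)) (idm A) (susp_swap k X)).
Proof.
exists (@gact R C F hF A A (iter_susp k (susp_obj X)) (susp_obj (iter_susp k X))
  (idm A) (susp_unswap k X)) => c.
  by rewrite gactr_comp susp_swapK; exact: gact_id.
by rewrite gactr_comp susp_unswapK; exact: gact_id.
Qed.

Lemma susp_swap_bijl Y k X : bijective (@gact R C F hF
  (iter_susp k (susp_obj X)) (susp_obj (iter_susp k X)) Y Y
  (susp_swap k X) (idm Y)).
Proof.
exists (@gact R C F hF (susp_obj (iter_susp k X)) (iter_susp k (susp_obj X)) Y Y
  (susp_unswap k X) (idm Y)) => c.
  by rewrite gactl_comp susp_unswapK; exact: gact_id.
by rewrite gactl_comp susp_swapK; exact: gact_id.
Qed.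

(** For a negative degree the suspension is already part of the group, and only
    its position changes. The degree [n'] is a variable because [n + 1] does not
    reduce to a constructor. *)
Lemma homology_susp_ex (n n' : int) : n + 1 = n' ->
  exists s : forall X, {additive homology_group n X -> homology_group n' (susp_obj X)},
    (forall X, bijective (s X)) /\
    forall X Y (f : smap0 R X Y) (a : homology_group n X),
      @homology_map n' (susp_obj X) (susp_obj Y) (susp_map f) (s X a) =
      s Y (homology_map n f a).
Proof.
have swap k : exists s : forall X,
    {additive G (S0_obj C) (susp_obj (iter_susp k X)) ->
      G (S0_obj C) (iter_susp k (susp_obj X))},
    (forall X, bijective (s X)) /\
    forall X Y (f : smap0 R X Y) a,
      gact (idm (S0_obj C)) (@iter_susp_map R C k (susp_obj X) (susp_obj Y) (susp_map f))
        (s X a) =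
      s Y (@gact R C F hF _ _ (susp_obj (iter_susp k X)) (susp_obj (iter_susp k Y))
        (idm (S0_obj C)) (susp_map (iter_susp_map k f)) a).
  exists (fun X => additive_of (@gactD (S0_obj C) (S0_obj C)
    (susp_obj (iter_susp k X)) (iter_susp k (susp_obj X)) (idm _) (susp_swap k X))).
  split=> [X|X Y f a]; first exact: susp_swap_bijr.
  by rewrite /= !gactr_comp susp_swap_nat.
case: n => [p|[|p]] nn'.
- have -> : n' = Posz p.+1 by lia.
  exists (fun X => additive_of (@double_susp_add R C F hF (sphere C p) X)).
  split=> [X|X Y f a]; first exact: double_susp_bij.
  by rewrite /= double_susp_nat susp_map_id.
- have -> : n' = Posz 0 by lia.
  exact: (swap 0%N).
- have -> : n' = Negz p by lia.
  exact: (swap p.+1).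
Qed.

Definition homology_susp n :=
  projT1 (cid (@homology_susp_ex n (n + 1) erefl)).

Lemma homology_susp_bij n X : bijective (homology_susp n X).
Proof. exact: (projT2 (cid (@homology_susp_ex n (n + 1) erefl))).1. Qed.

Lemma homology_susp_nat n X Y (f : smap0 R X Y) (a : homology_group n X) :
  @homology_map (n + 1) (susp_obj X) (susp_obj Y) (susp_map f)
    (homology_susp n X a) = homology_susp n Y (homology_map n f a).
Proof. exact: (projT2 (cid (@homology_susp_ex n (n + 1) erefl))).2. Qed.

Lemma homology_map_id n X : homology_map n (idm X) =1 id.
Proof. by move=> a; rewrite homology_mapE iter_susp_map_id; exact: gact_id. Qed.

Lemma homology_map_comp n X Y Z (g : smap0 R Y Z) (f : smap0 R X Y) :
  homology_map n (compm g f) =1 homology_map n g \o homology_map n f.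
Proof.
by move=> a; rewrite /= iter_susp_map_comp gactr_comp.
Qed.

Lemma homology_map_homotopy n X Y (f g : smap0 R X Y) :
  pointed_homotopic f g -> homology_map n f =1 homology_map n g.
Proof.
move=> /pointed_homotopicW/(@homotopic_iter_susp _ _ (susp_index n) X Y f g) fg a.
exact: (act_homotopicr hF _ fg).
Qed.

Lemma homology_map_exact n A X (i : smap0 R A X) (hi : ng_inclusion i)
    (x : homology_group n X) :
  @homology_map n X (cofiber_obj hi) (cofiber_inj i) x = 0 <->
  exists a, homology_map n i a = x.
Proof.
exact: (@iter_susp_exact R C (grp_functor (sphere C (sphere_index n))) (susp_index n) A X i hi x).
Qed.

Definition homology : homology_theory C :=
  @MkHomology R C homology_group homology_map homology_map_id homology_map_comp
    homology_susp homology_susp_bij homology_susp_nat homology_map_homotopy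
    homology_map_exact.

(** * Cohomology *)

Definition cohomology_group (n : int) X : zmodType :=
  G (iter_susp (susp_index n) X) (sphere C (sphere_index n)).

Definition cohomology_map (n : int) X Y (f : smap0 R X Y) :
    {additive cohomology_group n Y -> cohomology_group n X} :=
  additive_of (@gactD (iter_susp (susp_index n) Y) (iter_susp (susp_index n) X)
    (sphere C (sphere_index n)) (sphere C (sphere_index n)) (iter_susp_map (susp_index n) f) (idm _)).

Lemma cohomology_mapE n X Y (f : smap0 R X Y) a :
  cohomology_map n f a = gact (iter_susp_map (susp_index n) f) (idm (sphere C (sphere_index n))) a.
Proof. by []. Qed.

Lemma cohomology_susp_ex (n n' : int) : n + 1 = n' ->
  exists s : forall X,
      {additive cohomology_group n' (susp_obj X) -> cohomology_group n X},
    (forall X, bijective (s X)) /\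
    forall X Y (f : smap0 R X Y) (a : cohomology_group n' (susp_obj Y)),
      s X (@cohomology_map n' (susp_obj X) (susp_obj Y) (susp_map f) a) =
      cohomology_map n f (s Y a).
Proof.
have swap k : exists s : forall X,
    {additive G (iter_susp k (susp_obj X)) (S0_obj C) ->
      G (susp_obj (iter_susp k X)) (S0_obj C)},
    (forall X, bijective (s X)) /\
    forall X Y (f : smap0 R X Y) a,
      s X (gact (@iter_susp_map R C k (susp_obj X) (susp_obj Y) (susp_map f))
        (idm (S0_obj C)) a) =
      @gact R C F hF (susp_obj (iter_susp k Y)) (susp_obj (iter_susp k X)) _ _
        (susp_map (iter_susp_map k f)) (idm (S0_obj C)) (s Y a).
  exists (fun X => additive_of (@gactD (iter_susp k (susp_obj X))
    (susp_obj (iter_susp k X)) (S0_obj C) (S0_obj C) (susp_swap k X) (idm _))).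
  split=> [X|X Y f a]; first exact: susp_swap_bijl.
  by rewrite /= !gactl_comp susp_swap_nat.
case: n => [p|[|p]] nn'.
- have -> : n' = Posz p.+1 by lia.
  have add X : {morph binv (@double_susp_bij R C F hF X (sphere C p)) : a b / a + b}.
    move=> a b; apply: (bij_inj (@double_susp_bij R C F hF X (sphere C p))).
    by rewrite double_susp_add !binvK.
  exists (fun X => additive_of (add X)).
  split=> [X|X Y f a]; first exact: binv_bij.
  apply: (bij_inj (@double_susp_bij R C F hF X (sphere C p))).
  by rewrite /= double_susp_nat !binvK susp_map_id.
- have -> : n' = Posz 0 by lia.
  exact: (swap 0%N).
- have -> : n' = Negz p by lia.
  exact: (swap p.+1).
Qed.

Definition cohomology_susp n :=
  projT1 (cid (@cohomology_susp_ex n (n + 1) erefl)).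

Lemma cohomology_susp_bij n X : bijective (cohomology_susp n X).
Proof. exact: (projT2 (cid (@cohomology_susp_ex n (n + 1) erefl))).1. Qed.

Lemma cohomology_susp_nat n X Y (f : smap0 R X Y)
    (a : cohomology_group (n + 1) (susp_obj Y)) :
  cohomology_susp n X
    (@cohomology_map (n + 1) (susp_obj X) (susp_obj Y) (susp_map f) a) =
  cohomology_map n f (cohomology_susp n Y a).
Proof. exact: (projT2 (cid (@cohomology_susp_ex n (n + 1) erefl))).2. Qed.

Lemma cohomology_map_id n X : cohomology_map n (idm X) =1 id.
Proof. by move=> a; rewrite cohomology_mapE iter_susp_map_id; exact: gact_id. Qed.

Lemma cohomology_map_comp n X Y Z (g : smap0 R Y Z) (f : smap0 R X Y) :
  cohomology_map n (compm g f) =1 cohomology_map n f \o cohomology_map n g.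
Proof.
by move=> a; rewrite /= iter_susp_map_comp gactl_comp.
Qed.

Lemma cohomology_map_homotopy n X Y (f g : smap0 R X Y) :
  pointed_homotopic f g -> cohomology_map n f =1 cohomology_map n g.
Proof.
move=> /pointed_homotopicW/(@homotopic_iter_susp _ _ (susp_index n) X Y f g) fg a.
exact: (act_homotopicl hF _ fg).
Qed.

Lemma cohomology_map_exact n A X (i : smap0 R A X) (hi : ng_inclusion i)
    (x : cohomology_group n X) :
  cohomology_map n i x = 0 <->
  exists a, @cohomology_map n X (cofiber_obj hi) (cofiber_inj i) a = x.
Proof. exact: iter_susp_coexact. Qed.

Definition cohomology : cohomology_theory C :=
  @MkCohomology R C cohomology_group cohomology_map cohomology_map_id
    cohomology_map_comp cohomology_susp cohomology_susp_bij cohomology_susp_nat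
    cohomology_map_homotopy cohomology_map_exact.

(** * Comparison *)

Lemma gadd_fold A Y (a b : G A Y) :
  a + b = pi_functor_add (T := partial_functor F A) (n := 0) a b.
Proof.
apply: (@natural_add R C F hF A (partial_functor F A) 0 (fun Y c => c)) => //.
by move=> X; exists id.
Qed.

Lemma iter_double_suspr j a b : exists phi : forall X,
    G (sphere C b) (iter_susp a X) -> G (sphere C (j + b)) (iter_susp (j + a) X),
  [/\ forall X, bijective (phi X), forall X, {morph phi X : x y / x + y} &
      forall X Y (f : smap0 R X Y) x,
        phi Y (gact (idm _) (iter_susp_map a f) x) =
        gact (idm _) (iter_susp_map (j + a) f) (phi X x)].
Proof.
elim: j => [|j [phi [bphi aphi nphi]]].
  by exists (fun X => id); split => // X; exists id.
exists (fun X x => double_susp (phi X x)); split.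
- by move=> X; apply: bij_comp => //; exact: double_susp_bij.
- by move=> X x y; rewrite aphi double_susp_add.
- by move=> X Y f x; rewrite nphi double_susp_nat susp_map_id.
Qed.

Lemma iter_double_suspl j a b : exists phi : forall X,
    G (iter_susp a X) (sphere C b) -> G (iter_susp (j + a) X) (sphere C (j + b)),
  [/\ forall X, bijective (phi X), forall X, {morph phi X : x y / x + y} &
      forall X Y (f : smap0 R X Y) x,
        phi X (gact (iter_susp_map a f) (idm _) x) =
        gact (iter_susp_map (j + a) f) (idm _) (phi Y x)].
Proof.
elim: j => [|j [phi [bphi aphi nphi]]].
  by exists (fun X => id); split => // X; exists id.
exists (fun X x => double_susp (phi X x)); split.
- by move=> X; apply: bij_comp => //; exact: double_susp_bij.
- by move=> X x y; rewrite aphi double_susp_add.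
- by move=> X Y f x; rewrite nphi double_susp_nat susp_map_id.
Qed.

(** The sphere is an iterated suspension of [S^0] in the contravariant
    variable. *)
Lemma homology_linear p : exists phi : forall X,
    G (sphere C p) X -> pi_functor (covariant_part F) p X,
  [/\ forall X, bijective (phi X),
      forall X a b, phi X (a + b) = pi_functor_add (phi X a) (phi X b) &
      forall X Y (f : smap0 R X Y) a,
        phi Y (gact (idm _) f a) = pi_functor_map f (phi X a)].
Proof.
have [psi [bpsi _ npsi]] := @iter_desusp p 0 p (esym (addn0 p)).
have nat X Y (f : smap0 R X Y) (a : G (sphere C p) X) :
    psi (S0_obj C) Y (gact (idm _) f a) =
    pi_functor_map (T := covariant_part F) f (psi (S0_obj C) X a).
  have := npsi (S0_obj C) (S0_obj C) X Y (idm _) f a.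
  by rewrite iter_susp_map_id.
exists (fun X => psi (S0_obj C) X).
split=> [X|X a b|//]; first exact: bpsi.
apply: (@natural_add R C F hF (sphere C p) (covariant_part F) p
  (fun X => psi (S0_obj C) X)) => // Y; exact: bpsi.
Qed.

End theories.

Theorem theorem7p3 (R : realType) (C : subcat R) (F : bifunctor C)
    (hF : bilinear_functor F) :
  exists (h : homology_theory C) (c : cohomology_theory C),
    [/\ forall (n : int) (k m : nat), n + k%:Z = m%:Z ->
          exists phi : forall X : obj C,
              h n X -> pi_functor (partial_functor F (sphere C m)) 0 (iter_susp k X),
            [/\ forall X, bijective (phi X),
                forall X (a b : h n X),
                  phi X (a + b) = pi_functor_add (phi X a) (phi X b) &
                forall (X Y : obj C) (f : smap0 R X Y) (a : h n X),
                  phi Y (hmap h n f a) =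
                  pi_functor_map (iter_susp_map k f) (phi X a)],
        forall (n : int) (k m : nat), n + k%:Z = m%:Z ->
          exists phi : forall X : obj C,
              c n X -> pi_functor (partial_functor F (iter_susp k X)) 0 (sphere C m),
            [/\ forall X, bijective (phi X),
                forall X (a b : c n X),
                  phi X (a + b) = pi_functor_add (phi X a) (phi X b) &
                forall (X Y : obj C) (f : smap0 R X Y) (a : c n Y),
                  phi X (cmap c n f a) =
                  pi_mor (bmor F (iter_susp_map k f) (idm (sphere C m)))
                    (phi Y a)] &
        forall n : int,
          exists phi : forall X : obj C,
              h n X -> linear_homology (covariant_part F) n X,
            [/\ forall X, bijective (phi X),
                forall X (a b : h n X),
                  phi X (a + b) = linear_homology_add (phi X a) (phi X b) &
                forall (X Y : obj C) (f : smap0 R X Y) (a : h n X),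
                  phi Y (hmap h n f a) = linear_homology_map f (phi X a)]].
Proof.
exists (homology hF), (cohomology hF); split.
- move=> n k m /shift_index[j -> ->].
  have [phi [bphi aphi nphi]] := iter_double_suspr hF j (susp_index n) (sphere_index n).
  exists phi; split => // X a b.
  by rewrite aphi gadd_fold.
- move=> n k m /shift_index[j -> ->].
  have [phi [bphi aphi nphi]] := iter_double_suspl hF j (susp_index n) (sphere_index n).
  exists phi; split => // X a b.
  by rewrite aphi gadd_fold.
- case=> p.
    have [phi [bphi aphi nphi]] := homology_linear hF p.
    by exists phi; split.
  exists (fun X a => a); split => // [X|X a b]; first by exists id.
  exact: gadd_fold.
Qed.
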